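(* Let $X\subset\mathbb{P}^n$ be an irreducible variety and let $\ell\in\{0,1,\dots,n-1\}$. Under the isomorphism $\mathrm{Gr}(\ell,\mathbb{P}^n)\cong \mathrm{Gr}(n-\ell-1,(\mathbb{P}^n)^* )$, $L\mapsto L^\vee$, the strongly coisotropic variety $\mathcal{G}_\ell(X)\subset\mathrm{Gr}(\ell,\mathbb{P}^n)$ associated to $X$ is the strongly coisotropic variety $\mathcal{G}_{n-\ell-1}(X^\vee)\subset\mathrm{Gr}(n-\ell-1,(\mathbb{P}^n)^* )$ associated to the projectively dual variety $X^\vee\subset(\mathbb{P}^n)^*$; that is, $\{L^\vee\mid L\in\mathcal{G}_\ell(X)\}=\mathcal{G}_{n-\ell-1}(X^\vee)$.
   Context: $\mathbb{K}$ is an algebraically closed field of characteristic zero, $\mathbb{P}^n=\mathbb{P}(\mathbb{K}^{n+1})$, $(\mathbb{P}^n)^*=\mathbb{P}((\mathbb{K}^{n+1})^* )$. $\mathrm{Reg}(X)$ is the smooth locus of $X$, $\mathbb{T}_{X,x}$ the embedded tangent space of $X$ at $x\in\mathrm{Reg}(X)$, and $L_1+L_2$ the projective span. For a projective subspace $L\subset\mathbb{P}^n$ with affine cone $\hat L\subset \mathbb{K}^{n+1}$, $L^\vee=\mathbb{P}(\mathrm{Ann}(\hat L))\subset(\mathbb{P}^n)^*$. A hyperplane $H\subset\mathbb{P}^n$ thus corresponds to a point $H^\vee\in(\mathbb{P}^n)^*$. The projectively dual variety of $X$ is $$X^\vee=\overline{\{H^\vee\mid H\subset\mathbb{P}^n\text{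 hyperplane},\ \exists p\in\mathrm{Reg}(X):\ \mathbb{T}_{X,p}\subset H\}}\subset(\mathbb{P}^n)^*$$ (in particular $(\mathbb{P}^n)^\vee=\emptyset$). The $\ell$-th higher associated variety of $X$, which is the strongly coisotropic variety in $\mathrm{Gr}(\ell,\mathbb{P}^n)$ associated to $X$, is $$\mathcal{G}_\ell(X)=\overline{\{L\in\mathrm{Gr}(\ell,\mathbb{P}^n)\mid\exists x\in\mathrm{Reg}(X)\cap L:\ \dim(L+\mathbb{T}_{X,x})<n\}},$$ and similarly for subvarieties of $(\mathbb{P}^n)^*$ (with $\mathcal{G}_\ell(\emptyset)=\emptyset$). $\mathrm{Gr}(\ell,\mathbb{P}^n)$ is the Grassmannian of $\ell$-dimensional projective subspaces. *)

(* Defs.v *)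
From mathcomp Require Export all_boot all_order all_algebra.
From mathcomp Require Export mpoly.
From mathcomp Require Export boolp classical_sets.

Set Implicit Arguments.
Unset Strict Implicit.
Unset Printing Implicit Defensive.

Import GRing.Theory.

Local Open Scope classical_set_scope.
Local Open Scope ring_scope.

(* A projective subspace of P(K^N) is represented by its affine cone, a        *)
(* {vspace 'rV[K]_N}; its projective dimension is \dim - 1. In particular the  *)
(* points of P(K^N) are the subspaces of dimension 1, and Gr(l, P(K^N)) is     *)
(* the set of subspaces of dimension l + 1.                                    *)
(*                                                                             *)
(* A linear form on K^N is represented by the row of its coefficients in the   *)
(* dual basis, so (K^N)^* is again 'rV[K]_N, with pairing phi *m v^T.          *)

Section Subspaces.
Variables (K : fieldType) (N : nat).
Implicit Types (S : set 'rV[K]_N) (L : {vspace 'rV[K]_N}).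

(* The junk value 0 is never taken when S is a linear subspace: vspace_ofP. *)
Definition vspace_of S : {vspace 'rV[K]_N} :=
  xget 0%VS [set U : {vspace 'rV[K]_N} | forall v, v \in U <-> S v].

Lemma vspace_ofP S :
    S 0 -> (forall (a : K) u v, S u -> S v -> S (a *: u + v)) ->
  forall v, v \in vspace_of S <-> S v.
Proof.
move=> S0 SD.
suff [U HU] : exists U : {vspace 'rV[K]_N}, forall v, v \in U <-> S v.
  by rewrite /vspace_of; case: xgetP => [V _ //|/(_ U)]; case.
have H m : forall U : {vspace 'rV[K]_N}, (forall v, v \in U -> S v) ->
    (\dim {:'rV[K]_N} - \dim U < m)%N ->
    exists U' : {vspace 'rV[K]_N}, forall v, v \in U' <-> S v.
  elim: m => // m IH U US ltm.
  have [SU|] := pselect (forall v, S v -> v \in U).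
    by exists U => v; split; [exact: US|exact: SU].
  move=> /existsNP[v /not_implyP[Sv /negP vU]].
  apply: (IH (<[v]> + U)%VS) => [w /memv_addP[_ /vlineP[a ->] [u uU ->]]|].
    by apply: SD => //; exact: US.
  have ltd : (\dim U < \dim (<[v]> + U))%N.
    rewrite (ltn_leqif (dimv_leqif_sup (addvSr _ _))) subv_add subvv andbT.
    by rewrite -memvE.
  have le3 := dimvS (subvf (<[v]> + U)%VS).
  by rewrite -ltnS (leq_trans _ ltm) // ltnS ltn_sub2l // (leq_trans ltd).
apply: (H (\dim {:'rV[K]_N}).+1 0%VS) => [v|].
  by rewrite memv0 => /eqP ->.
by rewrite ltnS leq_subr.
Qed.

(* L |-> L^\vee, the annihilator of L *)
Definition dual_subspace L : {vspace 'rV[K]_N} :=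
  vspace_of [set phi | forall v, v \in L -> phi *m v^T = 0].

Lemma mem_dual_subspace L phi :
  phi \in dual_subspace L <-> forall v, v \in L -> phi *m v^T = 0.
Proof.
apply: vspace_ofP => [v _|a u v hu hv w wL]; first by rewrite mul0mx.
by rewrite mulmxDl -scalemxAl hu // hv // scaler0 addr0.
Qed.

End Subspaces.

Section ProjectiveVarieties.
Variables (K : fieldType) (N : nat).
Implicit Types (X Y Z : set {vspace 'rV[K]_N}) (x p L H : {vspace 'rV[K]_N}).

Definition proj_points : set {vspace 'rV[K]_N} := [set x | \dim x = 1%N].

Definition homogeneous n (f : {mpoly K[n]}) : Prop := exists d, f \is d.-homog.

Definition vanishes_at (f : {mpoly K[N]}) x : Prop :=
  forall v, v \in x -> f.@[fun i => v 0 i] = 0.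

Definition proj_closed Z : Prop :=
  exists2 F : set {mpoly K[N]}, F `<=` @homogeneous N
    & Z = proj_points `&` [set x | forall f, F f -> vanishes_at f x].

Definition proj_closure : set {vspace 'rV[K]_N} -> set {vspace 'rV[K]_N} :=
  smallest proj_closed.

Definition irreducible_variety Z : Prop :=
  [/\ proj_closed Z, Z !=set0
    & forall A B, proj_closed A -> proj_closed B -> Z = A `|` B ->
        Z = A \/ Z = B].

(* C 0 < C 1 < ... < C d, all irreducible and contained in X *)
Definition irreducible_chain X (d : nat) (C : nat -> set {vspace 'rV[K]_N}) :=
  [/\ forall i, (i <= d)%N -> irreducible_variety (C i),
      forall i, (i < d)%N -> C i `<` C i.+1
    & C d `<=` X].

Definition has_krull_dim X (d : nat) : Prop :=
  (exists C, irreducible_chain X d C) /\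
  (forall e C, irreducible_chain X e C -> (e <= d)%N).

(* The local dimension at x: the largest dimension of an irreducible closed    *)
(* subset of X through x (for irreducible X this is just the dimension of X).  *)
Definition has_local_dim X x (d : nat) : Prop :=
  (exists Z, [/\ irreducible_variety Z, Z `<=` X, Z x & has_krull_dim Z d]) /\
  (forall Z e, irreducible_variety Z -> Z `<=` X -> Z x ->
     has_krull_dim Z e -> (e <= d)%N).

(* The embedded tangent space at x: common kernel of the differentials at x of *)
(* the homogeneous polynomials in the vanishing ideal of X.                    *)
Definition tangent_space X x : {vspace 'rV[K]_N} :=
  vspace_of [set v | forall f : {mpoly K[N]}, homogeneous f ->
    (forall y, X y -> vanishes_at f y) ->
    forall w, w \in x -> \sum_i (f^`M(i)).@[fun j => w 0 j] * v 0 i = 0].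

Lemma mem_tangent_space X x v :
  v \in tangent_space X x <->
  forall f : {mpoly K[N]}, homogeneous f ->
    (forall y, X y -> vanishes_at f y) ->
    forall w, w \in x -> \sum_i (f^`M(i)).@[fun j => w 0 j] * v 0 i = 0.
Proof.
move: v; apply: vspace_ofP => [f _ _ w _|a u v hu hv f hf fX w wx].
  by apply: big1 => i _; rewrite mxE mulr0.
transitivity (a * \sum_i (f^`M(i)).@[fun j => w 0 j] * u 0 i
                + \sum_i (f^`M(i)).@[fun j => w 0 j] * v 0 i); last first.
  by rewrite hu // hv // mulr0 addr0.
rewrite mulr_sumr -big_split; apply: eq_bigr => i _ /=.
by rewrite !mxE mulrDr mulrCA.
Qed.

(* \dim is a vector space dimension, hence the successor. *)
Definition Reg X : set {vspace 'rV[K]_N} :=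
  [set x | X x /\ exists2 d, has_local_dim X x d & \dim (tangent_space X x) = d.+1].

(* X^\vee; hyperplanes are the H with \dim H + 1 = N *)
Definition dual_variety X : set {vspace 'rV[K]_N} :=
  proj_closure [set dual_subspace H | H in
    [set H | (\dim H).+1 = N /\
             exists2 p, Reg X p & (tangent_space X p <= H)%VS]].

End ProjectiveVarieties.

Section Grassmannians.
Variables (K : fieldType) (N k : nat).

(* The Pluecker coordinates of the span of the rows of A: all k x k minors.    *)
(* They are indexed by arbitrary k-tuples of columns; those with repetitions   *)
(* vanish and reordering a tuple only changes the sign.                        *)
Definition plucker (A : 'M[K]_(k, N)) (i : 'I_#|{ffun 'I_k -> 'I_N}|) : K :=
  \det (\matrix_(a, b) A a ((enum_val i : {ffun 'I_k -> 'I_N}) b)).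

Definition grassmannian : set {vspace 'rV[K]_N} := [set U | \dim U = k].

Definition plucker_vanishes_at (f : {mpoly K[#|{ffun 'I_k -> 'I_N}|]})
    (U : {vspace 'rV[K]_N}) : Prop :=
  forall A : 'M[K]_(k, N), basis_of U [seq row a A | a <- enum 'I_k] ->
    f.@[plucker A] = 0.

(* Zariski topology induced by the Pluecker embedding *)
Definition gr_closed (Z : set {vspace 'rV[K]_N}) : Prop :=
  exists2 F : set {mpoly K[#|{ffun 'I_k -> 'I_N}|]}, F `<=` @homogeneous K _
    & Z = grassmannian `&` [set U | forall f, F f -> plucker_vanishes_at f U].

Definition gr_closure : set {vspace 'rV[K]_N} -> set {vspace 'rV[K]_N} :=
  smallest gr_closed.

End Grassmannians.

(* The higher associated variety G_l(X); \dim (L + T) < N says that the        *)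
(* projective span of L and T is not the whole of P(K^N).                      *)
Definition associated_variety (K : fieldType) (N l : nat)
    (X : set {vspace 'rV[K]_N}) : set {vspace 'rV[K]_N} :=
  gr_closure l.+1 [set L | \dim L = l.+1 /\
    exists x, [/\ Reg X x, (x <= L)%VS & (\dim (L + tangent_space X x) < N)%N]].

(* Main.v *)
(* The conormal variety of X consists of the pairs (w, phi) with w a smooth    *)
(* point of the cone over X and phi a linear form vanishing on the tangent     *)
(* space at w; a subspace L belongs to G_l(X) before closure iff w is in L and *)
(* phi vanishes on L for some such pair. This incidence is symmetric under     *)
(* L |-> L^\vee, so everything reduces to biduality: the conormal varieties of *)
(* X and of X^\vee agree up to exchanging w and phi. At a generic point        *)
(* (xi, eta), a tangent vector (a, b) satisfies eta.a = 0, and differentiating *)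
(* phi.w = 0 gives b.xi = 0; since in characteristic zero tangent vectors lift *)
(* along dominant maps, xi annihilates the tangent space of X^\vee at eta. This*)
(* gives one inclusion, and both sides are irreducible of affine dimension N.  *)
(*                                                                             *)
(* Dimension is measured as the dimension of the space of tangent vectors at a *)
(* generic point (equivalently, of derivations of the function field). One     *)
(* elimination step over a minimal relation of the last coordinate yields the  *)
(* lifting of tangent vectors, the specialization of generic points to         *)
(* K-points (whence the Nullstellensatz), and the comparison with Krull        *)
(* dimension that identifies Reg X with the points of minimal tangent space.   *)
From HB Require Import structures.
Require Import Defs.
From mathcomp Require Import perm ring.

Set Implicit Arguments.
Unset Strict Implicit.
Unset Printing Implicit Defensive.

Import GRing.Theory.

Local Open Scope classical_set_scope.
Local Open Scope ring_scope.

(** * Polynomials in one variable over a domain: relations, derivations, specializations *)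

(** Call [(w, phi)] a conormal pair of X when w spans a smooth point of X and phi is a nonzero form
    vanishing on the tangent space there. A hyperplane containing both L and a tangent space is the
    kernel of such a phi, so before closure L is in the associated variety iff it contains w and is
    annihilated by phi for some pair ([associated_incidence]). Taking annihilators exchanges the
    roles of w and phi, and three facts remain.

    Biduality ([conormal_duality]): the conormal ideals of X and of its dual agree after swapping
    the two blocks of variables. One inclusion comes from differentiating the pairing at a generic
    point ([conormal_swap_sub]). It is an equality because both ideals are primes of dimension N
    ([conormal_dim]) and nested primes of equal dimension coincide ([tangent_dim_eq]).

    Closures only see ideals ([incidence_closure]): the pairs of X and the swapped pairs of the dual
    are different sets, since smoothness is required on different sides, but the same polynomials
    vanish on both. A frame of L deforms polynomially with its pair, which turns Pluecker equations
    into polynomials in the pair.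

    Annihilation carries closures to closures ([dual_gr_closure]), because complementary minors of a
    space and of its annihilator agree up to sign and a common factor.

    The infinitesimal notion of dimension rests on two one-variable statements,
    [derivation_extension] and [specialization_extension]; iterated, they become [tangent_extension]
    and [specialization_lifting]. [hyperplane_section] ties this dimension to chains of irreducible
    sets, so that [regular_point_dense] speaks of [Reg] as defined. *)

Lemma size_sub_lead (R : nzRingType) (p : {poly R}) :
  p != 0 -> (size (p - lead_coef p *: 'X^((size p).-1))%R < size p)%N.
Proof.
move=> pn0; rewrite -[X in (_ < X)%N]prednK ?size_poly_gt0 // ltnS.
apply/leq_sizeP => j lej; rewrite coefB coefZ coefXn.
move: lej; rewrite leq_eqVlt => /orP[/eqP<-|ltj]; first by rewrite eqxx mulr1 subrr.
rewrite gtn_eqF // mulr0 subr0 nth_default //.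
by move: ltj; rewrite prednK ?size_poly_gt0.
Qed.

Section OneVariable.
Variables (A : idomainType) (F : fieldType) (e : {rmorphism A -> F}) (t : F).
Hypothesis charF0 : [pchar F] =i pred0.

Definition evp (p : {poly A}) : F := (map_poly e p).[t].

Lemma evpD p q : evp (p + q) = evp p + evp q.
Proof. by rewrite /evp rmorphD hornerD. Qed.
Lemma evpM p q : evp (p * q) = evp p * evp q.
Proof. by rewrite /evp rmorphM hornerM. Qed.
Lemma evpC a : evp a%:P = e a.
Proof. by rewrite /evp map_polyC hornerC. Qed.

(** [e] may have a kernel, so nontriviality is tested on the image, while the size that is minimized
    is that of the polynomial over [A]. *)
Definition minimal_relation (p : {poly A}) :=
  [/\ evp p = 0, map_poly e p != 0
    & forall q, evp q = 0 -> (size q < size p)%N -> map_poly e q = 0].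

Lemma minimal_relation_exists p :
  evp p = 0 -> map_poly e p != 0 -> exists q, minimal_relation q.
Proof.
have [n] := ubnP (size p); elim: n p => // n IH p; rewrite ltnS => szp p0 pn0.
have [[q [q0 ltqp qn0]]|H] := pselect (exists q, [/\ evp q = 0,
  (size q < size p)%N & map_poly e q != 0]).
  by apply: (IH q) => //; apply: leq_trans szp.
exists p; split=> // q q0 ltqp; apply/eqP/negPn/negP => qn0.
by apply: H; exists q.
Qed.

Section Minimal.
Variable p : {poly A}.
Hypothesis minp : minimal_relation p.

(** If [e] killed the leading coefficient, dropping the leading term would give a shorter relation
    with the same image. *)
Lemma minimal_lead_neq0 : e (lead_coef p) != 0.
Proof.
have [p0 pn0 H] := minp; apply/negP => /eqP l0.
have pnz : p != 0 by apply: contraNneq pn0 => ->; rewrite map_poly0.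
have eqp : map_poly e (p - lead_coef p *: 'X^((size p).-1)) = map_poly e p.
  by rewrite rmorphB /= map_polyZ l0 scale0r subr0.
case/eqP: pn0; rewrite -eqp; apply: H; first by rewrite /evp eqp.
exact: size_sub_lead.
Qed.

Lemma minimal_size_gt1 : (1 < size p)%N.
Proof.
have [p0 pn0 H] := minp; rewrite ltnNge; apply/negP => /size1_polyC eqp.
by move: p0 pn0; rewrite eqp evpC map_polyC /= => ->; rewrite eqxx.
Qed.

(** This is separability. The derivative is shorter than [p], so if it vanished at [t] then [e]
    would kill it, although its top coefficient survives in characteristic zero. *)
Lemma minimal_deriv_neq0 : evp p^`() != 0.
Proof.
have [p0 pn0 H] := minp; apply/negP => /eqP d0.
have sz := minimal_size_gt1.
have := H _ d0 (lt_size_deriv _); rewrite -size_poly_gt0 (ltn_trans _ sz) // => /(_ isT).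
move/polyP/(_ (size p).-2); rewrite coef_map coef_deriv coef0 /= rmorphMn /=.
have -> : (size p).-2.+1 = (size p).-1 by case: (size p) sz => [|[]].
move/eqP; rewrite -mulr_natr mulf_eq0 -lead_coefE (negPf minimal_lead_neq0) /=.
by case: (size p) sz => [|[|k]] // _; rewrite (pcharf0P _).1.
Qed.

(** The pseudo-remainder is a relation shorter than [p], hence killed by [e]. So [p] generates all
    relations, up to powers of its leading coefficient and the kernel of [e]. *)
Lemma minimal_division q : evp q = 0 ->
  exists s r1 r2, [/\ lead_coef p ^+ s *: q = r1 * p + r2 & map_poly e r2 = 0].
Proof.
have [p0 pn0 H] := minp => q0.
have pnz : p != 0 by apply: contraNneq pn0 => ->; rewrite map_poly0.
exists (scalp q p), (q %/ p), (q %% p); split; first exact: Pdiv.Idomain.divp_eq.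
apply: H; last by rewrite ltn_modp.
have := congr1 evp (Pdiv.Idomain.divp_eq q p).
by rewrite -mul_polyC evpD !evpM evpC q0 p0 !mulr0 add0r.
Qed.

End Minimal.

Variant relation_spec : Prop :=
| RelationTranscendental of (forall q, evp q = 0 -> map_poly e q = 0)
| RelationAlgebraic p of minimal_relation p.

Lemma relationP : relation_spec.
Proof.
have [H|] := pselect (forall q, evp q = 0 -> map_poly e q = 0).
  exact: RelationTranscendental.
move=> /existsNP[q /not_implyP[q0 /eqP qn0]].
by have [p] := minimal_relation_exists q0 qn0; exact: RelationAlgebraic.
Qed.

Definition derivation (B : nzRingType) (h : B -> F) (D : B -> F) :=
  (forall a b, D (a + b) = D a + D b) /\
  (forall a b, D (a * b) = D a * h b + h a * D b).

Section DerivationTheory.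
Variables (B : nzRingType) (h : {rmorphism B -> F}) (D : B -> F).
Hypothesis dD : derivation h D.

Lemma derivation0 : D 0 = 0.
Proof. by apply: (addrI (D 0)); rewrite -dD.1 !addr0. Qed.
Lemma derivation1 : D 1 = 0.
Proof. by apply: (addrI (D 1)); rewrite -{3}[1]mulr1 dD.2 !rmorph1 mulr1 mul1r addr0. Qed.
Lemma derivationN a : D (- a) = - D a.
Proof. by apply: (addrI (D a)); rewrite -dD.1 !subrr derivation0. Qed.
Lemma derivation_sum I (r : seq I) P E : D (\sum_(i <- r | P i) E i) = \sum_(i <- r | P i) D (E i).
Proof. by apply: big_morph; [exact: dD.1 | exact: derivation0]. Qed.
Lemma derivationX a n : D (a ^+ n) = h a ^+ n.-1 * D a *+ n.
Proof.
elim: n => [|n IH]; first by rewrite expr0 derivation1 mulr0n.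
rewrite exprS dD.2 IH rmorphXn /= mulrnAr mulrA mulrC mulrS; congr (_ + _).
by case: n {IH} => [|n]; rewrite ?mulr0n //= -exprS.
Qed.
End DerivationTheory.

(** An extension is determined by its value [tau] on the variable. If [t] is transcendental any
    [tau] is allowed; otherwise the minimal relation forces [tau], and the nonvanishing of its
    derivative at [t] makes the equation solvable. *)
Lemma derivation_extension (D : A -> F) :
    derivation e D -> (forall a, e a = 0 -> D a = 0) ->
  exists D' : {poly A} -> F, [/\ derivation evp D', forall a, D' a%:P = D a
    & forall q, evp q = 0 -> D' q = 0].
Proof.
move=> dD Dker; have D0 : D 0 = 0 by apply: Dker; rewrite rmorph0.
pose DD (tau : F) (q : {poly A}) := (map_poly D q).[t] + tau * evp q^`().
have DDE tau (q : {poly A}) n : (size q <= n)%N -> DD tau q =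
  \sum_(i < n) D q`_i * t ^+ i + tau * evp q^`().
  move=> szq; rewrite /DD; congr (_ + _).
  rewrite (@horner_coef_wide _ n) ?(leq_trans (size_poly _ _)) //.
  by apply: eq_bigr => i _; rewrite coef_map_id0.
have DDC tau a : DD tau a%:P = D a.
  by rewrite (@DDE _ _ 1%N) ?size_polyC ?leq_b1 // big_ord1 coefC eqxx expr0 mulr1 derivC /evp
    map_poly0 horner0 mulr0 addr0.
have DDX tau : DD tau 'X = tau.
  rewrite (@DDE _ _ 2%N) ?size_polyX // !big_ord_recr big_ord0 /= !coefX /= D0 (derivation1 dD).
  by rewrite !mul0r !add0r derivX /evp rmorph1 hornerC mulr1.
have DDadd tau p q : DD tau (p + q) = DD tau p + DD tau q.
  rewrite /DD derivD evpD mulrDr addrACA -hornerD; congr ((_).[_] + _).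
  by apply/polyP=> i; rewrite coefD !coef_map_id0 // coefD dD.1.
have DDmulX tau p : DD tau (p * 'X) = DD tau p * t + evp p * tau.
  rewrite /DD derivM derivX mulr1 evpD evpM [evp 'X]/evp map_polyX hornerX.
  have -> : map_poly D (p * 'X) = map_poly D p * 'X.
    by apply/polyP=> i; rewrite coef_map_id0 // !coefMX; case: i => [|i] //=; rewrite coef_map_id0.
  by rewrite hornerMX [tau * (_ + _)]mulrDr mulrDl !addrA mulrA [tau * evp p]mulrC.
have DDmulC tau a q : DD tau (a%:P * q) = D a * evp q + e a * DD tau q.
  elim/poly_ind: q => [|q c IH].
    by rewrite mulr0 -polyC0 DDC D0 evpC rmorph0 !mulr0 addr0.
  rewrite mulrDr !DDadd mulrA DDmulX IH -polyCM !DDC dD.2 evpD !evpM !evpC DDmulX.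
  by rewrite [evp 'X]/evp map_polyX hornerX; ring.
have DDmul tau p q : DD tau (p * q) = DD tau p * evp q + evp p * DD tau q.
  elim/poly_ind: p => [|p c IH].
    by rewrite mul0r -polyC0 DDC D0 evpC rmorph0 !mul0r addr0.
  rewrite mulrDl !DDadd -mulrA ['X * q]mulrC mulrA DDmulX IH DDmulC DDmulX DDC.
  by rewrite evpD !evpM evpC [evp 'X]/evp map_polyX hornerX; ring.
have DDder tau : derivation evp (DD tau) by split.
have DDker tau q : map_poly e q = 0 -> DD tau q = 0.
  move=> q0; have eq0 i : e q`_i = 0 by rewrite -coef_map q0 coef0.
  rewrite /DD.
  have -> : map_poly D q = 0 by apply/polyP=> i; rewrite coef_map_id0 // coef0 Dker.
  by rewrite /evp -deriv_map q0 deriv0 !horner0 mulr0 addr0.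
case: relationP => [tr|p minp].
  by exists (DD 0); split=> // q /tr; exact: DDker.
pose tau := - (map_poly D p).[t] / evp p^`().
have dn0 := minimal_deriv_neq0 minp.
have DDp : DD tau p = 0 by rewrite /DD /tau mulfVK // subrr.
exists (DD tau); split=> // q q0.
have [s [r1 [r2 [eqq r20]]]] := minimal_division minp q0.
have [p0 _ _] := minp.
have := congr1 (DD tau) eqq; rewrite -mul_polyC DDmul DDadd DDmul DDp p0 (DDker _ _ r20) q0 evpC.
rewrite !mulr0 !addr0 add0r => /eqP; rewrite mulf_eq0 rmorphXn expf_eq0.
by rewrite (negPf (minimal_lead_neq0 minp)) andbF => /eqP.
Qed.

(** If [t] is transcendental, [a] is a coefficient of [b] and [tau] a non-root of the specialized
    [b]. Otherwise [tau] is a root of the specialized minimal relation, and [a] is the product of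
    its leading coefficient with a constant of the form [u + v b], [u] a relation; a nonzero value
    of that constant prevents [b] from vanishing at [tau]. *)
Lemma specialization_extension (b : {poly A}) : evp b != 0 ->
  exists2 a : A, e a != 0 &
    forall (K : closedFieldType) (phi : {rmorphism A -> K}),
      (forall c, e c = 0 -> phi c = 0) -> phi a != 0 ->
    exists tau : K, (forall q, evp q = 0 -> (map_poly phi q).[tau] = 0)
                    /\ (map_poly phi b).[tau] != 0.
Proof.
move=> bn0; case: relationP => [tr|p minp].
  have [i bi] : exists i, e b`_i != 0.
    apply/not_existsP => H; case/eqP: bn0; rewrite /evp (_ : map_poly e b = 0) ?horner0 //.
    by apply/polyP => i; rewrite coef_map coef0 /=; apply/eqP/negPn/negP; exact: H.
  exists b`_i => // K phi kerphi phibi.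
  have /closed_nonrootP[tau ntau] : map_poly phi b != 0.
    by apply: contraNneq phibi => b0; rewrite -coef_map b0 coef0.
  exists tau; split=> [q /tr q0|//].
  rewrite (_ : map_poly phi q = 0) ?horner0 //; apply/polyP => j.
  by rewrite coef_map coef0 /= kerphi // -coef_map q0 coef0.
have [p0 pn0 minsz] := minp.
(* combinations u + v b with u a relation; one of minimal size is a constant *)
pose comb (c : {poly A}) := exists u v :
  {poly A}, [/\ c = u + v * b, evp u = 0 & map_poly e c != 0].
have combP : exists c : {poly A}, comb c /\ forall c' : {poly A}, (size c' < size c)%N -> ~ comb c'.
  have : comb p by exists p, 0; rewrite mul0r addr0.
  have [n] := ubnP (size p); move: {p0 pn0 minsz minp}p.
  elim: n => // n IH p; rewrite ltnS => szp cp.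
  have [[q [ltqp cq]]|H] := pselect (exists q : {poly A}, (size q < size p)%N /\ comb q).
    by apply: (IH q) => //; apply: leq_trans szp.
  by exists p; split=> // q ltqp cq; apply: H; exists q.
have [c [[u [v [cE u0 cn0]]] minc]] := combP.
have cnz : c != 0 by apply: contraNneq cn0 => ->; rewrite map_poly0.
have rem_ker (q : {poly A}) : (exists u v :
  {poly A}, q = u + v * b /\ evp u = 0) -> map_poly e (q %% c) = 0.
  move=> [u' [v' [qE u'0]]]; apply/eqP/negPn/negP => rn0.
  have /minc : (size (q %% c)%R < size c)%N by rewrite ltn_modp.
  apply; exists ((lead_coef c ^+ scalp q c)%:P * u' - (q %/ c) * u),
                ((lead_coef c ^+ scalp q c)%:P * v' - (q %/ c) * v); split=> //.
    have -> : q %% c = (lead_coef c ^+ scalp q c)%:P * q - (q %/ c) * c.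
      by rewrite mul_polyC Pdiv.Idomain.divp_eq addrC addKr.
    move: (lead_coef c ^+ _)%:P (q %/ c) => l k; rewrite cE qE; ring.
  by rewrite evpD -mulNr !evpM u'0 u0 !mulr0 addr0.
have clead : e (lead_coef c) != 0.
  apply/negP => /eqP l0.
  have eqc : map_poly e (c - lead_coef c *: 'X^((size c).-1)) = map_poly e c.
    by rewrite rmorphB /= map_polyZ l0 scale0r subr0.
  have /minc := size_sub_lead cnz; apply.
  exists (u - lead_coef c *: 'X^((size c).-1)), v; split.
  - by rewrite cE addrAC.
  - by rewrite evpD u0 add0r /evp rmorphN /= map_polyZ l0 scale0r oppr0 horner0.
  - by rewrite eqc.
have ecn0 : evp c != 0.
  apply/negP => /eqP c0.
  have := congr1 evp (Pdiv.Idomain.divp_eq b c).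
  rewrite -mul_polyC evpD !evpM c0 evpC mulr0 add0r [X in _ = X]/evp rem_ker; last first.
    by exists 0, 1; rewrite mul1r add0r /evp rmorph0 horner0.
  rewrite horner0 => /eqP; rewrite mulf_eq0 rmorphXn expf_eq0 (negPf clead) andbF /=.
  by rewrite (negPf bn0).
(* Up to a factor and the kernel of [e], [c] divides [p]. If [c] were not constant, the quotient
   would be shorter than [p] and still vanish at [t], against minimality. *)
have szc : size c = 1%N.
  apply/eqP; rewrite eqn_leq size_poly_gt0 cnz andbT leqNgt; apply/negP => sz1.
  have pker : map_poly e (p %% c) = 0 by apply: rem_ker; exists p, 0; rewrite mul0r addr0.
  have eqpc := Pdiv.Idomain.divp_eq p c.
  have q0 : evp (p %/ c) = 0.
    have := congr1 evp eqpc; rewrite -mul_polyC evpD !evpM p0 mulr0 [evp (p %% c)]/evp pker.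
    by rewrite horner0 addr0 => /esym/eqP; rewrite mulf_eq0 (negPf ecn0) orbF => /eqP.
  have qz : map_poly e (p %/ c) = 0.
    apply: minsz => //; rewrite size_divp //; have := minimal_size_gt1 minp.
    by case: (size p) => // k _; case: (size c) sz1 => [|[|l]] // _; rewrite /= subSS ltnS leq_subr.
  have := congr1 (map_poly e) eqpc; rewrite rmorphD rmorphM /= qz pker mul0r addr0 map_polyZ.
  move/eqP; rewrite rmorphXn /= scaler_eq0 (negPf pn0) orbF expf_eq0.
  by rewrite (negPf clead) andbF.
have [c0 cE0] : exists c0, c = c0%:P by exists c`_0; apply: size1_polyC; rewrite szc.
have c0n0 : e c0 != 0 by rewrite -evpC -cE0.
exists (lead_coef p * c0); first by rewrite rmorphM mulf_neq0 // (minimal_lead_neq0 minp).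
move=> K phi kerphi; rewrite rmorphM mulf_eq0 negb_or => /andP[lpn0 c0phi].
have szphi : size (map_poly phi p) = size p by rewrite size_map_poly_id0.
have /closed_rootP[tau /rootP rtau] : size (map_poly phi p) != 1%N.
  by rewrite szphi; case: (size p) (minimal_size_gt1 minp) => [|[]].
have van q : evp q = 0 -> (map_poly phi q).[tau] = 0.
  move=> /(minimal_division minp)[s [r1 [r2 [eqq r20]]]].
  have r2phi : map_poly phi r2 = 0.
    by apply/polyP => j; rewrite coef_map coef0 /= kerphi // -coef_map r20 coef0.
  have := congr1 (fun q => (map_poly phi q).[tau]) eqq.
  rewrite /= rmorphD rmorphM /= map_polyZ r2phi addr0 hornerM rtau mulr0 hornerZ rmorphXn /=.
  by move/eqP; rewrite mulf_eq0 expf_eq0 (negPf lpn0) andbF => /eqP.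
exists tau; split=> //; apply: contraNneq c0phi => btau.
have := congr1 (fun q => (map_poly phi q).[tau]) cE.
by rewrite cE0 /= map_polyC hornerC rmorphD rmorphM hornerD hornerM (van _ u0) btau mulr0 addr0
  => ->.
Qed.

End OneVariable.

(** * Tangent vectors at a point with coordinates in an extension field *)

Lemma mpoly_morph_eq m (R : nzRingType) (S : comNzRingType)
    (f g : {rmorphism {mpoly R[m]} -> S}) :
  (forall c, f c%:MP = g c%:MP) -> (forall i, f 'X_i = g 'X_i) -> f =1 g.
Proof.
move=> eqC eqX p; rewrite (mpolyE p) !raddf_sum; apply: eq_bigr => k _ /=.
rewrite -mul_mpolyC !rmorphM /= eqC mpolyXE_id !rmorph_prod /=; congr (_ * _).
by apply: eq_bigr => i _; rewrite !rmorphXn /= eqX.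
Qed.

Section Subst.
Variables (R : comNzRingType) (s N : nat) (g : 'I_s -> {mpoly R[N]}).
Definition msubst : {mpoly R[s]} -> {mpoly R[N]} := mmap (@mpolyC N R) g.
HB.instance Definition _ := GRing.RMorphism.copy msubst (mmap (@mpolyC N R) g).
Lemma msubstX i : msubst 'X_i = g i.
Proof. by rewrite /msubst mmapX mmap1U. Qed.
Lemma msubstC c : msubst c%:MP = c%:MP.
Proof. by rewrite /msubst mmapC. Qed.
End Subst.

Section Eval.
Variables (K Om : fieldType) (iota : {rmorphism K -> Om}).

Lemma mmapXU m (xi : 'I_m -> Om) i : mmap iota xi 'X_i = xi i.
Proof. by rewrite mmapX mmap1U. Qed.

Lemma mmap_ext m (xi xi' : 'I_m -> Om) (f : {mpoly K[m]}) :
  xi =1 xi' -> mmap iota xi f = mmap iota xi' f.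
Proof. by move/funext->. Qed.

Lemma mmap_subst s N (g : 'I_s -> {mpoly K[N]}) (xi : 'I_N -> Om) f :
  mmap iota xi (msubst g f) = mmap iota (fun i => mmap iota xi (g i)) f.
Proof.
move: f; apply: (mpoly_morph_eq (f := mmap iota xi \o msubst g)) => [c|i] /=.
  by rewrite msubstC !mmapC.
by rewrite msubstX mmapXU.
Qed.

Lemma muni_widen m (i : 'I_m) : muni ('X_(widen_ord (leqnSn m) i) : {mpoly K[m.+1]}) = ('X_i)%:P.
Proof.
rewrite /muni mmapX mmap1U; case: splitP => [j eqj|j] /=.
  by congr ('X__)%:P; apply/val_inj/esym.
by rewrite ord1 addn0 => eqi; move: (ltn_ord i); rewrite eqi ltnn.
Qed.

Lemma muni_max m : muni ('X_ord_max : {mpoly K[m.+1]}) = 'X.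
Proof.
rewrite /muni mmapX mmap1U; case: splitP => [j /= eqj|//].
by move: (ltn_ord j); rewrite -eqj ltnn.
Qed.

Lemma mmap_muni m (xi : nat -> Om) (f : {mpoly K[m.+1]}) :
  mmap iota (fun i : 'I_m.+1 => xi i) f =
  evp (mmap iota (fun i : 'I_m => xi i)) (xi m) (muni f).
Proof.
pose h := horner_eval (xi m) \o map_poly (mmap iota (fun i : 'I_m => xi i)) \o @muni m K.
move: f; apply: (mpoly_morph_eq (g := h)) => [c|i].
  by rewrite /h /= muniC map_polyC /horner_eval hornerC /= !mmapC.
rewrite /= mmapXU /h /horner_eval /=; have [lti|] := ltnP i m.
  have -> : i = widen_ord (leqnSn m) (Ordinal lti) by exact/val_inj.
  by rewrite muni_widen map_polyC hornerC /= mmapXU.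
rewrite leq_eqVlt ltnNge -ltnS ltn_ord orbF => /eqP eqi.
have -> : i = ord_max by exact/val_inj.
by rewrite muni_max map_polyX hornerX.
Qed.

Lemma muni_inj m : injective (@muni m K).
Proof.
move=> f g eqfg; apply/eqP; rewrite -subr_eq0; apply/eqP.
have : muni (f - g) = 0 by rewrite rmorphB /= eqfg subrr.
move: (f - g) => {eqfg}f /polyP f0; apply/mpolyP => k; rewrite mcoeff0.
pose k' := [multinom (k (widen_ord (leqnSn m) i)) | i < m].
suff H (h : {mpoly K[m.+1]}) : ((muni h)`_(k ord_max))@_k' = h@_k.
  by rewrite -H f0 coef0 mcoeff0.
rewrite muniE coef_sum raddf_sum /= [in RHS](mpolyE h) raddf_sum /=.
apply: eq_bigr => l _; rewrite !coefZ coefXn !mcoeffZ mcoeffX.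
have -> : (l == k) = ([multinom (l (widen_ord (leqnSn m) i)) | i < m] == k')
    && (k ord_max == l ord_max).
  apply/eqP/andP => [->|[/eqP/mnmP eqw /eqP eqm]]; first by rewrite !eqxx.
  apply/mnmP => i; have [lti|] := ltnP i m.
    have := eqw (Ordinal lti); rewrite !mnmE.
    by have -> : widen_ord (leqnSn m) (Ordinal lti) = i by exact/val_inj.
  rewrite leq_eqVlt ltnNge -ltnS ltn_ord orbF => /eqP eqi.
  by have -> : i = ord_max by exact/val_inj.
have [_|_] := eqVneq (k ord_max) _; rewrite ?andbT ?andbF ?mulr1 ?mulr0 ?mcoeff0 ?mulr0 //.
by rewrite mcoeffZ mcoeffX.
Qed.

Lemma derivation_eq m (h : {rmorphism {mpoly K[m]} -> Om}) (D D' : {mpoly K[m]} -> Om) :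
    derivation h D -> derivation h D' ->
    (forall c, D c%:MP = D' c%:MP) -> (forall i, D 'X_i = D' 'X_i) -> D =1 D'.
Proof.
move=> dD dD' eqC eqX p; rewrite (mpolyE p) !(derivation_sum dD, derivation_sum dD').
apply: eq_bigr => k _; rewrite -mul_mpolyC dD.2 dD'.2 eqC; congr (_ + _ * _).
rewrite mpolyXE_id; elim/big_rec: _ => [|i y _ IH].
  by rewrite (derivation1 dD) (derivation1 dD').
by rewrite dD.2 dD'.2 IH (derivationX dD) (derivationX dD') eqX.
Qed.

Definition dir_deriv m (xi a : 'I_m -> Om) (f : {mpoly K[m]}) : Om :=
  \sum_i mmap iota xi (f^`M(i)) * a i.

Lemma dir_deriv_ext m (xi xi' a a' : 'I_m -> Om) f :
  xi =1 xi' -> a =1 a' -> dir_deriv xi a f = dir_deriv xi' a' f.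
Proof. by move=> /funext-> /funext->. Qed.

Lemma dir_derivation m (xi a : 'I_m -> Om) :
  derivation (mmap iota xi) (dir_deriv xi a).
Proof.
split=> f g; rewrite /dir_deriv.
  by rewrite -big_split; apply: eq_bigr => i _; rewrite mderivD rmorphD mulrDl.
rewrite mulr_suml mulr_sumr -big_split; apply: eq_bigr => i _ /=.
by rewrite mderivM rmorphD !rmorphM /=; ring.
Qed.

Lemma dir_derivC m (xi a : 'I_m -> Om) c : dir_deriv xi a c%:MP = 0.
Proof. by apply: big1 => i _; rewrite mderivC rmorph0 mul0r. Qed.

Lemma mderivXU m (i j : 'I_m) : ('X_i : {mpoly K[m]})^`M(j) = (i == j)%:R%:MP.
Proof.
rewrite mderivX mnm1E; have [->|] := eqVneq i j; last by rewrite scale0r mpolyC0.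
have -> : (U_(j) - U_(j) = 0)%MM by apply/mnmP => k; rewrite mnmBE subnn mnm0E.
by rewrite mpolyX0 scale1r mpolyC1.
Qed.

Lemma dir_derivX m (xi a : 'I_m -> Om) i : dir_deriv xi a 'X_i = a i.
Proof.
rewrite /dir_deriv (bigD1 i) //= mderivXU eqxx mpolyC1 rmorph1 mul1r big1 ?addr0 //.
by move=> j; rewrite mderivXU eq_sym => /negPf->; rewrite mpolyC0 rmorph0 mul0r.
Qed.

Lemma derivation_dir m (xi : 'I_m -> Om) D : derivation (mmap iota xi) D ->
  (forall c, D c%:MP = 0) -> D =1 dir_deriv xi (fun i => D 'X_i).
Proof.
move=> dD DC; apply: (derivation_eq dD (dir_derivation _ _)) => [c|i].
  by rewrite DC dir_derivC.
by rewrite dir_derivX.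
Qed.

Lemma dir_deriv_subst s N (g : 'I_s -> {mpoly K[N]}) (xi a : 'I_N -> Om) f :
  dir_deriv xi a (msubst g f) =
  dir_deriv (fun i => mmap iota xi (g i)) (fun i => dir_deriv xi a (g i)) f.
Proof.
have dS : derivation (mmap iota (fun i => mmap iota xi (g i)))
    (fun f => dir_deriv xi a (msubst g f)).
  split=> p q; first by rewrite rmorphD (dir_derivation _ _).1.
  by rewrite rmorphM (dir_derivation _ _).2 !mmap_subst.
rewrite (derivation_dir dS) => [|c]; last by rewrite msubstC dir_derivC.
by congr dir_deriv; apply/funext => i; rewrite msubstX.
Qed.

(** In other words, [a] lists the values on the coordinates of a derivation over [K] from [K[xi]] to
    [Om]. *)
Definition tangent m (xi a : 'I_m -> Om) :=
  forall f : {mpoly K[m]}, mmap iota xi f = 0 -> dir_deriv xi a f = 0.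

Lemma tangent_subst s N (g : 'I_s -> {mpoly K[N]}) (xi a : 'I_N -> Om) :
  tangent xi a ->
  tangent (fun i => mmap iota xi (g i)) (fun i => dir_deriv xi a (g i)).
Proof. by move=> ta f; rewrite -mmap_subst -dir_deriv_subst => /ta. Qed.

Section CharZero.
Hypothesis charOm0 : [pchar Om] =i pred0.

Lemma tangent_step m (xi a : nat -> Om) :
    tangent (fun i : 'I_m => xi i) (fun i : 'I_m => a i) ->
  exists tau, tangent (fun i : 'I_m.+1 => xi i)
                      (fun i : 'I_m.+1 => if i == m :> nat then tau else a i).
Proof.
move=> ta; set x := fun i : 'I_m => xi i.
have [D' [dD' D'C D'0]] := derivation_extension (xi m) charOm0 (dir_derivation x _) ta.
exists (D' 'X) => f; rewrite mmap_muni => /D'0 <-.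
have dM : derivation (mmap iota (fun i : 'I_m.+1 => xi i)) (fun f => D' (muni f)).
  by split=> p q; rewrite ?rmorphD ?rmorphM ?dD'.1 ?dD'.2 ?mmap_muni.
rewrite (derivation_dir dM) => [|c]; last by rewrite muniC D'C dir_derivC.
apply: eq_bigr => i _; congr (_ * _).
have [eqi|nei] := eqVneq (i : nat) m.
  by have -> : i = ord_max; [exact/val_inj | rewrite muni_max].
have lti : (i < m)%N by rewrite ltn_neqAle nei -ltnS ltn_ord.
have -> : i = widen_ord (leqnSn m) (Ordinal lti) by exact/val_inj.
by rewrite muni_widen D'C dir_derivX.
Qed.

Lemma tangent_extension_nat s k (xi a : nat -> Om) :
    tangent (fun i : 'I_s => xi i) (fun i : 'I_s => a i) ->
  exists2 b : nat -> Om, (forall i, (i < s)%N -> b i = a i)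
    & tangent (fun i : 'I_(s + k) => xi i) (fun i : 'I_(s + k) => b i).
Proof.
move=> ta; elim: k => [|k [b eqab tb]]; first by exists a; rewrite // addn0.
have [tau tt] := tangent_step tb.
exists (fun i => if i == (s + k)%N then tau else b i); last by rewrite addnS.
by move=> i lti; rewrite ltn_eqF ?eqab // ltn_addr.
Qed.

End CharZero.

End Eval.

(** * Specialization of generic coordinates, one coordinate at a time *)

Section Lifting.
Variables (K : closedFieldType) (Om : fieldType) (iota : {rmorphism K -> Om}).

(** That is, [x] is a rational point of the affine variety over [K] of which [xi] is a generic
    point. *)
Definition specializes m (xi : 'I_m -> Om) (x : 'I_m -> K) :=
  forall f : {mpoly K[m]}, mmap iota xi f = 0 -> f.@[x] = 0.

Lemma meval_muni m (x : nat -> K) (f : {mpoly K[m.+1]}) :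
  f.@[fun i : 'I_m.+1 => x i] = evp (meval (fun i : 'I_m => x i)) (x m) (muni f).
Proof. exact: (mmap_muni idfun). Qed.

Lemma specialization_step m (xi : nat -> Om) (b : {mpoly K[m.+1]}) :
    mmap iota (fun i : 'I_m.+1 => xi i) b != 0 ->
  exists2 c : {mpoly K[m]}, mmap iota (fun i : 'I_m => xi i) c != 0 &
    forall x : nat -> K, specializes (fun i : 'I_m => xi i) (fun i : 'I_m => x i) ->
      c.@[fun i : 'I_m => x i] != 0 ->
    exists2 tau, specializes (fun i : 'I_m.+1 => xi i) (fun i : 'I_m.+1 =>
      if i == m :> nat then tau else x i)
      & b.@[fun i : 'I_m.+1 => if i == m :> nat then tau else x i] != 0.
Proof.
rewrite mmap_muni => /specialization_extension[c cn0 H]; exists c => // x spx cx.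
have [tau [Htau btau]] := H K (meval (fun i : 'I_m => x i)) spx cx.
pose y i := if i == m then tau else x i.
have yE f : f.@[fun i : 'I_m.+1 => y i] = (map_poly (meval (fun i : 'I_m => x i)) (muni f)).[tau].
  rewrite meval_muni /y eqxx /evp; congr (map_poly (meval _) _).[_].
  by apply/funext => i; rewrite ltn_eqF.
exists tau; last by rewrite yE.
by move=> f; rewrite mmap_muni yE => /Htau.
Qed.

Lemma specialization_extension_nat s k (xi : nat -> Om) (b : {mpoly K[s + k]}) :
    mmap iota (fun i : 'I_(s + k) => xi i) b != 0 ->
  exists2 c : {mpoly K[s]}, mmap iota (fun i : 'I_s => xi i) c != 0 &
    forall x : nat -> K, specializes (fun i : 'I_s => xi i) (fun i : 'I_s => x i) ->
      c.@[fun i : 'I_s => x i] != 0 ->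
    exists y : nat -> K, [/\ forall i, (i < s)%N -> y i = x i,
      specializes (fun i : 'I_(s + k) => xi i) (fun i : 'I_(s + k) => y i)
      & b.@[fun i : 'I_(s + k) => y i] != 0].
Proof.
elim: k b => [|k IH] b bn0.
  move: b bn0; rewrite addn0 => b bn0; exists b => // x spx bx; exists x; split=> //.
move: b bn0; rewrite addnS => b /specialization_step[c cn0 Hc].
have [d dn0 Hd] := IH c cn0; exists d => // x spx dx.
have [y [eqyx spy cy]] := Hd x spx dx; have [tau sptau btau] := Hc y spy cy.
exists (fun i => if i == (s + k)%N then tau else y i); split=> //.
by move=> i lti; rewrite ltn_eqF ?eqyx // ltn_addr.
Qed.

End Lifting.

(** * Lifting tangent vectors and points along a dominant polynomial map *)

Section Joint.
Variables (K : fieldType) (Om : fieldType) (iota : {rmorphism K -> Om}).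
Variables (s N : nat) (g : 'I_s -> {mpoly K[N]}) (xi : 'I_N -> Om).

(* the tuple (g(xi), xi), as an infinite sequence *)
Definition joint_point (k : nat) : Om :=
  if insub k is Some i then
    match split (i : 'I_(s + N)) with inl j => mmap iota xi (g j) | inr j => xi j end
  else 0.

Lemma joint_pointl (i : 'I_s) : joint_point i = mmap iota xi (g i).
Proof.
by rewrite -[i : nat]/(lshift N i : nat) /joint_point valK (unsplitK (inl i)).
Qed.

Lemma joint_pointr (i : 'I_N) : joint_point (rshift s i) = xi i.
Proof. by rewrite /joint_point valK (unsplitK (inr i)). Qed.

Lemma joint_relation i :
  mmap iota (fun i : 'I_(s + N) => joint_point i)
    ('X_(lshift N i) - msubst (fun j => 'X_(rshift s j)) (g i)) = 0.
Proof.
rewrite rmorphB /= mmapXU mmap_subst /= joint_pointl; apply/eqP; rewrite subr_eq0; apply/eqP.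
by apply: mmap_ext => j; rewrite mmapXU joint_pointr.
Qed.

Lemma mmap_joint f :
  mmap iota (fun i : 'I_(s + N) => joint_point i) (msubst (fun j =>
    'X_(rshift s j)) f) = mmap iota xi f.
Proof. by rewrite mmap_subst; apply: mmap_ext => j; rewrite mmapXU joint_pointr. Qed.

(** The differential of a dominant map is onto at a generic point. The vector [a] extends along the
    tuple [(g(xi), xi)], and tangency to the relations [y_i = g_i(x)] says that the new part [b]
    maps to [a]. *)
Lemma tangent_extension (a : 'I_s -> Om) : [pchar Om] =i pred0 ->
    tangent iota (fun i => mmap iota xi (g i)) a ->
  exists2 b, tangent iota xi b & forall i, dir_deriv iota xi b (g i) = a i.
Proof.
move=> charOm0 ta; pose an k := if insub k is Some i then a i else 0.
have anE (i : 'I_s) : an i = a i by rewrite /an valK.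
have tan : tangent iota (fun i : 'I_s => joint_point i) (fun i : 'I_s => an i).
  have -> : (fun i : 'I_s => joint_point i) = fun i => mmap iota xi (g i).
    by apply/funext => i; rewrite joint_pointl.
  by have -> : (fun i : 'I_s => an i) = a by apply/funext => i; rewrite anE.
have [b eqb tb] := tangent_extension_nat charOm0 N tan.
exists (fun j => b (rshift s j)).
  move=> f f0; have := tb (msubst (fun j => 'X_(rshift s j)) f); rewrite mmap_joint => /(_ f0).
  rewrite dir_deriv_subst => <-; apply: dir_deriv_ext => j; last by rewrite dir_derivX.
  by rewrite mmapXU joint_pointr.
move=> i; have := tb _ (joint_relation i).
rewrite (dir_derivation _ _ _).1 (derivationN (dir_derivation _ _ _)) dir_derivX dir_deriv_subst.
have -> : b (lshift N i) = a i by rewrite eqb /= ?anE.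
move/eqP; rewrite subr_eq0 => /eqP ->.
by apply: dir_deriv_ext => j; rewrite ?dir_derivX ?mmapXU ?joint_pointr.
Qed.

End Joint.

Section Lifting.
Variables (K : closedFieldType) (Om : fieldType) (iota : {rmorphism K -> Om}).

Lemma meval_subst s N (g : 'I_s -> {mpoly K[N]}) (x : 'I_N -> K) f :
  (msubst g f).@[x] = f.@[fun i => (g i).@[x]].
Proof. exact: (mmap_subst idfun). Qed.

(** Chevalley's theorem in the form needed: the image under [g] of the open set [b != 0] contains
    the nonempty open set [c != 0] of the closure of the image. *)
Lemma specialization_lifting s N (g : 'I_s -> {mpoly K[N]}) (xi : 'I_N -> Om) b :
    mmap iota xi b != 0 ->
  exists2 c : {mpoly K[s]}, mmap iota (fun i => mmap iota xi (g i)) c != 0 &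
    forall u : 'I_s -> K, specializes iota (fun i => mmap iota xi (g i)) u ->
      c.@[u] != 0 ->
    exists x : 'I_N -> K, [/\ specializes iota xi x, forall i, (g i).@[x] = u i & b.@[x] != 0].
Proof.
move=> bn0; have bn0' := bn0; rewrite -(mmap_joint _ g) in bn0'.
have [c cn0 Hc] := specialization_extension_nat bn0'.
have eqg : (fun i : 'I_s => joint_point iota g xi i) = fun i => mmap iota xi (g i).
  by apply/funext => i; rewrite joint_pointl.
rewrite eqg in cn0 Hc; exists c => // u spu cu.
pose un k := if insub k is Some i then u i else 0.
have unE : (fun i : 'I_s => un i) = u by apply/funext => i; rewrite /un valK.
have := Hc un; rewrite unE => /(_ spu cu)[y [eqy spy by0]].
have evE f : (msubst (fun j => 'X_(rshift s j)) f).@[fun i : 'I_(s + N) =>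
  y i] = f.@[fun i : 'I_N => y (rshift s i)].
  by rewrite meval_subst; apply: meval_eq => i; rewrite mevalXU.
exists (fun i => y (rshift s i)); split.
- by move=> f f0; rewrite -evE; apply: spy; rewrite mmap_joint.
- move=> i; have := spy _ (joint_relation _ _ _ i).
  rewrite mevalB mevalXU evE eqy /= ?ltn_ord // => /eqP; rewrite subr_eq0 => /eqP <-.
  by rewrite /un valK.
- by rewrite -evE.
Qed.

(** This is lifting along the map to a point: there [c] is a nonzero constant and imposes no
    condition. *)
Lemma nullstellensatz N (xi : 'I_N -> Om) b : mmap iota xi b != 0 ->
  exists2 x : 'I_N -> K, specializes iota xi x & b.@[x] != 0.
Proof.
move=> /(specialization_lifting (fun i : 'I_0 => 0))[c cn0 H].
have const0 (f : {mpoly K[0]}) : f = (f@_0)%:MP.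
  apply/mpolyP => m; have -> : m = 0%MM by apply/mnmP; case.
  by rewrite mcoeffC eqxx mulr1.
have [||x [spx _ bx]] := H (fun _ => 0).
- move=> f; rewrite (const0 f) mmapC mevalC => /eqP.
  by rewrite fmorph_eq0 => /eqP.
- by move: cn0; rewrite (const0 c) mmapC mevalC fmorph_eq0.
by exists x.
Qed.

End Lifting.

(** * Tangent dimension as transcendence degree *)

Section Independence.
Variables (K : fieldType) (Om : fieldType) (iota : {rmorphism K -> Om}).
Hypothesis charK0 : [pchar K] =i pred0.

Let charOm0 : [pchar Om] =i pred0.
Proof. by move=> p; rewrite (fmorph_pchar iota) charK0. Qed.

Definition alg_indep s (y : 'I_s -> Om) :=
  forall f : {mpoly K[s]}, mmap iota y f = 0 -> f = 0.

Lemma mderiv_eq0_const s (f : {mpoly K[s]}) :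
  (forall i, f^`M(i) = 0) -> f = (f@_0)%:MP.
Proof.
move=> df; apply/mpolyP => m; rewrite mcoeffC.
have [->|mn0] := eqVneq m 0%MM; first by rewrite mulr1.
rewrite mulr0; have [i mi] : exists i, m i != 0%N.
  apply/existsP; apply: contra_neqT mn0 => /existsPn H; apply/mnmP => i.
  by rewrite mnm0E; apply/eqP/negPn.
have := congr1 (mcoeff (m - U_(i))) (df i); rewrite mcoeff_mderiv mcoeff0 submK; last first.
  by apply/mnm_lepP => j; rewrite mnm1E; case: eqP => // <-; rewrite lt0n.
by move/eqP; rewrite -mulr_natr mulf_eq0 (pcharf0P _).1 // orbF => /eqP.
Qed.

(** If every vector is tangent, the partial derivatives of a relation are again relations, of
    smaller degree, hence zero by induction. In characteristic zero the relation is then constant,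
    so zero. *)
Lemma alg_indep_tangent s (y : 'I_s -> Om) :
  alg_indep y <-> forall a, tangent iota y a.
Proof.
split=> [ind a f /ind ->|tany f].
  by rewrite (derivation0 (dir_derivation _ _ _)).
have [n] := ubnP (msize f); elim: n f => // n IH f; rewrite ltnS => szf f0.
have [->//|fn0] := eqVneq f 0.
have fC : f = (f@_0)%:MP.
  apply: mderiv_eq0_const => i; apply: IH.
    apply: leq_trans szf; rewrite msizeE big_seq.
    have szf0 : (0 < msize f)%N by rewrite lt0n msize_poly_eq0.
    rewrite -[msize f]prednK // ltnS; elim/big_ind: _ => // [u v hu hv|m].
      by rewrite geq_max hu.
    rewrite mcoeff_msupp mcoeff_mderiv => cm.
    have : (m + U_(i))%MM \in msupp f.
      by rewrite mcoeff_msupp; apply: contraNneq cm => ->; rewrite mul0rn.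
    by move/msize_mdeg_lt; rewrite mdegD mdeg1 addn1; case: (msize f).
  have := tany (fun j => (j == i)%:R) f f0; rewrite /dir_deriv (bigD1 i) //= eqxx mulr1.
  by rewrite big1 ?addr0 // => j /negPf->; rewrite mulr0.
move: f0; rewrite fC mmapC => /eqP; rewrite fmorph_eq0 => /eqP ->.
by rewrite mpolyC0.
Qed.

End Independence.

Section VspaceMatrix.
Variables (F : fieldType) (N : nat).

Lemma vspace_matrix (U : {vspace 'rV[F]_N}) :
  exists B : 'M[F]_(\dim U, N), row_free B /\ forall v, (v \in U) = (v <= B)%MS.
Proof.
pose B : 'M_(\dim U, N) := \matrix_i (vbasis U)`_i; exists B.
have rowB i : row i B = (vbasis U)`_i by rewrite rowK.
split.
  rewrite -kermx_eq0; apply/eqP/row_matrixP => i; rewrite row0.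
  have /sub_kermxP : (row i (kermx B) <= kermx B)%MS by exact: row_sub.
  move: (row i _) => u; rewrite mulmx_sum_row => u0; apply/rowP => j; rewrite mxE.
  have /freeP := basis_free (vbasisP U); apply.
  by rewrite -[RHS]u0; apply: eq_bigr => k _; rewrite rowB.
move=> v; apply/idP/submxP => [/coord_vbasis ->|[u ->]].
  exists (\row_i coord (vbasis U) i v); rewrite mulmx_sum_row.
  by apply: eq_bigr => i _; rewrite mxE rowB.
rewrite mulmx_sum_row memv_suml // => i _; rewrite memvZ // rowB vbasis_mem //.
by rewrite mem_nth // size_tuple.
Qed.

Lemma row_free_dimv m (A : 'M[F]_(m, N)) (U : {vspace 'rV[F]_N}) :
  row_free A -> (forall i, row i A \in U) -> (m <= \dim U)%N.
Proof.
move=> freeA AU; have [B [freeB BU]] := vspace_matrix U.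
rewrite -(eqP freeA) -(eqP freeB).
by apply/mxrankS/row_subP => i; rewrite -BU.
Qed.

End VspaceMatrix.

Section TangentDim.
Variables (K : fieldType).
Hypothesis charK0 : [pchar K] =i pred0.

Definition tangent_vspace (Om : fieldType) (iota : {rmorphism K -> Om}) N (xi : 'I_N -> Om) :
    {vspace 'rV[Om]_N} :=
  vspace_of [set a | tangent iota xi (fun i => a 0 i)].

Lemma mem_tangent_vspace (Om : fieldType) (iota : {rmorphism K -> Om}) N (xi : 'I_N -> Om) a :
  a \in tangent_vspace iota xi <-> tangent iota xi (fun i => a 0 i).
Proof.
move: a; apply: vspace_ofP => [f _|c u v tu tv f f0].
  by apply: big1 => i _; rewrite mxE mulr0.
transitivity (c * dir_deriv iota xi (fun i => u 0 i) f + dir_deriv iota xi (fun i => v 0 i) f).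
  rewrite mulr_sumr -big_split; apply: eq_bigr => i _ /=.
  by rewrite !mxE mulrDr mulrCA.
by rewrite tu // tv // mulr0 addr0.
Qed.

(** The coordinates are pivot columns of a basis of the tangent space. The projection to them is
    onto, so every vector is tangent there, which is algebraic independence. With
    [alg_indep_leq_dim], the tangent dimension is the transcendence degree. *)
Lemma tangent_dim_basis (Om : fieldType) (iota : {rmorphism K -> Om}) N (xi : 'I_N -> Om) :
  exists sigma : 'I_(\dim (tangent_vspace iota xi)) -> 'I_N,
    alg_indep iota (fun i => xi (sigma i)).
Proof.
have [B [freeB memB]] := vspace_matrix (tangent_vspace iota xi).
have fullBT : row_full B^T by rewrite /row_full mxrank_tr.
pose sigma := fullrankfun fullBT; exists sigma.
apply/(alg_indep_tangent iota charK0) => c.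
have unitC : colsub sigma B \in unitmx.
  by rewrite -unitmx_tr trmx_mxsub; exact: fullrowsub_unit fullBT.
pose a := \row_i c i *m invmx (colsub sigma B) *m B.
have ta : tangent iota xi (fun i => a 0 i).
  by apply: (mem_tangent_vspace iota xi a).1; rewrite memB submxMl.
have aE i : a 0 (sigma i) = c i.
  have -> : a 0 (sigma i) = (colsub sigma a) 0 i by rewrite [RHS]mxE.
  by rewrite /a -mulmx_colsub mulmxKV // mxE.
move=> f; have := tangent_subst (g := fun i => 'X_(sigma i)) ta (f := f).
have -> : (fun i => mmap iota xi 'X_(sigma i)) = fun i => xi (sigma i).
  by apply/funext => i; rewrite mmapXU.
suff -> : (fun i => dir_deriv iota xi (fun i => a 0 i) 'X_(sigma i)) = c by [].
by apply/funext => i; rewrite dir_derivX aE.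
Qed.

(** All unit vectors are tangent at the point [g(xi)]; their lifts to [xi] are linearly independent
    because their images under the differential of [g] are. *)
Lemma alg_indep_leq_dim (Om : fieldType) (iota : {rmorphism K -> Om}) N (xi : 'I_N -> Om)
    s (g : 'I_s -> {mpoly K[N]}) :
  alg_indep iota (fun i => mmap iota xi (g i)) -> (s <= \dim (tangent_vspace iota xi))%N.
Proof.
move=> ind; have charOm0 : [pchar Om] =i pred0.
  by move=> p; rewrite (fmorph_pchar iota) charK0.
have H (j : 'I_s) : exists b : 'rV[Om]_N, b \in tangent_vspace iota xi /\
    forall i, dir_deriv iota xi (fun k => b 0 k) (g i) = (i == j)%:R.
  have [b tb bg] := tangent_extension charOm0 ((alg_indep_tangent iota charK0 _).1 ind (fun i =>
    (i == j)%:R)).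
  exists (\row_i b i); split=> [|i].
    apply: (mem_tangent_vspace iota xi _).2.
    by under eq_fun do rewrite mxE.
  by under [X in dir_deriv _ _ X]eq_fun do rewrite mxE.
have [b Hb] := choice H.
pose A := \matrix_j b j; pose G := \matrix_(k, i) mmap iota xi ((g i)^`M(k)).
have AG : A *m G = 1%:M.
  apply/matrixP => j i; rewrite !mxE -eq_sym -(Hb j).2; apply: eq_bigr => k _.
  by rewrite !mxE mulrC.
apply: (row_free_dimv (A := A)) => [|j]; last by rewrite rowK; exact: (Hb j).1.
by apply/row_freeP; exists G.
Qed.

Section Compare.
Variables (Om Om' : fieldType) (iota : {rmorphism K -> Om}) (iota' : {rmorphism K -> Om'}).
Variables (N : nat) (zeta : 'I_N -> Om) (xi : 'I_N -> Om').
Hypothesis zeta_xi : forall f, mmap iota zeta f = 0 -> mmap iota' xi f = 0.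

Lemma tangent_dim_mono : (\dim (tangent_vspace iota' xi) <= \dim (tangent_vspace iota zeta))%N.
Proof.
have [sigma ind] := tangent_dim_basis iota' xi.
apply: (alg_indep_leq_dim (g := fun i => 'X_(sigma i))) => f.
rewrite -mmap_subst => /zeta_xi; rewrite mmap_subst => f0; apply: ind.
by rewrite -[RHS]f0; apply: mmap_ext => i; rewrite mmapXU.
Qed.

(** Suppose [g] vanishes at [xi] but not at [zeta]. By the dimension bound, [g] and [d] coordinates
    independent at [xi] are related at [zeta]. Dividing by powers of [g] makes the constant term in
    [g] nonzero; specializing to [xi] leaves only that term, a relation among independent
    coordinates. *)
Lemma tangent_dim_eq : (\dim (tangent_vspace iota zeta) <= \dim (tangent_vspace iota' xi))%N ->
  forall f, mmap iota' xi f = 0 -> mmap iota zeta f = 0.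
Proof.
move=> ledim g g0; apply/eqP/negPn/negP => gn0.
have [sigma ind] := tangent_dim_basis iota' xi.
move: ledim sigma ind; move: (\dim (tangent_vspace iota' xi)) => d ledim sigma ind.
pose G (k : nat) : {mpoly K[N]} := if insub k is Some i then 'X_(sigma i) else g.
have GE (i : 'I_d) : G i = 'X_(sigma i) by rewrite /G valK.
have Gd : G d = g by rewrite /G insubF ?ltnn.
have [R R0 Rn0] : exists2 R : {poly {mpoly K[d]}},
    evp (mmap iota (fun i : 'I_d => mmap iota zeta (G i))) (mmap iota zeta g) R = 0 & R != 0.
  apply: contrapT => H; have : (d.+1 <= \dim (tangent_vspace iota zeta))%N.
    apply: (alg_indep_leq_dim (g := fun i : 'I_d.+1 => G i)) => f.
    rewrite (mmap_muni _ (fun i => mmap iota zeta (G i))) Gd => f0.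
    apply/eqP/negPn/negP => fn0; apply: H; exists (muni f) => //.
    by apply: contraNneq fn0 => muni0; apply/eqP/muni_inj; rewrite muni0 rmorph0.
  by rewrite ltnNge ledim.
have {R R0 Rn0}[R [R0 Rn0]] : exists R : {poly {mpoly K[d]}},
    evp (mmap iota (fun i : 'I_d => mmap iota zeta (G i))) (mmap iota zeta g) R = 0 /\ R`_0 != 0.
  have [n] := ubnP (size R); elim: n R R0 Rn0 => // n IH R R0 Rn0; rewrite ltnS => szR.
  have [R00|] := eqVneq R`_0 0; last by exists R.
  have : exists R', R = R' * 'X.
    elim/poly_ind: {IH R0 Rn0 szR}R R00 => [|p c _]; first by exists 0; rewrite mul0r.
    by rewrite coefD coefMX coefC /= add0r => ->; exists p; rewrite addr0.
  case=> R' RE; have R'n0 : R' != 0 by apply: contraNneq Rn0 => R'0; rewrite RE R'0 mul0r.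
  apply: (IH R') => //.
    move: R0; rewrite RE evpM [evp _ _ 'X]/evp map_polyX hornerX => /eqP.
    by rewrite mulf_eq0 (negPf gn0) orbF => /eqP.
  by apply: leq_trans szR; rewrite RE size_mulX.
case/eqP: Rn0; apply: ind.
(* R(x_sigma, g) vanishes at zeta, hence at xi, where its value is R_0(xi_sigma) *)
pose Rg : {mpoly K[N]} := (map_poly (msubst (fun i : 'I_d => G i)) R).[g].
have RgE (Om1 : fieldType) (io : {rmorphism K -> Om1}) (x : 'I_N -> Om1) :
    mmap io x Rg = evp (mmap io (fun i : 'I_d => mmap io x (G i))) (mmap io x g) R.
  rewrite /Rg /evp -horner_map -map_poly_comp; congr (_).[_].
  by apply: eq_map_poly => f /=; rewrite mmap_subst.
have := zeta_xi (f := Rg); rewrite !RgE R0 g0 => /(_ erefl).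
rewrite /evp horner_coef0 coef_map /= => <-; apply: mmap_ext => i.
by rewrite GE mmapXU.
Qed.

End Compare.

End TangentDim.

(** * Prime ideals and generic points *)

Section Ideals.
Variable R : comNzRingType.

Definition is_ideal (P : set R) :=
  [/\ P 0, forall f g, P f -> P g -> P (f + g) & forall f g, P g -> P (f * g)].

Definition is_prime (P : set R) :=
  [/\ is_ideal P, ~ P 1 & forall f g, P (f * g) -> P f \/ P g].

(** An ideal maximal among those containing [J] and missing [M] is prime: enlarging it by either of
    two outside elements meets [M], and the product of the two elements of [M] so found would be in
    the ideal if the product of the outside elements were. *)
Lemma prime_avoidance (J M : set R) :
    is_ideal J -> M 1 -> (forall f g, M f -> M g -> M (f * g)) ->
    (forall f, J f -> ~ M f) ->
  exists2 P : set R, is_prime P & J `<=` P /\ forall f, P f -> ~ M f.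
Proof.
move=> [J0 JD JM] M1 MM JnM.
(* Zorn's lemma also runs over the empty chain, whose union is empty; adjoining [J] keeps the
   condition true there. *)
pose Q (A : set R) := is_ideal (A `|` J) /\ forall f, (A `|` J) f -> ~ M f.
have [F FQ totF|A [[[A0 AD AM] AnM] maxA]] := @Zorn_bigcup R Q.
  split; last by move=> f [[A FA Af]|]; [apply: (FQ A FA).2; left | exact: JnM].
  split; first by right.
  - have H A f g : F A -> A f -> (A `|` J) g -> ((\bigcup_(X in F) X) `|` J) (f + g).
      move=> FA Af Ag; have [[_ AD _] _] := FQ A FA.
      by have [?|?] := AD f g (or_introl Af) Ag; [left; exists A|right].
    move=> f g [[A FA Af]|Jf] [[B FB Bg]|Jg].
    + have [sAB|sBA] := totF A B FA FB; last by apply: H FA Af _; left; exact: sBA.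
      by rewrite addrC; apply: H FB Bg _; left; exact: sAB.
    + by apply: H FA Af _; right.
    + by rewrite addrC; apply: H FB Bg _; right.
    + by right; exact: JD.
  - move=> f g [[A FA Ag]|Jg]; last by right; exact: JM.
    have [[_ _ AM] _] := FQ A FA.
    by have [?|?] := AM f g (or_introl Ag); [left; exists A|right].
pose P := A `|` J.
have meets a : ~ P a -> exists x r, P x /\ M (x + r * a).
  move=> nPa; apply: contrapT => H.
  pose B := [set y | exists x r, P x /\ y = x + r * a].
  have sJB : J `<=` B by move=> y Jy; exists y, 0; rewrite mul0r addr0; split=> //; right.
  have sAB : A `<=` B by move=> y Ay; exists y, 0; rewrite mul0r addr0; split=> //; left.
  have BJ : B `|` J = B by apply/seteqP; split=> y; [case=> // /sJB | left].
  apply: (maxA B).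
    split=> // /(_ a) Ba; apply: nPa; left; apply: Ba.
    by exists 0, 1; rewrite add0r mul1r.
  rewrite /Q BJ; split; last by move=> _ [x [r [Px ->]]] My; apply: H; exists x, r.
  split; first by apply: sJB.
    move=> _ _ [x [r [Px ->]]] [y [s [Py ->]]]; exists (x + y), (r + s).
    by split; [exact: AD | ring].
  move=> f _ [x [r [Px ->]]]; exists (f * x), (f * r); split; [exact: AM | ring].
exists P; last by split=> [f|]; [right | exact: AnM].
split=> [|P1|f g Pfg]; [by [] | exact: AnM P1 M1 |].
apply: contrapT => /not_orP[/meets[x [r [Px Mx]]] /meets[y [s [Py My]]]].
apply: AnM (MM _ _ Mx My).
have -> : (x + r * f) * (y + s * g) = (y + s * g) * x + (r * f * y + (r * s) * (f * g)) by ring.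
by apply: (AD _ _ (AM _ _ Px)); apply: AD (AM _ _ Py) (AM _ _ Pfg).
Qed.

End Ideals.

Section ResidueField.
Variables (R : comNzRingType) (P : set R).

Definition prime_pred of is_prime P : R -> bool := fun f => `[<P f>].

Variable primeP : is_prime P.
Local Notation I := (prime_pred primeP).

Let I_idealr : idealr_closed I.
Proof.
have [[P0 PD PM] P1 _] := primeP; split.
- exact/asboolP.
- by apply/asboolP.
- move=> a f g /asboolP Pf /asboolP Pg; apply/asboolP; apply: PD => //; exact: PM.
Qed.

Let I_prime : prime_idealr_closed I.
Proof.
have [_ _ PP] := primeP => f g /asboolP /PP[Pf|Pg]; apply/orP; [left|right]; exact/asboolP.
Qed.

HB.instance Definition _ := isIdealr.Build R I I_idealr.
HB.instance Definition _ := isPrimeIdealrClosed.Build R I I_prime.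

Definition residue_ideal : prime_idealr R := I.
Definition residue_ring := {ideal_quot residue_ideal}.
HB.instance Definition _ := GRing.ComNzRing.on residue_ring.

(** Fractions are formed over an integral domain equipped with units and an inverse; for the
    quotient ring these are obtained classically. *)
Definition residue_unit : pred residue_ring := fun x => `[<exists y, y * x = 1>].
Definition residue_inv (x : residue_ring) : residue_ring :=
  if pselect (exists y, y * x = 1) is left h then projT1 (cid h) else x.

Let residue_mulVr : {in residue_unit, left_inverse 1 residue_inv *%R}.
Proof.
move=> x /asboolP xu; rewrite /residue_inv; case: pselect => // h.
exact: projT2 (cid h).
Qed.

Let residue_unitP x y : y * x = 1 -> x \in residue_unit.
Proof. by move=> yx; apply/asboolP; exists y. Qed.

Let residue_inv_out : {in [predC residue_unit], residue_inv =1 id}.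
Proof.
by move=> x /asboolP nu; rewrite /residue_inv; case: pselect.
Qed.

HB.instance Definition _ := GRing.ComNzRing_hasMulInverse.Build residue_ring
  residue_mulVr residue_unitP residue_inv_out.
HB.instance Definition _ := GRing.ComUnitRing_isIntegral.Build residue_ring
  (@Quotient.rquot_IdomainAxiom R residue_ideal).

Lemma residue_field :
  exists (Om : fieldType) (h : {rmorphism R -> Om}), forall f, h f = 0 <-> P f.
Proof.
pose pi : {rmorphism R -> residue_ring} := \pi_(residue_ring)%qT.
exists {fraction residue_ring}, (@FracField.tofrac residue_ring \o pi) => f /=.
split=> [/eqP|Pf].
  rewrite tofrac_eq0 => /eqP pif; apply/asboolP; rewrite -[X in `[<P X>]]subr0.
  suff : f - 0 \in residue_ideal by [].
  by rewrite Quotient.idealrBE; apply/eqP; rewrite -/pi pif /pi rmorph0.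
apply/eqP; rewrite tofrac_eq0; apply/eqP; rewrite -(rmorph0 pi); apply/eqP.
by rewrite -Quotient.idealrBE subr0; apply/asboolP.
Qed.

End ResidueField.

Lemma generic_point (K : fieldType) N (P : set {mpoly K[N]}) : is_prime P ->
  exists (Om : fieldType) (iota : {rmorphism K -> Om}) (xi : 'I_N -> Om),
    forall f, mmap iota xi f = 0 <-> P f.
Proof.
move=> primeP; have [Om [h hP]] := residue_field primeP.
exists Om, (h \o @mpolyC N K), (fun i => h 'X_i) => f; rewrite -hP.
suff -> : mmap (h \o @mpolyC N K) (fun i => h 'X_i) f = h f by [].
move: f; apply: mpoly_morph_eq => [c|i] /=; first by rewrite mmapC.
by rewrite mmapXU.
Qed.

(** * Projective varieties and their homogeneous ideals *)

Notation coords v := (fun i => v 0 i).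

Section PrimeDim.
Variable K : fieldType.
Hypothesis charK0 : [pchar K] =i pred0.
Variable N : nat.
Implicit Types (P Q : set {mpoly K[N]}).

(** By [prime_dim_mono] applied in both directions, [d] does not depend on the generic point. For
    the ideal of a projective variety it is the dimension of the affine cone. *)
Definition prime_dim P (d : nat) :=
  exists (Om : fieldType) (iota : {rmorphism K -> Om}) (xi : 'I_N -> Om),
    (forall f, mmap iota xi f = 0 <-> P f) /\ \dim (tangent_vspace iota xi) = d.

Lemma prime_dim_exists P : is_prime P -> exists d, prime_dim P d.
Proof.
move=> /generic_point[Om [iota [xi genxi]]].
by exists (\dim (tangent_vspace iota xi)), Om, iota, xi.
Qed.

Lemma prime_dim_mono P Q d e :
  P `<=` Q -> prime_dim P d -> prime_dim Q e -> (e <= d)%N.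
Proof.
move=> PQ [Om [iota [zeta [genz <-]]]] [Om' [iota' [xi [genx <-]]]].
by apply: tangent_dim_mono => // f /genz /PQ /genx.
Qed.

Lemma prime_dim_eq P Q d e :
  P `<=` Q -> prime_dim P d -> prime_dim Q e -> (d <= e)%N -> Q `<=` P.
Proof.
move=> PQ [Om [iota [zeta [genz <-]]]] [Om' [iota' [xi [genx <-]]]] lede f Qf.
apply/genz; apply: (tangent_dim_eq charK0 _ lede); last exact/genx.
by move=> g /genz /PQ /genx.
Qed.

Lemma prime_dim_indep P d s (g : 'I_s -> {mpoly K[N]}) : prime_dim P d ->
  (forall f, P (msubst g f) -> f = 0) -> (s <= d)%N.
Proof.
move=> [Om [iota [xi [genx <-]]]] ind; apply: (alg_indep_leq_dim charK0 (g := g)) => f.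
by rewrite -mmap_subst => /genx /ind.
Qed.

End PrimeDim.

Section Lines.
Variables (K : closedFieldType) (N : nat).
Implicit Types (f g : {mpoly K[N]}) (u v : 'rV[K]_N).

Lemma mpoly_nonroot s (f : {mpoly K[s]}) : f != 0 -> exists x, f.@[x] != 0.
Proof.
move=> fn0; have prime0 : is_prime [set g : {mpoly K[s]} | g = 0].
  split.
  - by split=> [//|g h -> ->|g h ->]; rewrite ?addr0 ?mulr0.
  - by move/eqP; rewrite oner_eq0.
  - by move=> g h /eqP; rewrite mulf_eq0 => /orP[/eqP|/eqP]; [left|right].
have [Om [iota [xi genxi]]] := generic_point prime0.
have [|x _ fx] := @nullstellensatz K Om iota s xi f; last by exists x.
by apply: contraNneq fn0 => /genxi ->.
Qed.

Lemma poly_allroots (q : {poly K}) : (forall c, q.[c] = 0) -> q = 0.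
Proof.
move=> q0; apply/eqP/negPn/negP => /closed_nonrootP[x].
by rewrite /root q0 eqxx.
Qed.

Lemma line_poly f u v : exists q : {poly K}, forall t, q.[t] = f.@[coords (u + t *: v)].
Proof.
exists (mmap (@polyC K) (fun i => (u 0 i)%:P + (v 0 i)%:P * 'X) f) => t.
move: f; apply: (mpoly_morph_eq (f := horner_eval t \o mmap (@polyC K) _)) => [c|i] /=.
  by rewrite mmapC mevalC /horner_eval hornerC.
by rewrite mmapX mmap1U mevalXU /horner_eval hornerD hornerM !hornerC hornerX !mxE [t * _]mulrC.
Qed.

Lemma homog_eval f d c v : f \is d.-homog -> f.@[coords (c *: v)] = c ^+ d * f.@[coords v].
Proof.
move=> /dhomogP homf; rewrite !mevalE mulr_sumr; apply: eq_big_seq => m /homf hm;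
  have mdeg_m : mdeg m = d := hm.
rewrite mulrCA; congr (_ * _); rewrite -[in RHS]mdeg_m mdegE -prodrXr -big_split /=.
by apply: eq_bigr => i _; rewrite mxE exprMn.
Qed.

Definition vanishes_on_line f v := forall c, f.@[coords (c *: v)] = 0.

(** Along a line through the origin, [f] is a polynomial in the scalar whose coefficients are the
    values of its homogeneous components, and [K] is infinite. *)
Lemma vanishes_on_line_homog f v :
  vanishes_on_line f v <-> forall d, (pihomog mdeg d f).@[coords v] = 0.
Proof.
have lineE k c : (msize f <= k)%N ->
    f.@[coords (c *: v)] = \sum_(d < k) (pihomog mdeg d f).@[coords v] * c ^+ d.
  move=> lek; rewrite [in LHS](pihomog_partitionE lek) raddf_sum /=.
  by apply: eq_bigr => d _; rewrite (homog_eval c v (pihomogP _ _ _)) mulrC.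
split=> [f0 d|f0 c]; last first.
  by rewrite (lineE (msize f)) // big1 // => d _; rewrite f0 mul0r.
pose k := maxn (msize f) d.+1.
have /polyP/(_ d) : \poly_(d < k) (pihomog mdeg d f).@[coords v] = 0.
  by apply: poly_allroots => c; rewrite horner_poly -lineE ?leq_maxl.
by rewrite coef_poly coef0 leq_max ltnSn orbT.
Qed.

Lemma vanishes_on_line_mul f g v :
  vanishes_on_line (f * g) v -> vanishes_on_line f v \/ vanishes_on_line g v.
Proof.
have [p pE] := line_poly f 0 v; have [q qE] := line_poly g 0 v => fg0.
have : p * q = 0.
  apply: poly_allroots => c; rewrite hornerM pE qE add0r -mevalM; exact: fg0.
move/eqP; rewrite mulf_eq0 => /orP[] /eqP r0; [left|right] => c.
  by have := pE c; rewrite r0 horner0 add0r.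
by have := qE c; rewrite r0 horner0 add0r.
Qed.

End Lines.

Lemma row_neq0_coord (F : fieldType) N (v : 'rV[F]_N) : v != 0 -> exists i, v 0 i != 0.
Proof.
move=> vn0; apply/existsP; apply: contra_neqT vn0 => /existsPn H; apply/rowP => i.
by rewrite mxE; apply/eqP/negPn.
Qed.

Section ProjectiveIdeal.
Variables (K : closedFieldType) (N : nat).
Implicit Types (X Y Z : set {vspace 'rV[K]_N}) (f g : {mpoly K[N]}).

Definition ideal_of X : set {mpoly K[N]} := [set f | forall y, X y -> vanishes_at f y].

Lemma proj_pointP (x : {vspace 'rV[K]_N}) : proj_points x -> exists2 v, v != 0 & x = <[v]>%VS.
Proof.
rewrite /proj_points /= => dimx; exists (vpick x).
  by rewrite vpick0 -dimv_eq0 dimx.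
apply/eqP; rewrite eq_sym eqEdim dim_vline vpick0 -dimv_eq0 dimx /= andbT.
by rewrite -memvE memv_pick.
Qed.

Lemma vanishes_at_line f v : vanishes_at f <[v]>%VS <-> vanishes_on_line f v.
Proof.
split=> [f0 c|f0 w /vlineP[c ->]]; last exact: f0.
by apply: f0; rewrite memvZ // memv_line.
Qed.

Lemma vanishes_at_homog f x : vanishes_at f x <-> forall d, vanishes_at (pihomog mdeg d f) x.
Proof.
split=> [f0 d w wx|f0 w wx].
  by apply: (vanishes_on_line_homog f w).1 => c; apply: f0; rewrite memvZ.
have : vanishes_on_line f w by apply/vanishes_on_line_homog => d; exact: f0.
by move/(_ 1); rewrite scale1r.
Qed.

Lemma ideal_of_homog X f : ideal_of X f <-> forall d, ideal_of X (pihomog mdeg d f).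
Proof.
split=> [fX d y /fX /vanishes_at_homog //|fX y Xy].
by apply/vanishes_at_homog => d; exact: fX.
Qed.

Lemma homogeneous_pihomog d f : homogeneous (pihomog mdeg d f).
Proof. by exists d; exact: pihomogP. Qed.

Lemma ideal_of_ideal X : is_ideal (ideal_of X).
Proof.
split=> [y _ v _|f g fX gX y Xy v vy|f g gX y Xy v vy].
- by rewrite meval0.
- by rewrite mevalD (fX y Xy v vy) (gX y Xy v vy) addr0.
- by rewrite mevalM (gX y Xy v vy) mulr0.
Qed.

Lemma proj_closed_ideal X : proj_closed X ->
  X = @proj_points K N `&` [set x | forall f, homogeneous f -> ideal_of X f -> vanishes_at f x].
Proof.
move=> [F homF XE]; apply/seteqP; split=> [x Xx|x [px vx]].
  by split; [move: Xx; rewrite XE => -[] | move=> f _ fX; exact: fX].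
rewrite XE; split=> // f Ff; apply: vx; first exact: homF.
by rewrite XE => y [_]; apply.
Qed.

Lemma ideal_of_sub X Y : proj_closed Y -> X `<=` @proj_points K N ->
  ideal_of Y `<=` ideal_of X -> X `<=` Y.
Proof.
move=> /proj_closed_ideal YE Xp IYX x Xx; rewrite YE; split; first exact: Xp.
by move=> f _ /IYX fX; exact: fX.
Qed.

Lemma irreducible_points X : irreducible_variety X -> X `<=` @proj_points K N.
Proof. by case=> [[F _ ->] _ _ x []]. Qed.

(** On a single line through the origin a product vanishes only if a factor does, so [f g] in the
    ideal covers X by the two closed sets [A f] and [A g]. *)
Lemma irreducible_ideal_prime X : irreducible_variety X -> is_prime (ideal_of X).
Proof.
move=> irrX; have Xp := irreducible_points irrX; have [clX [x Xx] irr] := irrX.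
split; first exact: ideal_of_ideal.
  by move=> /(_ x Xx 0 (mem0v _)) /eqP; rewrite meval1 oner_eq0.
move=> f g fgX; have [F homF XE] := clX.
pose A h := X `&` [set x | vanishes_at h x].
have clA h : proj_closed (A h).
  exists (F `|` range (fun d => pihomog mdeg d h)).
    by move=> _ [/homF //|[d _ <-]]; exact: homogeneous_pihomog.
  apply/seteqP; split=> [y [Xy hy]|y [py hy]].
    move: Xy; rewrite XE => -[py Fy]; split=> // _ [/Fy //|[d _ <-]].
    exact: (vanishes_at_homog h y).1.
  split; first by rewrite XE; split=> // k Fk; apply: hy; left.
  by apply/vanishes_at_homog => d; apply: hy; right; exists d.
have XA h : X = A h -> ideal_of X h by move=> XAh y; rewrite XAh => -[].
have XAA : X = A f `|` A g.
  apply/seteqP; split=> [y Xy|y [[]|[]] //].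
  have [v vn0 yE] := proj_pointP (Xp _ Xy).
  have := fgX y Xy; rewrite yE => /vanishes_at_line /vanishes_on_line_mul.
  by case=> /vanishes_at_line vy; [left|right]; rewrite -yE in vy *.
by have [/XA|/XA] := irr _ _ (clA f) (clA g) XAA; [left|right].
Qed.

Lemma prime_irreducible Y : proj_closed Y -> is_prime (ideal_of Y) -> irreducible_variety Y.
Proof.
move=> clY [_ Y1 YP]; split=> //.
  by apply/set0P/eqP => Y0; apply: Y1; rewrite Y0.
move=> A B clA clB YE; apply: contrapT => /not_orP[YA YB].
have sub (A' : set {vspace 'rV[K]_N}) : proj_closed A' -> A' `<=` Y -> Y <> A' ->
    exists2 f, ideal_of A' f & ~ ideal_of Y f.
  move=> clA' sA' nYA'; apply: contrapT => H; apply: nYA'; apply/seteqP; split=> //.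
  apply: ideal_of_sub => //; first by case: clY => F _ -> x [].
  by move=> f A'f; apply: contrapT => nYf; apply: H; exists f.
have [f fA fY] := sub A clA (fun x Ax => eq_ind_r (fun Z => Z x) (or_introl Ax) YE) YA.
have [g gB gY] := sub B clB (fun x Bx => eq_ind_r (fun Z => Z x) (or_intror Bx) YE) YB.
have /YP[//|//] : ideal_of Y (f * g).
move=> y; rewrite YE => -[Ay|By] v vy; rewrite mevalM.
  by rewrite (fA y Ay v vy) mul0r.
by rewrite (gB y By v vy) mulr0.
Qed.

End ProjectiveIdeal.

(** * Hyperplane sections and Krull dimension *)

Section Cone.
Variables (K : closedFieldType) (N : nat) (q : set {mpoly K[N]}).
Hypothesis primeq : is_prime q.
Implicit Types (f g : {mpoly K[N]}) (v : 'rV[K]_N).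

Definition zero_locus v := forall f, q f -> f.@[coords v] = 0.

Lemma zero_locus_nonroot f : ~ q f -> exists2 v, zero_locus v & f.@[coords v] != 0.
Proof.
move=> nqf; have [Om [iota [xi genxi]]] := generic_point primeq.
have [|x spx fx] := @nullstellensatz K Om iota N xi f.
  by apply/eqP => /genxi.
have rowE g : g.@[coords (\row_i x i)] = g.@[x] by apply: meval_eq => i; rewrite mxE.
by exists (\row_i x i); rewrite ?rowE // => g /genxi /spx; rewrite rowE.
Qed.

(* the ideal generated by the homogeneous elements of q *)
Definition cone_ideal f := forall v, zero_locus v -> vanishes_on_line f v.

Lemma cone_ideal_homog f : cone_ideal f <-> forall d, q (pihomog mdeg d f).
Proof.
split=> [fc d|fq v vq]; last first.
  by apply/vanishes_on_line_homog => d; apply: vq.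
apply: contrapT => /zero_locus_nonroot[v vq] /eqP; apply.
exact: (vanishes_on_line_homog f v).1 (fc v vq) d.
Qed.

Lemma cone_ideal_sub : cone_ideal `<=` q.
Proof.
move=> f fc; apply: contrapT => /zero_locus_nonroot[v vq] /eqP; apply.
by have := fc v vq 1; rewrite scale1r.
Qed.

(** If [f] and [g] are outside, each has a homogeneous component outside [q]. A zero of [q] at which
    both components are nonzero spans a line on which neither [f] nor [g] vanishes identically. *)
Lemma cone_ideal_prime : is_prime cone_ideal.
Proof.
have [_ q1 qP] := primeq; split.
- split=> [v _ c|f g fc gc v vq c|f g gc v vq c]; first by rewrite meval0.
    by rewrite mevalD fc // gc // addr0.
  by rewrite mevalM gc // mulr0.
- move=> /cone_ideal_sub; exact: q1.
move=> f g fgc; apply: contrapT => /not_orP[].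
move=> /cone_ideal_homog /existsNP[a nqf] /cone_ideal_homog /existsNP[b nqg].
have [|v vq] := @zero_locus_nonroot (pihomog mdeg a f * pihomog mdeg b g).
  by move=> /qP[].
rewrite mevalM mulf_eq0 negb_or => /andP[fa gb].
have [] := vanishes_on_line_mul (fgc v vq) => /vanishes_on_line_homog.
  by move=> /(_ a) fa0; rewrite fa0 eqxx in fa.
by move=> /(_ b) gb0; rewrite gb0 eqxx in gb.
Qed.

Definition cone_variety : set {vspace 'rV[K]_N} :=
  @proj_points K N `&` [set x | forall f, homogeneous f -> cone_ideal f -> vanishes_at f x].

Lemma cone_variety_closed : proj_closed cone_variety.
Proof.
exists [set f | homogeneous f /\ cone_ideal f]; first by move=> f [].
apply/seteqP; split=> x [px vx]; split=> // f; first by case; exact: vx.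
by move=> hf cf; apply: vx.
Qed.

(** The vector [v0] excludes an empty cone variety, whose ideal would contain 1. *)
Lemma cone_variety_ideal v0 : zero_locus v0 -> v0 != 0 ->
  forall f, ideal_of cone_variety f <-> cone_ideal f.
Proof.
move=> v0q v0n0; have mem v : zero_locus v -> v != 0 -> cone_variety <[v]>%VS.
  move=> vq vn0; split; first by rewrite /proj_points /= dim_vline vn0.
  by move=> f _ fc; apply/vanishes_at_line; exact: fc.
move=> f; split=> [fY v vq|fc].
  have [->|vn0] := eqVneq v 0; last by apply/vanishes_at_line/fY; exact: mem.
  by move=> c; rewrite scaler0; apply: fY (mem0v _); exact: mem v0q v0n0.
apply/ideal_of_homog => d y [_]; apply; first exact: homogeneous_pihomog.
move=> v vq c; have := vanishes_on_line_homog f (c *: v); case=> H _; apply: H => t.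
by rewrite scalerA; apply: fc.
Qed.

End Cone.

Section KrullDim.
Variables (K : closedFieldType) (N : nat).
Hypothesis charK0 : [pchar K] =i pred0.
Implicit Types (X Y Z : set {vspace 'rV[K]_N}) (f g : {mpoly K[N]}).

(** X has [d + 2] algebraically independent coordinates. Cutting by a hyperplane that identifies the
    last with a multiple of the first leaves the other [d + 1] independent on some component,
    provided the hyperplane meets the open set over which points lift to X. *)
Lemma hyperplane_section X d : irreducible_variety X -> prime_dim (ideal_of X) d.+2 ->
  exists Y e, [/\ irreducible_variety Y, Y `<` X, prime_dim (ideal_of Y) e & (d < e)%N].
Proof.
move=> irrX [Om [iota [xi [genxi dimxi]]]].
have := tangent_dim_basis charK0 iota xi; rewrite dimxi => -[sigma ind] {dimxi}.
pose X_ i : {mpoly K[N]} := 'X_(sigma i).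
have indX (f : {mpoly K[d.+2]}) : ideal_of X (msubst X_ f) -> f = 0.
  move=> /genxi; rewrite mmap_subst => f0; apply: ind; rewrite -[RHS]f0.
  by apply: mmap_ext => i; rewrite mmapXU.
have [|c cn0 lift] := @specialization_lifting K Om iota _ N X_ xi 1.
  by rewrite rmorph1 oner_eq0.
have {}cn0 : c != 0 by apply: contraNneq cn0 => ->; rewrite rmorph0.
have [|u] := @mpoly_nonroot K _ (c * 'X_ord0).
  by rewrite mulf_neq0 // -msize_poly_eq0 msizeX.
rewrite mevalM mevalXU mulf_eq0 negb_or => /andP[cu u0].
(* With this slope the hyperplane passes through [u], hence meets the open set [c != 0]; [theta]
   parametrizes it by the first [d + 1] coordinates. *)
pose lam := u ord_max / u ord0.
pose theta (i : 'I_d.+2) : {mpoly K[d.+1]} :=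
  if insub (i : nat) is Some j then 'X_j else lam *: 'X_ord0.
have thetaW (i : 'I_d.+1) : theta (widen_ord (leqnSn _) i) = 'X_i.
  by rewrite /theta /= valK.
have theta0 : theta ord0 = 'X_ord0 by rewrite -thetaW; congr theta; exact/val_inj.
have thetaM : theta ord_max = lam *: 'X_ord0 by rewrite /theta insubF //= ltnn.
have c'n0 : msubst theta c != 0.
  apply: contraNneq cu => c'0.
  have := congr1 (meval (fun i => u (widen_ord (leqnSn d.+1) i))) c'0.
  rewrite meval0 meval_subst => <-; apply/eqP/meval_eq => i.
  have [lti|] := ltnP i d.+1.
    have -> : i = widen_ord (leqnSn d.+1) (Ordinal lti) by exact/val_inj.
    by rewrite thetaW mevalXU.
  rewrite leq_eqVlt ltnNge -ltnS ltn_ord orbF => /eqP eqi.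
  have -> : i = ord_max by exact/val_inj.
  rewrite thetaM mevalZ mevalXU (_ : widen_ord _ _ = ord0); last exact/val_inj.
  by rewrite /lam divfK.
pose h := X_ ord_max - lam *: X_ ord0.
pose W_ i := X_ (widen_ord (leqnSn d.+1) i).
pose J : set {mpoly K[N]} := [set f | exists a b, ideal_of X a /\ f = a + b * h].
(* A prime missing [M] keeps the coordinates [W_] algebraically independent. *)
pose M : set {mpoly K[N]} := [set f | exists2 P : {mpoly K[d.+1]}, P != 0 & f = msubst W_ P].
have [I0 ID IM] := ideal_of_ideal X.
have [||||q primeq [Jq qM]] := @prime_avoidance _ J M.
- split.
  + by exists 0, 0; rewrite mul0r addr0.
  + move=> _ _ [a [b [aX ->]]] [a' [b' [a'X ->]]]; exists (a + a'), (b + b').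
    by split; [exact: ID | ring].
  + move=> f _ [a [b [aX ->]]]; exists (f * a), (f * b).
    by split; [exact: IM | ring].
- by exists 1; rewrite ?oner_eq0 // rmorph1.
- by move=> _ _ [P Pn0 ->] [P' P'n0 ->]; exists (P * P'); rewrite ?mulf_neq0 // rmorphM.
(* If [P(W_)] were [a + b h], it would vanish at any point lying over [theta(u')], where [a] and [h]
   are both zero; but its value there is [P(u')], chosen nonzero. *)
- move=> _ [a [b [aX ->]]] [P Pn0 hP].
  have [|u'] := @mpoly_nonroot K _ (P * msubst theta c); first by rewrite mulf_neq0.
  rewrite mevalM mulf_eq0 negb_or meval_subst => /andP[Pu' cu'].
  have [||x [spx xE _]] := lift (fun i => (theta i).@[u']) => //.
    move=> f f0; have -> : f = 0; last by rewrite meval0.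
    by apply: indX; apply/genxi; rewrite mmap_subst.
  have := congr1 (meval x) hP; rewrite mevalD mevalM (spx a); last exact/genxi.
  rewrite mevalB mevalZ !xE thetaM theta0 mevalZ subrr mulr0 addr0 meval_subst.
  move/esym/eqP; apply/negP; rewrite [X in X != 0](_ : _ = P.@[u']) //.
  by apply: meval_eq => i; rewrite xE thetaW mevalXU.
have qW (P : {mpoly K[d.+1]}) : q (msubst W_ P) -> P = 0.
  by move=> qP; apply/eqP/negPn/negP => Pn0; apply: qM qP _; exists P.
have Xq : ideal_of X `<=` q by move=> a aX; apply: Jq; exists a, 0; rewrite mul0r addr0.
have hq : q h by apply: Jq; exists 0, 1; rewrite mul1r add0r.
have [|v0 v0q v0n] := @zero_locus_nonroot K N q primeq (W_ ord0).
  rewrite -(msubstX W_) => /qW /eqP; rewrite -msize_poly_eq0 msizeX //.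
have v0n0 : v0 != 0.
  by apply: contraNneq v0n => ->; rewrite /W_ /X_ mevalXU mxE.
(* [q] need not be homogeneous, so its cone ideal is used: it still contains the ideal of X and the
   linear form [h], and being inside [q] it misses [M]. *)
have IYE := cone_variety_ideal v0q v0n0.
have IYeq : ideal_of (cone_variety q) = cone_ideal q by apply/seteqP; split=> f /IYE.
have primeY : is_prime (ideal_of (cone_variety q)) by rewrite IYeq; exact: cone_ideal_prime.
have [e dimY] := prime_dim_exists primeY.
have Xc : ideal_of X `<=` cone_ideal q.
  by move=> f /ideal_of_homog fX; apply/cone_ideal_homog => // d'; exact: Xq.
exists (cone_variety q), e; split=> //.
- by apply: prime_irreducible primeY; exact: cone_variety_closed.
- split.
    apply: ideal_of_sub; rewrite ?IYeq //; first by case: irrX.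
    by move=> x [].
  move=> sXY; have hX : ideal_of X h.
    move=> x /sXY xY; suff : ideal_of (cone_variety q) h by apply.
    apply/IYE => v vq t; rewrite /h /X_ mevalB mevalZ !mevalXU !mxE.
    have := vq h hq; rewrite mevalB mevalZ !mevalXU => h0.
    transitivity (t * (v 0 (sigma ord_max) - lam * v 0 (sigma ord0))); first by ring.
    by rewrite h0 mulr0.
  have /indX : ideal_of X (msubst X_ ('X_ord_max - lam *: 'X_ord0)).
    by rewrite rmorphB /= -mul_mpolyC rmorphM /= msubstC !msubstX mul_mpolyC.
  move/(congr1 (meval (fun i => (i == ord_max)%:R))).
  rewrite mevalB mevalZ !mevalXU meval0 eqxx mulr0 subr0 => /eqP.
  by rewrite oner_eq0.
- apply: (prime_dim_indep charK0 (g := W_) dimY) => P.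
  by rewrite IYeq => /(cone_ideal_sub primeq); exact: qW.
Qed.

(** The cone over X contains a line through the origin, on which some coordinate takes every value
    and so satisfies no relation. *)
Lemma prime_dim_gt0 X d : irreducible_variety X -> prime_dim (ideal_of X) d -> (0 < d)%N.
Proof.
move=> irrX dimX; have [_ [x Xx] _] := irrX.
have [v vn0 xE] := proj_pointP (irreducible_points irrX Xx).
have [i vi] := row_neq0_coord vn0.
apply: (prime_dim_indep charK0 (g := fun _ : 'I_1 => 'X_i) dimX) => f fX.
apply/eqP/negPn/negP => /mpoly_nonroot[u] /eqP; apply.
have vx : (u ord0 / v 0 i) *: v \in x by rewrite xE memvZ // memv_line.
have := fX x Xx _ vx; rewrite meval_subst => <-; apply: meval_eq => j.
by rewrite mevalXU mxE divfK // ord1.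
Qed.

Lemma irreducible_proper X Y d e : irreducible_variety X -> irreducible_variety Y ->
  X `<` Y -> prime_dim (ideal_of X) d -> prime_dim (ideal_of Y) e -> (d < e)%N.
Proof.
move=> irrX irrY [sXY nYX] dimX dimY.
have IYX : ideal_of Y `<=` ideal_of X by move=> f fY y /sXY; exact: fY.
rewrite ltnNge; apply/negP => le_ed; apply: nYX.
apply: ideal_of_sub; [by case: irrX | exact: irreducible_points |].
exact: prime_dim_eq IYX dimY dimX le_ed.
Qed.

Lemma irreducible_dim_mono X Y d e : X `<=` Y ->
  prime_dim (ideal_of X) d -> prime_dim (ideal_of Y) e -> (d <= e)%N.
Proof.
move=> sXY dimX dimY; apply: prime_dim_mono dimY dimX => // f fY y /sXY; exact: fY.
Qed.

(** A hyperplane section drops the dimension by at most one, and proper inclusion drops it by at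
    least one, so the induction descends one step at a time. *)
Lemma chain_exists X d : irreducible_variety X -> prime_dim (ideal_of X) d.+1 ->
  exists C, irreducible_chain X d C.
Proof.
elim: d X => [|d IH] X irrX dimX; first by exists (fun=> X); split.
have [Y [e [irrY ltYX dimY lt_de]]] := hyperplane_section irrX dimX.
have eqe : e = d.+1.
  apply/eqP; rewrite eqn_leq lt_de andbT -ltnS.
  exact: irreducible_proper irrY irrX ltYX dimY dimX.
rewrite eqe in dimY; have [C [irrC ltC subC]] := IH Y irrY dimY.
exists (fun i => if (i <= d)%N then C i else X); split.
- by move=> i _; case: ifP => // /irrC.
- move=> i; rewrite ltnS => lei; rewrite lei; case: ifP => [/ltC //|/negbT].
  rewrite -leqNgt => ledi; have -> : i = d by apply/eqP; rewrite eqn_leq lei.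
  by split=> [x /subC /ltYX.1 //|sXC]; apply: ltYX.2 => x /sXC /subC.
- by rewrite ltnn.
Qed.

Lemma chain_leq X d e C : prime_dim (ideal_of X) d.+1 -> irreducible_chain X e C -> (e <= d)%N.
Proof.
move=> dimX [irrC ltC subC].
have H i : (i <= e)%N -> exists2 k, prime_dim (ideal_of (C i)) k & (i < k)%N.
  elim: i => [|i IH] lei.
    have [k dimk] := prime_dim_exists (irreducible_ideal_prime (irrC 0%N lei)).
    by exists k => //; exact: prime_dim_gt0 (irrC 0%N lei) dimk.
  have [k dimk ltik] := IH (ltnW lei).
  have [k' dimk'] := prime_dim_exists (irreducible_ideal_prime (irrC _ lei)).
  exists k' => //; apply: leq_ltn_trans ltik _.
  exact: irreducible_proper (irrC _ (ltnW lei)) (irrC _ lei) (ltC _ lei) dimk dimk'.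
have [k dimk ltek] := H e (leqnn _).
by rewrite -ltnS (leq_trans ltek) //; exact: irreducible_dim_mono subC dimk dimX.
Qed.

Lemma krull_dim X d : irreducible_variety X -> prime_dim (ideal_of X) d.+1 -> has_krull_dim X d.
Proof.
move=> irrX dimX; split; first exact: chain_exists.
by move=> e C; exact: chain_leq.
Qed.

Lemma local_dim X x d e : irreducible_variety X -> X x -> prime_dim (ideal_of X) d.+1 ->
  has_local_dim X x e <-> e = d.
Proof.
move=> irrX Xx dimX.
have krX := krull_dim irrX dimX.
have le Z k : Z `<=` X -> has_krull_dim Z k -> (k <= d)%N.
  move=> ZX [[C [irrC ltC subC]] _]; apply: (chain_leq dimX (C := C)).
  by split=> // y /subC /ZX.
split=> [[[Z [irrZ ZX Zx dimZ]] H]|->].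
  by apply/eqP; rewrite eqn_leq (le Z) // (H X d).
by split=> [|Z k _ ZX _]; [exists X; split=> //; exact: subset_refl | exact: le].
Qed.

Lemma RegE X x d : irreducible_variety X -> prime_dim (ideal_of X) d ->
  Reg X x <-> X x /\ \dim (tangent_space X x) = d.
Proof.
move=> irrX dimX; have := prime_dim_gt0 irrX dimX.
case: d dimX => // d dimX _; split=> [[Xx [e]]|[Xx dimT]].
  by move=> /(local_dim _ irrX Xx dimX) ->.
by split=> //; exists d => //; exact: (local_dim d irrX Xx dimX).2.
Qed.

End KrullDim.

(** * Gradients and regular points *)

Section LinearAlgebra.
Variables (F : fieldType) (N : nat).

Lemma max_row_free (G : set 'rV[F]_N) : exists r (A : 'M[F]_(r, N)),
  [/\ row_free A, forall i, G (row i A) & forall v, G v -> (v <= A)%MS].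
Proof.
pose P r := `[<exists A : 'M[F]_(r, N), row_free A /\ forall i, G (row i A)>].
have P0 : exists r, P r.
  exists 0%N; apply/asboolP; exists 0; split; last by case.
  by rewrite /row_free mxrank0.
have PN r : P r -> (r <= N)%N.
  by move=> /asboolP[A [freeA _]]; rewrite -(eqP freeA) rank_leq_col.
case: (ex_maxnP P0 PN) => r /asboolP[A [freeA GA]] maxr; exists r, A; split=> // v Gv.
apply/negPn/negP => nvA; have /maxr : P r.+1; last by rewrite ltnn.
apply/asboolP; exists (col_mx v A); split; last first.
  move=> i; change (G (@row F (1 + r) N i (col_mx v A))); rewrite -[i](@splitK 1 r).
  case: (split _) => j /=; last by rewrite rowKd.
  by rewrite rowKu (_ : row j v = v) //; apply/rowP => k; rewrite mxE ord1.
rewrite /row_free eqn_leq rank_leq_row /= -{1}(eqP freeA).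
have : (A < col_mx v A)%MS.
  rewrite ltmxE -addsmxE addsmxSr /=; apply: contra nvA => H.
  by apply: submx_trans H; rewrite -?addsmxE addsmxSl.
by rewrite ltmxErank => /andP[].
Qed.

Lemma dim_orthogonal (U : {vspace 'rV[F]_N}) r (A : 'M[F]_(r, N)) :
  (forall a, a \in U <-> a *m A^T = 0) -> (\dim U + \rank A)%N = N.
Proof.
move=> UA; have [B [freeB memB]] := vspace_matrix U.
have eqB : (B :=: kermx A^T)%MS.
  apply/eqmxP/andP; split; apply/row_subP => i.
    by apply/sub_kermxP/UA; rewrite memB row_sub.
  by rewrite -memB; apply/UA/sub_kermxP/row_sub.
have := mxrank_ker A^T; rewrite -eqB mxrank_tr => rB.
have -> : \dim U = \rank B by move/eqP: freeB.
by rewrite rB subnK // rank_leq_col.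
Qed.

Lemma dim_row_space (U : {vspace 'rV[F]_N}) r (A : 'M[F]_(r, N)) :
  (forall a, (a \in U) = (a <= A)%MS) -> \dim U = \rank A.
Proof.
move=> UA; have [B [freeB memB]] := vspace_matrix U.
have -> : \dim U = \rank B by move/eqP: freeB.
apply/eqmx_rank/andP; split; apply/row_subP => i.
  by rewrite -UA memB row_sub.
by rewrite -memB UA row_sub.
Qed.

Lemma row_space_orthogonal r (A : 'M[F]_(r, N)) (v : 'rV[F]_N) :
  (forall a : 'rV[F]_N, a *m A^T = 0 -> v *m a^T = 0) -> (v <= A)%MS.
Proof.
move=> H; rewrite submxE; apply/eqP/trmx_inj; rewrite trmx0 trmx_mul.
apply/row_matrixP => i; rewrite row0 row_mul.
have : row i (cokermx A)^T *m A^T = 0.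
  by rewrite -row_mul -trmx_mul mulmx_coker trmx0 row0.
by move/H/(congr1 trmx); rewrite trmx_mul trmxK trmx0.
Qed.

Lemma row_free_colsub r (A : 'M[F]_(r, N)) (sigma : 'I_r -> 'I_N) :
  \det (colsub sigma A) != 0 -> row_free A.
Proof.
move=> detA; apply/row_freeP; exists (colsub sigma 1%:M *m invmx (colsub sigma A)).
by rewrite mulmxA mulmx_colsub mulmx1 mulmxV // unitmxE unitfE.
Qed.

Lemma colsub_row_free r (A : 'M[F]_(r, N)) :
  row_free A -> exists sigma : 'I_r -> 'I_N, \det (colsub sigma A) != 0.
Proof.
rewrite -row_leq_rank => freeA; have fullAT : row_full A^T.
  by rewrite /row_full mxrank_tr eqn_leq rank_leq_row.
exists (fullrankfun fullAT); rewrite -unitfE -unitmxE -unitmx_tr trmx_mxsub.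
exact: fullrowsub_unit fullAT.
Qed.

End LinearAlgebra.

Section Gradients.
Variables (K : fieldType) (N : nat).
Implicit Types (P : set {mpoly K[N]}) (f : {mpoly K[N]}).

Definition jacobian r (F : 'I_r -> {mpoly K[N]}) : 'M[{mpoly K[N]}]_(r, N) :=
  \matrix_(j, i) (F j)^`M(i).

Section At.
Variables (Om : fieldType) (iota : {rmorphism K -> Om}) (xi : 'I_N -> Om).

Definition gradient f : 'rV[Om]_N := \row_i mmap iota xi f^`M(i).

Definition jacobian_at r (F : 'I_r -> {mpoly K[N]}) : 'M[Om]_(r, N) :=
  map_mx (mmap iota xi) (jacobian F).

Lemma row_jacobian r (F : 'I_r -> {mpoly K[N]}) i : row i (jacobian_at F) = gradient (F i).
Proof. by apply/rowP => j; rewrite !mxE. Qed.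

Lemma gradient_lin I (s : seq I) (c : I -> K) (F : I -> {mpoly K[N]}) :
  gradient (\sum_(i <- s) c i *: F i) = \sum_(i <- s) iota (c i) *: gradient (F i).
Proof.
apply/rowP => j; rewrite [LHS]mxE summxE (raddf_sum (mderiv j)) raddf_sum; apply: eq_bigr => i _ /=.
by rewrite mderivZ mmapZ !mxE.
Qed.

Lemma dir_derivE (a : 'rV[Om]_N) f : dir_deriv iota xi (fun i => a 0 i) f = (gradient f *m a^T) 0 0.
Proof. by rewrite mxE; apply: eq_bigr => i _; rewrite !mxE. Qed.

Lemma gradient_basis P : exists r (F : 'I_r -> {mpoly K[N]}),
  [/\ forall j, P (F j), row_free (jacobian_at F)
    & forall f, P f -> (gradient f <= jacobian_at F)%MS].
Proof.
have [r [A [freeA PA maxA]]] := max_row_free [set gradient f | f in P].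
have [F FP] := choice (fun i => let: ex_intro2 f Pf eqf := PA i in ex_intro (fun f =>
  P f /\ gradient f = row i A) f (conj Pf eqf)).
have FA : jacobian_at F = A.
  by apply/row_matrixP => i; rewrite row_jacobian (FP i).2.
exists r, F; rewrite FA; split=> // [j|f Pf]; first exact: (FP j).1.
by apply: maxA; exists f.
Qed.

Lemma orthogonal_jacobian P r (F : 'I_r -> {mpoly K[N]}) (a : 'rV[Om]_N) :
  (forall j, P (F j)) -> (forall f, P f -> (gradient f <= jacobian_at F)%MS) ->
  (forall f, P f -> gradient f *m a^T = 0) <-> a *m (jacobian_at F)^T = 0.
Proof.
move=> PF maxF; split=> [Pa|aF f /maxF /submxP[u ->]].
  apply: trmx_inj; rewrite trmx_mul trmxK trmx0; apply/row_matrixP => i.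
  by rewrite row_mul row_jacobian Pa // row0.
by rewrite -mulmxA; have := congr1 trmx aF; rewrite trmx_mul trmxK trmx0 => ->; rewrite mulmx0.
Qed.

Lemma mem_tangent_gradient P (a : 'rV[Om]_N) : (forall f, mmap iota xi f = 0 <-> P f) ->
  a \in tangent_vspace iota xi <-> forall f, P f -> gradient f *m a^T = 0.
Proof.
move=> genP; split=> [/mem_tangent_vspace ta f /genP /ta|Pa].
  by rewrite dir_derivE => fa; apply/rowP => i; rewrite ord1 fa mxE.
by apply/mem_tangent_vspace => f /genP /Pa fa; rewrite dir_derivE fa mxE.
Qed.

End At.
End Gradients.

Section TangentSpace.
Variables (K : closedFieldType) (N : nat).
Hypothesis charK0 : [pchar K] =i pred0.
Implicit Types (X : set {vspace 'rV[K]_N}) (f g : {mpoly K[N]}) (v w : 'rV[K]_N).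

Notation grad w := (gradient idfun (coords w)).
Notation jac w := (jacobian_at idfun (coords w)).

Lemma mderiv_homog f d i : f \is d.-homog -> f^`M(i) \is d.-1.-homog.
Proof.
move=> /dhomogP homf; apply/dhomogP => m; rewrite mcoeff_msupp mcoeff_mderiv => mn0.
have /homf : (m + U_(i))%MM \in msupp f.
  by rewrite mcoeff_msupp; apply: contraNneq mn0 => ->; rewrite mul0rn.
by rewrite [_ (m + _)%MM]mdegD mdeg1 addn1 => <-.
Qed.

(** One representative [w] and all of the ideal replace every vector of the point and the
    homogeneous polynomials: the gradient of a homogeneous polynomial only rescales along the line,
    and the ideal contains the homogeneous components of its elements. *)
Lemma mem_tangent_space_at X v w :
  v \in tangent_space X <[w]>%VS <-> forall f, ideal_of X f -> grad w f *m v^T = 0.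
Proof.
have gE f (u : 'rV[K]_N) : (grad u f *m v^T) 0 0 = \sum_i (f^`M(i)).@[fun j => u 0 j] * v 0 i.
  by rewrite mxE; apply: eq_bigr => i _; rewrite !mxE.
have g0 f (u : 'rV[K]_N) : grad u f *m v^T = 0 <-> \sum_i (f^`M(i)).@[fun j => u 0 j] * v 0 i = 0.
  by rewrite -gE; split=> [->|fu]; [rewrite mxE | apply/rowP => i; rewrite ord1 fu mxE].
split=> [/mem_tangent_space tv f fX|tv].
  rewrite [f](pihomog_partitionE (mf := mdeg) (leqnn _)).
  under eq_bigr do rewrite -[pihomog _ _ _]scale1r.
  rewrite gradient_lin mulmx_suml big1 // => d _.
  rewrite -scalemxAl (_ : _ *m _ = 0) ?scaler0 //.
  apply/g0; apply: tv (memv_line _); first exact: homogeneous_pihomog.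
  by move: d => [d _] /= y Xy; exact: (ideal_of_homog X f).1 fX d y Xy.
apply/mem_tangent_space => f [d homf] fX u /vlineP[c ->].
transitivity (c ^+ d.-1 * \sum_i (f^`M(i)).@[fun j => w 0 j] * v 0 i).
  rewrite mulr_sumr; apply: eq_bigr => i _.
  by rewrite (homog_eval c w (mderiv_homog i homf)) mulrA.
by rewrite (g0 f w).1 ?mulr0 //; exact: tv.
Qed.

Lemma tangent_space_dim X w r (F : 'I_r -> {mpoly K[N]}) :
  (forall j, ideal_of X (F j)) -> 
  (forall f, ideal_of X f -> (grad w f <= jac w F)%MS) ->
  (\dim (tangent_space X <[w]>) + \rank (jac w F))%N = N.
Proof.
move=> FX maxF; apply: dim_orthogonal => a.
by rewrite mem_tangent_space_at (orthogonal_jacobian _ FX maxF).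
Qed.

Lemma mem_dual_tangent_space X w phi :
  phi \in dual_subspace (tangent_space X <[w]>) <-> exists2 f, ideal_of X f & phi = grad w f.
Proof.
split=> [/mem_dual_subspace H|[f fX ->]]; last first.
  by apply/mem_dual_subspace => v /mem_tangent_space_at; apply.
have [r [F [FX freeF maxF]]] := gradient_basis idfun (coords w) (ideal_of X).
have /submxP[u ->] : (phi <= jac w F)%MS.
  apply: row_space_orthogonal => a /(orthogonal_jacobian _ FX maxF) aX.
  by apply: H; apply/mem_tangent_space_at.
exists (\sum_j u 0 j *: F j); last first.
  by rewrite gradient_lin mulmx_sum_row; apply: eq_bigr => j _; rewrite row_jacobian.
have [I0 ID IM] := ideal_of_ideal X.
elim/big_ind: _ => // j _; rewrite -mul_mpolyC; exact: IM.
Qed.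

Section Regular.
Variables (X : set {vspace 'rV[K]_N}) (d : nat).
Hypotheses (irrX : irreducible_variety X) (dimX : prime_dim (ideal_of X) d).

Lemma generic_jacobian (Om : fieldType) (iota : {rmorphism K -> Om}) (xi : 'I_N -> Om) r (F :
  'I_r -> {mpoly K[N]}) :
  (forall f, mmap iota xi f = 0 <-> ideal_of X f) ->
  (forall j, ideal_of X (F j)) ->
  (forall f, ideal_of X f -> (gradient iota xi f <= jacobian_at iota xi F)%MS) ->
  (d + \rank (jacobian_at iota xi F))%N = N.
Proof.
move=> genxi FX maxF.
have <- : \dim (tangent_vspace iota xi) = d.
  have dimxi : prime_dim (ideal_of X) (\dim (tangent_vspace iota xi)) by exists Om, iota, xi.
  by apply/eqP; rewrite eqn_leq (prime_dim_mono charK0 _ dimX dimxi) // (prime_dim_mono charK0 _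
    dimxi dimX).
apply: dim_orthogonal => a.
by rewrite (mem_tangent_gradient _ genxi) (orthogonal_jacobian _ FX maxF).
Qed.

Lemma det_jacobian_at (Om : fieldType) (iota : {rmorphism K -> Om}) (xi : 'I_N -> Om) r (F :
  'I_r -> {mpoly K[N]}) sigma :
  \det (colsub sigma (jacobian_at iota xi F)) = mmap iota xi (\det (colsub sigma (jacobian F))).
Proof. by rewrite -map_mxsub det_map_mx. Qed.

(** Semicontinuity: a Jacobian minor nonzero at [w] is outside the ideal, hence nonzero at the
    generic point, so the rank at [w] is at most the generic rank. *)
Lemma tangent_space_dim_geq w : X <[w]>%VS -> (d <= \dim (tangent_space X <[w]>))%N.
Proof.
move=> Xw; have [r [F [FX freeF maxF]]] := gradient_basis idfun (coords w) (ideal_of X).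
have [sigma] := colsub_row_free freeF; rewrite det_jacobian_at => minor_w.
have [Om [iota [xi genxi]]] := generic_point (irreducible_ideal_prime irrX).
have minor_xi : mmap iota xi (\det (colsub sigma (jacobian F))) != 0.
  apply: contraNneq minor_w => /genxi /(_ _ Xw w (memv_line w)) mw.
  by apply/eqP; exact: mw.
have [r' [F' [F'X freeF' maxF']]] := gradient_basis iota xi (ideal_of X).
have le_rr' : (\rank (jac w F) <= \rank (jacobian_at iota xi F'))%N.
  rewrite (eqP freeF) -(eqP (row_free_colsub (A := jacobian_at iota xi F) (sigma := sigma) _));
    last by rewrite det_jacobian_at.
  by apply/mxrankS/row_subP => i; rewrite row_jacobian; exact: maxF'.
rewrite -(leq_add2r (\rank (jac w F))) (tangent_space_dim FX maxF).
by rewrite -[X in (_ <= X)%N](generic_jacobian genxi F'X maxF') leq_add2l.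
Qed.

(** Points where a Jacobian minor of generic rank is nonzero are smooth. The product of [g], such a
    minor and a coordinate is outside the prime ideal; the coordinate ensures [w != 0]. *)
Lemma regular_point_dense g : ~ ideal_of X g ->
  exists w, [/\ w != 0, Reg X <[w]>%VS & g.@[coords w] != 0].
Proof.
move=> gX; have primeX := irreducible_ideal_prime irrX.
have [Om [iota [xi genxi]]] := generic_point primeX.
have [r [F [FX freeF maxF]]] := gradient_basis iota xi (ideal_of X).
have [sigma] := colsub_row_free freeF; rewrite det_jacobian_at => minor_xi.
have [_ [x0 Xx0] _] := irrX; have [v vn0 x0E] := proj_pointP (irreducible_points irrX Xx0).
have [i vi] := row_neq0_coord vn0.
have [w [x Xx]] : exists w, exists2 x, X x /\ w \in x &
    (g * (\det (colsub sigma (jacobian F)) * 'X_i)).@[coords w] != 0.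
  apply: contrapT => H; have [_ _ PX] := primeX.
  have /PX[//|/PX[]] : ideal_of X (g * (\det (colsub sigma (jacobian F)) * 'X_i)).
    move=> x Xx w wx; apply/eqP/negPn/negP => gw; apply: H; exists w; exists x => //.
  - by move/genxi/eqP; rewrite (negPf minor_xi).
  - move=> /(_ _ Xx0 v); rewrite x0E memv_line mevalXU => /(_ isT)/eqP.
    by rewrite (negPf vi).
rewrite !mevalM !mulf_eq0 !negb_or mevalXU => /and3P[gw minor_w wi].
have wn0 : w != 0 by apply: contraNneq wi => ->; rewrite mxE.
have xE : x = <[w]>%VS.
  move: Xx => [/(irreducible_points irrX)]; rewrite /proj_points /= => dimx wx'.
  by apply/eqP; rewrite eq_sym eqEdim dim_vline wn0 dimx andbT -memvE.
exists w; split=> //; case: Xx; rewrite xE => Xw _; apply/(RegE charK0 _ irrX dimX); split=> //.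
apply/eqP; rewrite eqn_leq tangent_space_dim_geq // andbT.
have [r' [F' [F'X freeF' maxF']]] := gradient_basis idfun (coords w) (ideal_of X).
rewrite -(leq_add2r (\rank (jac w F'))) (tangent_space_dim F'X maxF').
rewrite -[X in (X <= _)%N](generic_jacobian genxi FX maxF) leq_add2l (eqP freeF).
rewrite -(eqP (row_free_colsub (A := jac w F) (sigma := sigma) _)); last by rewrite det_jacobian_at.
by apply/mxrankS/row_subP => j; rewrite row_jacobian; exact: maxF'.
Qed.

End Regular.

End TangentSpace.

(** * The conormal ideal *)

Lemma natr_inj_char0 (F : fieldType) : [pchar F] =i pred0 -> injective (fun n => n%:R : F).
Proof.
move=> char0 m n; wlog le_mn : m n / (m <= n)%N.
  by move=> H; case/orP: (leq_total m n) => [/H //|/H{}H /esym/H].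
move=> eqmn; apply/eqP; rewrite eqn_leq le_mn -subn_eq0 /=.
by rewrite -((pcharf0P _).1 char0) natrB // eqmn subrr.
Qed.

Lemma poly_natroots (F : fieldType) (q : {poly F}) : [pchar F] =i pred0 ->
  (forall n : nat, q.[n%:R] = 0) -> q = 0.
Proof.
move=> char0 q0; apply/eqP/negPn/negP => qn0.
have := @max_poly_roots _ q [seq n%:R | n <- iota 0 (size q)] qn0.
rewrite size_map size_iota ltnn (map_inj_uniq (natr_inj_char0 char0)) iota_uniq => H.
suff : false by []; apply: H => //; apply/allP => _ /mapP[n _ ->]; exact/eqP.
Qed.

Lemma coef1M (R : nzRingType) (p q : {poly R}) : (p * q)`_1 = p`_1 * q`_0 + p`_0 * q`_1.
Proof. by rewrite coefM !big_ord_recl big_ord0 addr0 addrC. Qed.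

Lemma coef0_linear (R : nzRingType) (a b : R) : (a%:P + b%:P * 'X)`_0 = a.
Proof. by rewrite coefD coefMX coefC eqxx addr0. Qed.

Lemma coef1_linear (R : nzRingType) (a b : R) : (a%:P + b%:P * 'X)`_1 = b.
Proof. by rewrite coefD coefMX !coefC add0r. Qed.

Lemma msubst_comp (K : fieldType) k m n (g : 'I_m -> {mpoly K[n]}) (g' : 'I_k -> {mpoly K[m]}) h :
  msubst g (msubst g' h) = msubst (fun i => msubst g (g' i)) h.
Proof.
move: h; apply: (mpoly_morph_eq (f := msubst g \o msubst g')) => [c|i] /=.
  by rewrite !msubstC.
by rewrite !msubstX.
Qed.

Lemma msubst_id (K : fieldType) n (h : {mpoly K[n]}) : msubst (fun i => 'X_i) h = h.
Proof.
move: h; apply: (mpoly_morph_eq (g := idfun)) => [c|i] /=; first by rewrite msubstC.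
by rewrite msubstX.
Qed.

Lemma msubst_ext (K : fieldType) m n (g g' : 'I_m -> {mpoly K[n]}) h :
  g =1 g' -> msubst g h = msubst g' h.
Proof. by move/funext->. Qed.

Definition glue (T : Type) N (x y : 'I_N -> T) (i : 'I_(N + N)) : T :=
  match split i with inl j => x j | inr j => y j end.

Lemma gluel (T : Type) N (x y : 'I_N -> T) i : glue x y (lshift N i) = x i.
Proof. by rewrite /glue (unsplitK (inl i)). Qed.

Lemma gluer (T : Type) N (x y : 'I_N -> T) i : glue x y (rshift N i) = y i.
Proof. by rewrite /glue (unsplitK (inr i)). Qed.

Lemma glue_ext (T U : Type) N (x y : 'I_N -> T) (f : T -> U) i :
  f (glue x y i) = glue (f \o x) (f \o y) i.
Proof. by rewrite /glue; case: split. Qed.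

Section Conormal.
Variables (K : closedFieldType) (N : nat).
Hypothesis charK0 : [pchar K] =i pred0.
Variable X : set {vspace 'rV[K]_N}.
Hypothesis primeX : is_prime (ideal_of X).
Implicit Types (f g : {mpoly K[N]}) (h : {mpoly K[N + N]}).

Definition base_poly : {mpoly K[N]} -> {mpoly K[N + N]} := msubst (fun i => 'X_(lshift N i)).
Definition fiber_poly : {mpoly K[N]} -> {mpoly K[N + N]} := msubst (fun i => 'X_(rshift N i)).
HB.instance Definition _ := GRing.RMorphism.copy base_poly (msubst (fun i => 'X_(lshift N i))).
HB.instance Definition _ := GRing.RMorphism.copy fiber_poly (msubst (fun i => 'X_(rshift N i))).

Definition gradient_section f : 'I_(N + N) -> {mpoly K[N]} := glue (fun i => 'X_i) (fun i =>
  f^`M(i)).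

(* The ideal of the conormal variety: its fibre at w is spanned by the          *)
(* differentials at w of the polynomials vanishing on X.                        *)
Definition conormal_ideal : set {mpoly K[N + N]} :=
  [set h | forall f, ideal_of X f -> ideal_of X (msubst (gradient_section f) h)].

Lemma msubst_section_base f g : msubst (gradient_section f) (base_poly g) = g.
Proof.
rewrite /base_poly msubst_comp -[RHS]msubst_id; apply: msubst_ext => i.
by rewrite msubstX /gradient_section gluel.
Qed.

Lemma conormal_base g : conormal_ideal (base_poly g) <-> ideal_of X g.
Proof.
have [[I0 _ _] _ _] := primeX.
split=> [/(_ 0 I0)|gX f fX]; by rewrite msubst_section_base.
Qed.

Lemma gradient_section_affine f g t i :
  gradient_section (f + t *: (g - f)) i =
    gradient_section f i + t *: (gradient_section g i - gradient_section f i).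
Proof.
rewrite -[i]splitK; case: (split i) => j; rewrite /gradient_section ?gluel ?gluer.
  by rewrite subrr scaler0 addr0.
by rewrite mderivD mderivZ mderivB.
Qed.

Lemma ideal_of_combination f g t : ideal_of X f -> ideal_of X g -> ideal_of X (f + t *: (g - f)).
Proof.
have [[_ ID IM] _ _] := primeX => fX gX.
apply: (ID _ _ fX); rewrite -mul_mpolyC; apply: (IM _ _); apply: (ID _ _ gX).
by rewrite -mulN1r; exact: IM.
Qed.

(** If [h] and [h'] are nonzero on the gradients of [f] and [f'] respectively, then on the pencil
    [f + t (f' - f)] both become nonzero polynomials in [t]. One [t] serves both, and primality of
    the ideal of X applies to that section. *)
Lemma conormal_prime : is_prime conormal_ideal.
Proof.
have [[I0 ID IM] I1 IP] := primeX; split.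
- split=> [f fX|h h' hP h'P f fX|h h' h'P f fX].
  + by rewrite rmorph0.
  + by rewrite rmorphD; apply: ID; [exact: hP | exact: h'P].
  + by rewrite rmorphM; apply: IM; exact: h'P.
- by move=> /(_ 0 I0); rewrite rmorph1.
move=> h h' hh'P; apply: contrapT => /not_orP[].
have witness k : ~ conormal_ideal k -> exists f (w : 'rV[K]_N) x, [/\ ideal_of X f, X x, w \in x &
    k.@[fun i => (gradient_section f i).@[coords w]] != 0].
  move=> nk; apply: contrapT => H; apply: nk => f fX x Xx w wx.
  rewrite meval_subst; apply/eqP/negPn/negP => kn0; apply: H; by exists f, w, x.
move=> /witness[f [w [x [fX Xx wx hn0]]]] /witness[f' [w' [x' [f'X Xx' wx' h'n0]]]].
have line k (u : 'rV[K]_N) : exists q : {poly K}, forall t,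
    q.[t] = k.@[fun i => (gradient_section (f + t *: (f' - f)) i).@[coords u]].
  have [q qE] := line_poly k (\row_i (gradient_section f i).@[coords u])
    (\row_i ((gradient_section f' i).@[coords u] - (gradient_section f i).@[coords u])).
  exists q => t; rewrite qE; apply: meval_eq => i.
  by rewrite !mxE gradient_section_affine mevalD mevalZ mevalB.
have [q qE] := line h w; have [q' q'E] := line h' w'.
have qn0 : q != 0.
  by apply: contraNneq hn0 => q0; have := qE 0; rewrite q0 horner0 scale0r addr0 => <-.
have q'n0 : q' != 0.
  apply: contraNneq h'n0 => q0; have := q'E 1.
  by rewrite q0 horner0 scale1r addrC subrK => <-.
have /closed_nonrootP[t] : q * q' != 0 by rewrite mulf_neq0.
rewrite rootE hornerM mulf_eq0 negb_or qE q'E -!meval_subst => /andP[hw h'w'].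
have := hh'P _ (ideal_of_combination t fX f'X); rewrite rmorphM => /IP[H|H].
  by have := H x Xx w wx; move/eqP: hw.
by have := H x' Xx' w' wx'; move/eqP: h'w'.
Qed.

(** The substitution [phi := phi + T grad f(x)], with [T] a new variable: translation along the
    fibres of the conormal variety. *)
Definition shift f : {mpoly K[N + N]} -> {poly {mpoly K[N + N]}} :=
  mmap (@polyC _ \o @mpolyC (N + N) K)
    (glue (fun i => ('X_(lshift N i))%:P)
          (fun i => ('X_(rshift N i))%:P + (base_poly f^`M(i))%:P * 'X)).
HB.instance Definition _ f := GRing.RMorphism.copy (shift f)
  (mmap (@polyC _ \o @mpolyC (N + N) K)
    (glue (fun i => ('X_(lshift N i))%:P)
          (fun i => ('X_(rshift N i))%:P + (base_poly f^`M(i))%:P * 'X))).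

Lemma shiftC f c : shift f c%:MP = (c%:MP)%:P.
Proof. by rewrite /shift mmapC. Qed.

Lemma shiftl f i : shift f 'X_(lshift N i) = ('X_(lshift N i))%:P.
Proof. by rewrite /shift mmapX mmap1U gluel. Qed.

Lemma shiftr f i : shift f 'X_(rshift N i) = ('X_(rshift N i))%:P + (base_poly f^`M(i))%:P * 'X.
Proof. by rewrite /shift mmapX mmap1U gluer. Qed.

Lemma shift_coef0 f i : (shift f 'X_i)`_0 = 'X_i.
Proof.
rewrite -[i]splitK; case: (split i) => j; first by rewrite shiftl coefC eqxx.
by rewrite shiftr; exact: coef0_linear.
Qed.

Lemma shiftr_coef1 f i : (shift f 'X_(rshift N i))`_1 = base_poly f^`M(i).
Proof. by rewrite shiftr; exact: coef1_linear. Qed.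

Lemma shift_section f g t h :
  msubst (gradient_section g) ((shift f h).[t%:MP]) = msubst (gradient_section (g + t *: f)) h.
Proof.
move: h; apply: (mpoly_morph_eq (f :=
  msubst (gradient_section g) \o horner_eval t%:MP \o shift f)) => [c|i] /=.
  by rewrite shiftC /horner_eval hornerC !msubstC.
rewrite msubstX /horner_eval -[i]splitK; case: (split i) => j.
  by rewrite /= shiftl hornerC msubstX /gradient_section !gluel.
rewrite /= shiftr hornerD hornerM !hornerC hornerX rmorphD rmorphM /= msubst_section_base.
by rewrite msubstX msubstC /gradient_section !gluer mderivD mderivZ -mul_mpolyC [_ * t%:MP]mulrC.
Qed.

(** Setting [T] to an integer [n] stays in the conormal ideal, since the gradients of [g] and [n f]
    add up to that of [g + n f]. Modulo the ideal, a polynomial in [T] with all these zeros is zero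
    in characteristic zero. *)
Lemma shift_conormal f h i : ideal_of X f -> conormal_ideal h -> conormal_ideal (shift f h)`_i.
Proof.
move=> fX hP; have [[_ ID IM] _ _] := primeX.
have [Om [iota [zeta genz]]] := generic_point conormal_prime.
apply/genz; rewrite -coef_map; set q := map_poly _ _.
suff -> : q = 0 by rewrite coef0.
apply: poly_natroots => [p|n]; first by rewrite (fmorph_pchar iota) charK0.
have -> : n%:R = mmap iota zeta (n%:R)%:MP by rewrite mmapC -(rmorph_nat iota).
rewrite horner_map; apply/genz => g gX; rewrite shift_section; apply: hP.
by apply: (ID _ _ gX); rewrite -mul_mpolyC; exact: IM.
Qed.

Section At.
Variables (Om : fieldType) (iota : {rmorphism K -> Om}).

Definition on_conormal (z : 'I_(N + N) -> Om) := forall h, conormal_ideal h -> mmap iota z h = 0.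

Lemma mmap_base (z : 'I_(N + N) -> Om) f :
  mmap iota z (base_poly f) = mmap iota (fun i => z (lshift N i)) f.
Proof. by rewrite mmap_subst; apply: mmap_ext => i; rewrite mmapXU. Qed.

Lemma mmap_fiber (z : 'I_(N + N) -> Om) f :
  mmap iota z (fiber_poly f) = mmap iota (fun i => z (rshift N i)) f.
Proof. by rewrite mmap_subst; apply: mmap_ext => i; rewrite mmapXU. Qed.

Lemma mmap_section x f h :
  mmap iota x (msubst (gradient_section f) h) =
  mmap iota (glue x (fun i => mmap iota x f^`M(i))) h.
Proof.
rewrite mmap_subst; apply: mmap_ext => i; rewrite /gradient_section (glue_ext _ _ (mmap iota x)).
by congr glue; apply/funext => j /=; rewrite mmapXU.
Qed.

Lemma on_conormal_translate (x y : 'I_N -> Om) f c : ideal_of X f ->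
  on_conormal (glue x y) -> on_conormal (glue x (fun i => y i + c * mmap iota x f^`M(i))).
Proof.
move=> fX xy h hP.
have -> : mmap iota (glue x (fun i => y i + c * mmap iota x f^`M(i))) h =
    (map_poly (mmap iota (glue x y)) (shift f h)).[c].
  move: {hP}h; apply: (mpoly_morph_eq (g :=
    horner_eval c \o map_poly (mmap iota (glue x y)) \o shift f)) => [a|i] /=.
    by rewrite shiftC map_polyC /horner_eval hornerC /= !mmapC.
  rewrite mmapXU /horner_eval -[i]splitK; case: (split i) => j.
    by rewrite /= shiftl map_polyC hornerC /= mmapXU !gluel.
  rewrite /= shiftr rmorphD rmorphM /= !map_polyC map_polyX hornerD hornerM !hornerC hornerX /=.
  rewrite mmapXU !gluer mmap_base mulrC; congr (_ + _ * _); apply: mmap_ext => k.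
  by rewrite gluel.
rewrite [map_poly _ _](_ : _ = 0) ?horner0 //; apply/polyP => i.
by rewrite coef_map coef0 /=; apply: xy; exact: shift_conormal.
Qed.

(** Starting from the zero form, multiples of the gradients with coefficients in [Om] are added one
    at a time by [on_conormal_translate]. *)
Lemma on_conormal_span (x : 'I_N -> Om) r (F : 'I_r -> {mpoly K[N]}) (y : 'rV[Om]_N) :
    (forall g, ideal_of X g -> mmap iota x g = 0) -> (forall j, ideal_of X (F j)) ->
  (y <= jacobian_at iota x F)%MS -> on_conormal (glue x (coords y)).
Proof.
move=> xX FX /submxP[u ->].
suff H (s : seq 'I_r) : on_conormal (glue x (fun i =>
  \sum_(j <- s) u 0 j * mmap iota x (F j)^`M(i))).
  suff -> : coords (u *m jacobian_at iota x F) =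
      fun i => \sum_j u 0 j * mmap iota x (F j)^`M(i) by [].
  by apply/funext => i; rewrite mxE; apply: eq_bigr => j _; rewrite !mxE.
elim: s => [|j s IH].
  move=> h hP; have [[I0 _ _] _ _] := primeX.
  rewrite -[RHS](xX _ (hP 0 I0)) mmap_section; apply: mmap_ext => i.
  by congr glue; apply/funext => j; rewrite big_nil mderiv0 rmorph0.
have H := on_conormal_translate (u 0 j) (FX j) IH.
have -> // : (fun i => \sum_(l <- j :: s) u 0 l * mmap iota x (F l)^`M(i)) =
  fun i => \sum_(l <- s) u 0 l * mmap iota x (F l)^`M(i) + u 0 j * mmap iota x (F j)^`M(i).
by apply/funext => i; rewrite big_cons addrC.
Qed.

End At.

Section Generic.
Variables (Om : fieldType) (iota : {rmorphism K -> Om}) (zeta : 'I_(N + N) -> Om).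
Hypothesis genz : forall h, mmap iota zeta h = 0 <-> conormal_ideal h.

Let x i := zeta (lshift N i).
Let y i := zeta (rshift N i).

Lemma generic_base g : mmap iota x g = 0 <-> ideal_of X g.
Proof. by rewrite -conormal_base -genz mmap_base. Qed.

(** Over the generic point of X the conormal fibre is the linear span of the gradients. Polynomial
    equations for this span confine [y] and the vertical tangent vectors to it; conversely,
    translation along a gradient produces a vertical tangent vector. *)
Lemma conormal_fiber : exists r (F : 'I_r -> {mpoly K[N]}),
  [/\ forall j, ideal_of X (F j), row_free (jacobian_at iota x F),
      forall f, ideal_of X f -> (gradient iota x f <= jacobian_at iota x F)%MS,
      (\row_i y i <= jacobian_at iota x F)%MS
    & forall b : 'rV[Om]_N, (row_mx 0 b \in tangent_vspace iota zeta) =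
      (b <= jacobian_at iota x F)%MS].
Proof.
have [r [F [FX freeF maxF]]] := gradient_basis iota x (ideal_of X).
have [sigma minor] := colsub_row_free freeF.
set J := jacobian_at iota x F in freeF maxF minor *.
(* phi is a combination of the rows of J iff phi *m G = 0, by Cramer's rule *)
pose G : 'M[{mpoly K[N]}]_N := (\det (colsub sigma (jacobian F)))%:M
  - colsub sigma 1%:M *m \adj (colsub sigma (jacobian F)) *m jacobian F.
pose Gx := map_mx (mmap iota x) G.
have GxE : Gx = (\det (colsub sigma J))%:M - colsub sigma 1%:M *m \adj (colsub sigma J) *m J.
  rewrite /Gx /G map_mxB map_scalar_mx !map_mxM map_mx_adj !map_mxsub map_mx1 /=.
  by rewrite -det_map_mx map_mxsub.
have GxP (b : 'rV[Om]_N) : b *m Gx = 0 <-> (b <= J)%MS.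
  rewrite GxE mulmxBr mul_mx_scalar !mulmxA mulmx_colsub mulmx1.
  split=> [/eqP|/submxP[u ->]].
    rewrite subr_eq0 => /eqP bE; rewrite -[b](scalerK minor) bE.
    by rewrite scalemx_sub // submxMl.
  rewrite -mulmx_colsub -[u *m _ *m \adj _]mulmxA mul_mx_adj.
  by rewrite mul_mx_scalar -scalemxAl subrr.
pose E k : {mpoly K[N + N]} := \sum_i 'X_(rshift N i) * base_poly (G i k).
have EE z k : mmap iota z (E k) = \sum_i z (rshift N i) * mmap iota (fun i =>
  z (lshift N i)) (G i k).
  by rewrite raddf_sum; apply: eq_bigr => i _; rewrite /= rmorphM /= mmapXU mmap_base.
have EP k : conormal_ideal (E k).
  move=> f /maxF /GxP fG; apply/generic_base; rewrite mmap_section EE.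
  have /rowP/(_ k) := fG; rewrite [LHS]mxE [RHS]mxE => Gk; rewrite -[RHS]Gk.
  apply: eq_bigr => i _; rewrite gluer !mxE -/(G i k); congr (_ * _); apply: mmap_ext => j;
    exact: gluel.
exists r, F; split=> //.
  apply/GxP/rowP => k; have := (genz (E k)).2 (EP k); rewrite EE => Ek.
  by rewrite !mxE -[RHS]Ek; apply: eq_bigr => i _; rewrite !mxE.
move=> b; apply/idP/idP => [/mem_tangent_vspace tb|/submxP[u ->]].
  apply/GxP/rowP => k; have := tb _ ((genz (E k)).2 (EP k)).
  rewrite (derivation_sum (dir_derivation _ _ _)) => Ek; rewrite !mxE -[RHS]Ek.
  apply: eq_bigr => i _; rewrite (dir_derivation _ _ _).2 dir_derivX row_mxEr mmap_base !mxE.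
  rewrite [dir_deriv _ _ _ (base_poly _)](_ : _ = 0) ?mulr0 ?addr0 // dir_deriv_subst.
  by apply: big1 => j _; rewrite dir_derivX row_mxEl mxE mulr0.
have tf f : ideal_of X f -> row_mx 0 (gradient iota x f) \in tangent_vspace iota zeta.
  move=> fX; apply/mem_tangent_vspace => h /genz hP.
  (* The coefficient of [T] is the derivative along the gradient of [f], and it vanishes on the
     conormal ideal by [shift_conormal]. *)
  pose D h := mmap iota zeta (shift f h)`_1.
  have s0 k : mmap iota zeta (shift f k)`_0 = mmap iota zeta k.
    move: k; apply: (mpoly_morph_eq (f := mmap iota zeta \o coefp 0 \o shift f)) => [c|i] /=.
      by rewrite shiftC coefC eqxx.
    by rewrite shift_coef0.
  have dD : derivation (mmap iota zeta) D.
    split=> k l; rewrite /D; first by rewrite rmorphD coefD rmorphD.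
    have sM : shift f (k * l) = shift f k * shift f l by exact: rmorphM.
    have key (p q : {poly {mpoly K[N + N]}}) : mmap iota zeta (p * q)`_1 =
        mmap iota zeta p`_1 * mmap iota zeta q`_0 + mmap iota zeta p`_0 * mmap iota zeta q`_1.
      by rewrite coef1M rmorphD !rmorphM.
    by rewrite sM key; congr (_ * _ + _ * _); exact: s0.
  have DC c : D c%:MP = 0 by rewrite /D shiftC coefC rmorph0.
  have -> : dir_deriv iota zeta (coords (row_mx 0 (gradient iota x f))) h = D h; last first.
    by apply/genz; exact: shift_conormal.
  rewrite (derivation_dir dD DC); apply: dir_deriv_ext => // i.
  rewrite -[i]splitK; case: (split i) => j /=; rewrite /D.
    by rewrite row_mxEl mxE shiftl coefC rmorph0.
  by rewrite row_mxEr shiftr_coef1 mmap_base mxE.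
rewrite mulmx_sum_row; elim/big_rec: _ => [|i b' _ IH]; first by rewrite row_mx0 mem0v.
have -> : row_mx (0 : 'rV[Om]_N) (u 0 i *: row i J + b') =
  u 0 i *: row_mx 0 (row i J) + row_mx 0 b'.
  by rewrite scale_row_mx scaler0 add_row_mx addr0.
by rewrite memvD // memvZ // row_jacobian; exact: tf.
Qed.

(** Projection to the first block maps the tangent space onto that of X at [x], by
    [tangent_extension]. Its kernel, the vertical vectors, has the rank of the Jacobian as
    dimension, which is the codimension of that image. *)
Lemma conormal_dim : \dim (tangent_vspace iota zeta) = N.
Proof.
have [r [F [FX freeF maxF _ fiber]]] := conormal_fiber.
set T := tangent_vspace iota zeta; set J := jacobian_at iota x F in freeF maxF fiber.
pose p : 'Hom('rV[Om]_(N + N), 'rV[Om]_N) := linfun lsubmx.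
have pE v : p v = lsubmx v by rewrite lfunE.
have charOm0 : [pchar Om] =i pred0 by move=> k; rewrite (fmorph_pchar iota) charK0.
rewrite -(limg_ker_dim p T).
have -> : (p @: T)%VS = tangent_vspace iota x.
  apply/vspaceP => a; apply/idP/idP =>
    [/memv_imgP[v /mem_tangent_vspace tv ->]|/mem_tangent_vspace ta].
    apply/mem_tangent_vspace => f f0; rewrite -mmap_base in f0.
    rewrite -[RHS](tv _ f0) dir_deriv_subst; apply: dir_deriv_ext => i; first by rewrite mmapXU.
    by rewrite dir_derivX pE mxE.
  have ta' : tangent iota (fun i => mmap iota zeta 'X_(lshift N i)) (coords a).
    by have -> : (fun i => mmap iota zeta 'X_(lshift N i)) = x by apply/funext => i; rewrite mmapXU.
  have [b tb bE] := tangent_extension charOm0 ta'.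
  apply/memv_imgP; exists (\row_i b i).
    by apply/mem_tangent_vspace; under eq_fun do rewrite mxE.
  by apply/rowP => i; rewrite pE !mxE -bE dir_derivX.
have dimJ : (\rank J + \dim (tangent_vspace iota x))%N = N.
  rewrite addnC; apply: dim_orthogonal => a.
  by rewrite (mem_tangent_gradient _ generic_base) (orthogonal_jacobian _ FX maxF).
rewrite -[RHS]dimJ; congr (_ + _)%N.
rewrite -(rank_row_0mx N J); apply: dim_row_space => a.
rewrite memv_cap memv_ker pE; apply/andP/submxP => [[aT /eqP la]|[u ->]].
  move: aT; rewrite -[a]hsubmxK la fiber => /submxP[u ->].
  by exists u; rewrite mul_mx_row mulmx0.
by rewrite mul_mx_row mulmx0 fiber submxMl row_mxKl.
Qed.

End Generic.

End Conormal.

(** * Biduality *)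

Section Euler.
Variables (K : closedFieldType) (N : nat).
Implicit Types (f : {mpoly K[N]}).

Lemma euler_homog f d : f \is d.-homog -> \sum_i 'X_i * f^`M(i) = d%:R *: f.
Proof.
move=> /dhomogP homf; rewrite {2}[f]mpolyE scaler_sumr.
transitivity (\sum_i \sum_(m <- msupp f) f@_m *: ('X_i * 'X_[m]^`M(i))).
  apply: eq_bigr => i _; rewrite {1}[f]mpolyE raddf_sum mulr_sumr.
  by apply: eq_bigr => m _; rewrite /= mderivZ -scalerAr.
rewrite exchange_big; apply: eq_big_seq => m /homf hm /=.
have {}hm : mdeg m = d by [].
rewrite -scaler_sumr scalerA mulrC -scalerA; congr (_ *: _).
rewrite -hm mdegE natr_sum scaler_suml; apply: eq_bigr => i _.
rewrite mderivX -scalerAr; have [->|mi] := eqVneq (m i) 0%N; first by rewrite !scale0r.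
rewrite -mpolyXD; congr (_ *: 'X_[_]); rewrite addmC submK //.
by apply/mnm_lepP => j; rewrite mnm1E; case: eqP => // <-; rewrite lt0n.
Qed.

Lemma euler_ideal (X : set {vspace 'rV[K]_N}) f :
  ideal_of X f -> ideal_of X (\sum_i 'X_i * f^`M(i)).
Proof.
move=> fX; have [I0 ID IM] := ideal_of_ideal X.
rewrite [f](pihomog_partitionE (mf := mdeg) (leqnn _)).
under eq_bigr do rewrite raddf_sum mulr_sumr.
rewrite exchange_big /=; elim/big_ind: _ => // d _.
rewrite (euler_homog (pihomogP _ _ _)) -mul_mpolyC; apply: (IM _ _).
exact: (ideal_of_homog X f).1.
Qed.

End Euler.

Section Biduality.
Variables (K : closedFieldType) (N : nat).
Hypothesis charK0 : [pchar K] =i pred0.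
Variables X Z : set {vspace 'rV[K]_N}.
Hypothesis primeX : is_prime (ideal_of X).
Hypothesis dualZ : forall g, ideal_of Z g <-> conormal_ideal X (fiber_poly g).
Implicit Types (f g : {mpoly K[N]}) (h : {mpoly K[N + N]}).

Lemma conormal_pairing : conormal_ideal X (\sum_i 'X_(lshift N i) * 'X_(rshift N i)).
Proof.
move=> f fX; rewrite raddf_sum [k in ideal_of X k](_ : _ = \sum_i 'X_i * f^`M(i)).
  exact: euler_ideal.
by apply: eq_bigr => i _; rewrite /= rmorphM /= !msubstX /gradient_section gluel gluer.
Qed.

Lemma dual_ideal_prime : is_prime (ideal_of Z).
Proof.
have [_ P1 PP] := conormal_prime primeX; split; first exact: ideal_of_ideal.
  by move=> /dualZ; rewrite rmorph1.
by move=> f g /dualZ; rewrite rmorphM => /PP[] ?; [left|right]; apply/dualZ.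
Qed.

Definition swap_poly : {mpoly K[N + N]} -> {mpoly K[N + N]} :=
  msubst (glue (fun i => 'X_(rshift N i)) (fun i => 'X_(lshift N i))).
HB.instance Definition _ := GRing.RMorphism.copy swap_poly
  (msubst (glue (fun i => 'X_(rshift N i)) (fun i => 'X_(lshift N i)))).

Lemma mmap_swap (Om : fieldType) (iota : {rmorphism K -> Om}) z h :
  mmap iota z (swap_poly h) =
  mmap iota (glue (fun i => z (rshift N i)) (fun i => z (lshift N i))) h.
Proof.
rewrite mmap_subst; apply: mmap_ext => i; rewrite -[i]splitK; case: (split i) => j /=.
  by rewrite !gluel mmapXU.
by rewrite !gluer mmapXU.
Qed.

(** At the generic point [(x, y)], lift a vector [a] tangent to Z at [y] to a tangent vector
    [(b, a)]. Differentiating the pairing gives [b.y + x.a = 0], and [b.y = 0] because [b] is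
    tangent to X and [y] is a combination of gradients. So [x] kills the tangent space of Z, hence
    is a combination of gradients at [y], and [(y, x)] satisfies the conormal ideal of Z. *)
Lemma conormal_swap_sub h : conormal_ideal Z (swap_poly h) -> conormal_ideal X h.
Proof.
have [Om [iota [zeta genz]]] := generic_point (conormal_prime primeX).
pose x i := zeta (lshift N i); pose y i := zeta (rshift N i).
have geny g : mmap iota y g = 0 <-> ideal_of Z g by rewrite dualZ -genz mmap_fiber.
have charOm0 : [pchar Om] =i pred0 by move=> k; rewrite (fmorph_pchar iota) charK0.
have [r [F [FX freeF maxF yF _]]] := conormal_fiber charK0 primeX genz.
have [s [G [GZ freeG maxG]]] := gradient_basis iota y (ideal_of Z).
have xG : (\row_i x i <= jacobian_at iota y G)%MS.
  apply: row_space_orthogonal => a /(orthogonal_jacobian _ GZ maxG) aG.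
  have /mem_tangent_vspace ta := (mem_tangent_gradient a geny).2 aG.
  have ta' : tangent iota (fun i => mmap iota zeta 'X_(rshift N i)) (coords a).
    by have -> : (fun i => mmap iota zeta 'X_(rshift N i)) = y by apply/funext => i; rewrite mmapXU.
  have [b tb bE] := tangent_extension charOm0 ta'.
  have := tb _ ((genz _).2 conormal_pairing).
  rewrite (derivation_sum (dir_derivation _ _ _)).
  under eq_bigr do rewrite (dir_derivation _ _ _).2 bE dir_derivX !mmapXU.
  rewrite big_split /= => dpair; apply/rowP => i; rewrite ord1 !mxE.
  suff d0 : \sum_(i < N) b (lshift N i) * y i = 0.
    move: dpair; rewrite d0 add0r => dpair; rewrite -[RHS]dpair.
    by apply: eq_bigr => j _; rewrite !mxE.
  have tx f : ideal_of X f -> gradient iota x f *m (\row_i b (lshift N i))^T = 0.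
    move=> fX; apply/rowP => j; rewrite ord1 -dir_derivE [RHS]mxE.
    have := tb (base_poly f); rewrite mmap_base => /(_ ((generic_base primeX genz f).2 fX)).
    rewrite dir_deriv_subst => <-; apply: dir_deriv_ext => k; first by rewrite mmapXU.
    by rewrite dir_derivX mxE.
  have /(orthogonal_jacobian _ FX maxF) bF := tx.
  have /submxP[u yu] := yF.
  have : (\row_i b (lshift N i)) *m (\row_i y i)^T = 0 by rewrite yu trmx_mul mulmxA bF mul0mx.
  move/rowP/(_ 0); rewrite [RHS]mxE mxE => by0; rewrite -[RHS]by0.
  by apply: eq_bigr => j _; rewrite !mxE.
move=> hZ; apply/genz.
have := on_conormal_span charK0 dual_ideal_prime (fun g => (geny g).2) GZ xG hZ.
rewrite mmap_swap => <-; apply: mmap_ext => i; rewrite -[i]splitK; case: (split i) => j /=.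
  by rewrite !(gluel, gluer) mxE.
by rewrite !(gluel, gluer).
Qed.

Lemma tangent_dim_reindex (Om : fieldType) (iota : {rmorphism K -> Om}) m n (z :
  'I_n -> Om) (p : 'I_m -> 'I_n) :
  (\dim (tangent_vspace iota (fun i => z (p i))) <= \dim (tangent_vspace iota z))%N.
Proof.
have [sigma ind] := tangent_dim_basis charK0 iota (fun i => z (p i)).
apply: (alg_indep_leq_dim charK0 (g := fun i => 'X_(p (sigma i)))) => f f0.
by apply: ind; rewrite -[RHS]f0; apply: mmap_ext => i; rewrite mmapXU.
Qed.

(** Both sides are primes of dimension N, so the inclusion of [conormal_swap_sub] is an equality. *)
Theorem conormal_duality h : conormal_ideal X h <-> conormal_ideal Z (swap_poly h).
Proof.
split; last exact: conormal_swap_sub.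
have [Om [iota [zeta genz]]] := generic_point (conormal_prime primeX).
have [Om' [iota' [zeta' genz']]] := generic_point (conormal_prime dual_ideal_prime).
pose z i := zeta' (glue (@rshift N N) (@lshift N N) i).
have zE : z = glue (fun i => zeta' (rshift N i)) (fun i => zeta' (lshift N i)).
  by apply/funext => i; rewrite /z (glue_ext _ _ zeta').
have genZ k : mmap iota' z k = 0 <-> conormal_ideal Z (swap_poly k).
  by rewrite -genz' mmap_swap zE.
move=> hX; apply: (prime_dim_eq charK0 (P := [set k | conormal_ideal Z (swap_poly k)])) hX.
- exact: conormal_swap_sub.
- by exists Om', iota', z; split; first exact: genZ.
- by exists Om, iota, zeta.
rewrite (conormal_dim charK0 primeX genz).
by rewrite -[leqRHS](conormal_dim charK0 dual_ideal_prime genz') tangent_dim_reindex.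
Qed.

End Biduality.

(** * Annihilators and the ideal of the dual variety *)

Section DualSubspace.
Variables (K : fieldType) (N : nat).
Implicit Types (L H : {vspace 'rV[K]_N}).

Lemma dim_dual_subspace L : (\dim (dual_subspace L) + \dim L)%N = N.
Proof.
have [B [freeB memB]] := vspace_matrix L.
have -> : \dim L = \rank B by move/eqP: freeB.
apply: dim_orthogonal => a; split=> [/mem_dual_subspace aL|aB].
  apply: trmx_inj; rewrite trmx_mul trmxK trmx0; apply/row_matrixP => i.
  rewrite row0 row_mul; apply: trmx_inj; rewrite trmx0 trmx_mul trmxK.
  by apply: aL; rewrite memB row_sub.
apply/mem_dual_subspace => v; rewrite memB => /submxP[u ->].
by rewrite trmx_mul mulmxA aB mul0mx.
Qed.

Lemma pairing_sym (v w : 'rV[K]_N) : v *m w^T = 0 -> w *m v^T = 0.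
Proof. by move=> vw; apply: trmx_inj; rewrite trmx_mul trmxK vw !trmx0. Qed.

Lemma dual_subspaceK : involutive (@dual_subspace K N).
Proof.
move=> L; apply/esym/eqP; rewrite eqEdim; apply/andP; split.
  apply/subvP => v vL; apply/mem_dual_subspace => phi /mem_dual_subspace /(_ v vL).
  exact: pairing_sym.
rewrite -(leq_add2r (\dim (dual_subspace L))) dim_dual_subspace.
by rewrite -[X in (X <= _)%N](dim_dual_subspace L) addnC.
Qed.

Lemma dual_subspaceS L H : (L <= H)%VS -> (dual_subspace H <= dual_subspace L)%VS.
Proof.
move=> /subvP LH; apply/subvP => phi /mem_dual_subspace pH.
by apply/mem_dual_subspace => v /LH; exact: pH.
Qed.

End DualSubspace.

Section DualVariety.
Variables (K : closedFieldType) (N : nat).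
Hypothesis charK0 : [pchar K] =i pred0.

Lemma proj_closureE (S : set {vspace 'rV[K]_N}) : S `<=` @proj_points K N ->
  proj_closure S = @proj_points K N `&` [set x | forall f,
    homogeneous f /\ ideal_of S f -> vanishes_at f x].
Proof.
move=> Sp; apply/seteqP; split=> [x|x [px vx] C [[F homF ->] SC]].
  apply; split; first by exists [set f | homogeneous f /\ ideal_of S f] => // f [].
  by move=> y Sy; split; [exact: Sp | move=> f [_ fS]; exact: fS].
split=> // f Ff; apply: vx; split; first exact: homF.
by move=> y /SC[_]; apply.
Qed.

Lemma proj_closure_closed (S : set {vspace 'rV[K]_N}) : S `<=` @proj_points K N ->
  proj_closed (proj_closure S).
Proof.
by move=> /proj_closureE ->; exists [set f | homogeneous f /\ ideal_of S f] => // f [].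
Qed.

Lemma ideal_of_closure (S : set {vspace 'rV[K]_N}) f : S `<=` @proj_points K N ->
  ideal_of (proj_closure S) f <-> ideal_of S f.
Proof.
move=> Sp; rewrite (proj_closureE Sp); split=> [fC y Sy|fS].
  by apply: fC; split; [exact: Sp | move=> g [_ gS]; exact: gS].
apply/ideal_of_homog => d y [_]; apply; split; first exact: homogeneous_pihomog.
exact: (ideal_of_homog S f).1.
Qed.

Variable X : set {vspace 'rV[K]_N}.
Hypothesis irrX : irreducible_variety X.
Notation grad w := (gradient idfun (coords w)).

Let primeX := irreducible_ideal_prime irrX.

(** Smooth points suffice because, by [regular_point_dense], a polynomial outside the ideal of X is
    nonzero at one of them. *)
Lemma conormal_regular h : conormal_ideal X h <->
  forall w f, w != 0 -> Reg X <[w]>%VS -> ideal_of X f ->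
    h.@[glue (coords w) (coords (grad w f))] = 0.
Proof.
have secE w f : h.@[glue (coords w) (coords (grad w f))] =
  (msubst (gradient_section f) h).@[coords w].
  rewrite meval_subst; apply: meval_eq => i; rewrite -[i]splitK; case: (split i) => j /=.
    by rewrite /gradient_section !gluel mevalXU.
  by rewrite /gradient_section !gluer mxE.
split=> [hX w f _ [Xw _] fX|H f fX]; first by rewrite secE; exact: hX _ fX _ Xw _ (memv_line w).
have [d dimX] := prime_dim_exists primeX.
apply: contrapT => /(regular_point_dense charK0 irrX dimX)[w [wn0 regw /eqP]]; apply.
by rewrite -secE; exact: H.
Qed.

Definition dual_points : set {vspace 'rV[K]_N} :=
  [set dual_subspace H | H in
    [set H | (\dim H).+1 = N /\ exists2 p, Reg X p & (tangent_space X p <= H)%VS]].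

Lemma dual_pointsP y : dual_points y <->
  exists w f, [/\ w != 0, Reg X <[w]>%VS, ideal_of X f, grad w f != 0 & y = <[grad w f]>%VS].
Proof.
split=> [[H [dimH [p regp TH]] <-]|[w [f [wn0 regw fX gn0 ->]]]].
  have [w wn0 pE] := proj_pointP (irreducible_points irrX regp.1).
  have dimD : \dim (dual_subspace H) = 1%N.
    by apply: (@addIn (\dim H)); rewrite dim_dual_subspace add1n.
  have [phi phin0 HE] := proj_pointP dimD.
  have : phi \in dual_subspace (tangent_space X p).
    by apply: (subvP (dual_subspaceS TH)); rewrite HE memv_line.
  rewrite pE in regp *; move/mem_dual_tangent_space => [f fX phiE].
  by exists w, f; rewrite -phiE; split.
exists (dual_subspace <[grad w f]>%VS); last by rewrite dual_subspaceK.
split; first by have := dim_dual_subspace <[grad w f]>%VS; rewrite dim_vline gn0 addn1.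
exists <[w]>%VS => //; apply/subvP => v /mem_tangent_space_at vT.
apply/mem_dual_subspace => u /vlineP[c ->]; apply: pairing_sym.
by rewrite -scalemxAl vT // scaler0.
Qed.

Lemma dual_points_proj : dual_points `<=` @proj_points K N.
Proof.
by move=> y /dual_pointsP[w [f [_ _ _ gn0 ->]]]; rewrite /proj_points /= dim_vline gn0.
Qed.

(** Nonemptiness forces [g] to vanish at the zero form, which occurs as a gradient but spans no
    point. *)
Lemma dual_points_ideal g : dual_points !=set0 ->
  ideal_of dual_points g <-> conormal_ideal X (fiber_poly g).
Proof.
have fibE w f : (fiber_poly g).@[glue (coords w) (coords (grad w f))] = g.@[coords (grad w f)].
  by rewrite /fiber_poly meval_subst; apply: meval_eq => i; rewrite mevalXU gluer.
move=> [y0 Sy0]; split=> [gS|gX y /dual_pointsP[w [f [wn0 regw fX _ ->]]] _ /vlineP[c ->]].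
  apply/conormal_regular => w f wn0 regw fX; rewrite fibE.
  have [->|gn0] := eqVneq (grad w f) 0; first exact: gS Sy0 _ (mem0v _).
  by apply: gS (memv_line _); apply/dual_pointsP; exists w, f.
have <- : grad w (c *: f) = c *: grad w f.
  by have := gradient_lin idfun (coords w) [:: tt] (fun=> c) (fun=> f); rewrite !big_seq1.
rewrite -fibE; apply: (conormal_regular (fiber_poly g)).1 => //.
by have [[_ _ IM] _ _] := primeX; rewrite -mul_mpolyC; exact: IM.
Qed.

Lemma dual_variety_ideal g : dual_points !=set0 ->
  ideal_of (dual_variety X) g <-> conormal_ideal X (fiber_poly g).
Proof.
by move=> /dual_points_ideal <-; rewrite ideal_of_closure //; exact: dual_points_proj.
Qed.

Lemma dual_variety_irreducible : dual_points !=set0 -> irreducible_variety (dual_variety X).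
Proof.
move=> S0; apply: prime_irreducible; first exact: proj_closure_closed dual_points_proj.
exact: dual_ideal_prime primeX (fun g => dual_variety_ideal g S0).
Qed.

Lemma dual_variety_empty : dual_points = set0 -> dual_variety X = set0.
Proof.
move=> S0; apply/seteqP; split=> // x xZ; have : proj_closure dual_points x by [].
rewrite (proj_closureE dual_points_proj) => -[_ /(_ 1)].
have h1 : homogeneous (1 : {mpoly K[N]}) by exists 0%N; rewrite dhomog1.
have i1 : ideal_of dual_points 1 by move=> y; rewrite S0.
by move=> /(_ (conj h1 i1) 0 (mem0v _)) /eqP; rewrite meval1 oner_eq0.
Qed.

End DualVariety.

(** * Duality on Grassmannians *)

Lemma dim_dual_eq (K : fieldType) N m m' (L : {vspace 'rV[K]_N}) :
  (m + m')%N = N -> \dim L = m -> \dim (dual_subspace L) = m'.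
Proof.
move=> eqN dimL; have eqD := dim_dual_subspace L.
by apply: (@addnI m); apply: etrans (esym eqN); rewrite addnC -dimL.
Qed.

Section Plucker.
Variables (K : closedFieldType).

Lemma homog_scale m (f : {mpoly K[m]}) d c (x : 'I_m -> K) :
  f \is d.-homog -> f.@[fun i => c * x i] = c ^+ d * f.@[x].
Proof.
move=> homf; have := homog_eval c (\row_i x i) homf.
have -> : f.@[coords (c *: \row_i x i)] = f.@[fun i => c * x i].
  by apply: meval_eq => i; rewrite !mxE.
by move=> ->; congr (_ * _); apply: meval_eq => i; rewrite mxE.
Qed.

Lemma msubst_homog m n (g : 'I_m -> {mpoly K[n]}) (f : {mpoly K[m]}) d :
  (forall i, g i \is 1.-homog) -> f \is d.-homog -> msubst g f \is d.-homog.
Proof.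
move=> homg /dhomogP homf; rewrite [f]mpolyE raddf_sum /=.
rewrite big_seq; apply: rpred_sum => k /homf homk.
rewrite -mul_mpolyC rmorphM /= msubstC mul_mpolyC rpredZ // mpolyXE_id rmorph_prod /=.
have <- : (\sum_i k i)%N = d by rewrite -mdegE; exact: homk.
apply: (big_rec2 (fun (e : nat) (p : {mpoly K[n]}) => p \is e.-homog)); first exact: dhomog1.
move=> i e p _ homp; apply: dhomogM => //.
by rewrite rmorphXn /= msubstX; have := dhomogMn (k i) (homg i); rewrite mul1n.
Qed.

Lemma pluckerE N k (A : 'M[K]_(k, N)) i :
  plucker A i = \det (colsub (enum_val i : {ffun 'I_k -> 'I_N}) A).
Proof. by congr (\det _); apply/matrixP => a b; rewrite !mxE. Qed.

Lemma plucker_rank N k (A : 'M[K]_(k, N)) (sigma : 'I_k -> 'I_N) :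
  plucker A (enum_rank (finfun sigma)) = \det (colsub sigma A).
Proof.
rewrite pluckerE enum_rankK; congr (\det _).
by apply/matrixP => a b; rewrite !mxE ffunE.
Qed.

Lemma basis_of_rows N k (U : {vspace 'rV[K]_N}) (A : 'M[K]_(k, N)) :
  basis_of U [seq row a A | a <- enum 'I_k] <->
  row_free A /\ forall v, (v \in U) = (v <= A)%MS.
Proof.
have szs : size [seq row a A | a <- enum 'I_k] == k by rewrite size_map size_enum_ord.
pose t := Tuple szs.
have tE (i : 'I_k) : t`_i = row i A.
  by rewrite /t /= (nth_map i) ?size_enum_ord // nth_ord_enum.
have spanE v : (v \in <<t>>%VS) = (v <= A)%MS.
  apply/idP/submxP => [/coord_span ->|[u ->]].
    exists (\row_i coord t i v); rewrite mulmx_sum_row.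
    by apply: eq_bigr => i _; rewrite mxE tE.
  rewrite mulmx_sum_row memv_suml // => i _; rewrite memvZ // -tE memv_span //.
  by rewrite mem_nth // (eqP szs).
have freeE : free t <-> row_free A.
  split=> [/freeP ft|fA].
    rewrite -kermx_eq0; apply/eqP/row_matrixP => i; rewrite row0.
    have /sub_kermxP : (row i (kermx A) <= kermx A)%MS by exact: row_sub.
    move: (row i _) => u; rewrite mulmx_sum_row => u0; apply/rowP => j; rewrite mxE.
    by apply: ft; rewrite -[RHS]u0; apply: eq_bigr => l _; rewrite tE.
  apply/freeP => c c0 i; have /row_freeP[A' AA'] := fA.
  have : (\row_j c j) *m A = 0.
    by rewrite mulmx_sum_row -[RHS]c0; apply: eq_bigr => l _; rewrite mxE tE.
  by move/(congr1 (mulmx^~ A')); rewrite mul0mx -mulmxA AA' mulmx1 => /rowP/(_ i); rewrite !mxE.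
split=> [/andP[/eqP UE /freeE ft]|[fA UA]].
  by split=> // v; rewrite -UE spanE.
apply/andP; split; last exact/freeE.
by apply/eqP/vspaceP => v; rewrite spanE UA.
Qed.

Lemma rows_basis N k (U : {vspace 'rV[K]_N}) : \dim U = k ->
  exists A : 'M[K]_(k, N), row_free A /\ forall v, (v \in U) = (v <= A)%MS.
Proof. by move=> <-; exact: vspace_matrix. Qed.

Lemma gr_closureE N k (S : set {vspace 'rV[K]_N}) : S `<=` grassmannian k ->
  gr_closure k S = grassmannian k `&` [set U | forall f : {mpoly K[#|{ffun 'I_k -> 'I_N}|]},
    homogeneous f /\ (forall L, S L -> plucker_vanishes_at f L) -> plucker_vanishes_at f U].
Proof.
move=> Sgr; apply/seteqP; split=> [x|x [px vx] C [[F homF ->] SC]].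
  apply; split; last by move=> y Sy; split; [exact: Sgr | move=> f [_ fS]; exact: fS].
  by exists [set f | homogeneous f /\ (forall L, S L -> plucker_vanishes_at f L)] => // f [].
split=> // f Ff; apply: vx; split; first exact: homF.
by move=> y /SC[_]; apply.
Qed.

Section Complementary.
Variables (k k' : nat).

(** Moving the columns [J] to the end makes the matrix block triangular, so [c] is the sign of that
    permutation and [I] lists the other columns. If [J] repeats a column, two rows coincide and
    [c = 0]. *)
Lemma complementary_minor (J : 'I_k' -> 'I_(k + k')) : exists (c : K) (I : 'I_k -> 'I_(k + k')),
  forall A : 'M[K]_(k, k + k'), \det (col_mx A (rowsub J 1%:M)) = c * \det (colsub I A).
Proof.
have [injJ|] := pselect (injective J); last first.
  move=> /existsNP[i /existsNP[j /not_implyP[eqJ neij]]].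
  exists 0, (lshift k') => A; rewrite mul0r.
  apply: (determinant_alternate (i1 := rshift k i) (i2 := rshift k j)).
    by apply: contra_notN neij => /eqP/rshift_inj.
  by move=> l; rewrite !col_mxEd !mxE eqJ.
have cardC : #|~: [set J i | i in 'I_k']%SET| = k.
  by rewrite cardsCs finset.setCK card_imset // !card_ord addnK.
pose I (i : 'I_k) : 'I_(k + k') := enum_val (cast_ord (esym cardC) i).
have IJ i j : I i <> J j.
  move=> eqIJ; have := enum_valP (cast_ord (esym cardC) i).
  by rewrite -/(I i) eqIJ inE imset_f.
have injI : injective I by move=> i j /enum_val_inj /cast_ord_inj.
pose s0 (i : 'I_(k + k')) : 'I_(k + k') := match split i with inl a => I a | inr b => J b end.
have inj_s0 : injective s0.
  move=> i j; rewrite /s0 -{2}[i]splitK -{2}[j]splitK.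
  case: (split i) => a; case: (split j) => b /=.
  - by move/injI->.
  - by move/IJ.
  - by move/esym/IJ.
  - by move/injJ->.
pose s := perm inj_s0.
have sl a : s (lshift k' a) = I a by rewrite permE /s0 (unsplitK (inl a)).
have sr b : s (rshift k b) = J b by rewrite permE /s0 (unsplitK (inr b)).
exists ((-1) ^+ s), I => A; set M := col_mx _ _.
have -> : \det M = (-1) ^+ s * \det (col_perm s M).
  rewrite col_permE det_mulmx det_perm odd_permV mulrCA -expr2 sqrr_sign.
  by rewrite mulr1.
congr (_ * _).
have -> : col_perm s M = block_mx (colsub I A) (colsub J A) 0 1%:M.
  apply/matrixP => i j; rewrite -[i]splitK -[j]splitK.
  case: (split i) => a; case: (split j) => b /=.
  - by rewrite block_mxEul mxE sl /M col_mxEu !mxE.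
  - by rewrite block_mxEur mxE sr /M col_mxEu !mxE.
  - rewrite block_mxEdl mxE sl /M col_mxEd !mxE.
    by case: eqP => // eqJI; case: (IJ b a).
  - by rewrite block_mxEdr mxE sr /M col_mxEd !mxE (inj_eq injJ).
by rewrite det_ublock det1 mulr1.
Qed.

(** With [Q] a right inverse of [A], multiplying the stacked matrix by [row_mx Q B^T] gives a block
    lower triangular matrix with diagonal blocks the identity and the transpose of [colsub J B]. The
    common factor is the determinant of [row_mx Q B^T]. *)
Lemma dual_minors (U : {vspace 'rV[K]_(k + k')}) (A : 'M[K]_(k, k + k')) (B : 'M[K]_(k', k + k')) :
    row_free A -> (forall v, (v \in U) = (v <= A)%MS) ->
    row_free B -> (forall v, (v \in dual_subspace U) = (v <= B)%MS) ->
  exists2 c : K, c != 0 & forall J, \det (colsub J B) = c * \det (col_mx A (rowsub J 1%:M)).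
Proof.
move=> freeA UA freeB UB; have /row_freeP[Q AQ] := freeA.
pose M := row_mx Q B^T.
have AB : A *m B^T = 0.
  apply/row_matrixP => i; rewrite row_mul row0; apply: trmx_inj.
  rewrite trmx_mul trmxK trmx0; apply/row_matrixP => j; rewrite row_mul row0.
  have /mem_dual_subspace : row j B \in dual_subspace U by rewrite UB row_sub.
  by apply; rewrite UA row_sub.
have minor J : \det (colsub J B) = \det M * \det (col_mx A (rowsub J 1%:M)).
  rewrite mulrC -det_mulmx mul_col_row AQ AB det_lblock det1 mul1r -[LHS]det_tr.
  by rewrite trmx_mxsub mul_rowsub_mx mul1mx.
exists (\det M); last exact: minor.
have [J] := colsub_row_free freeB; rewrite minor.
by apply: contraNneq => ->; rewrite mul0r.
Qed.

Lemma dual_plucker_poly (f' : {mpoly K[#|{ffun 'I_k' -> 'I_(k + k')}|]}) : homogeneous f' ->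
  exists2 f : {mpoly K[#|{ffun 'I_k -> 'I_(k + k')}|]}, homogeneous f &
    forall U, \dim U = k ->
      plucker_vanishes_at f U <-> plucker_vanishes_at f' (dual_subspace U).
Proof.
move=> [d homf'].
have H (i : 'I_#|{ffun 'I_k' -> 'I_(k + k')}|) :=
  complementary_minor (enum_val i : {ffun 'I_k' -> 'I_(k + k')}).
have [c Hc] := choice H; have [I HI] := choice Hc.
pose g i : {mpoly K[#|{ffun 'I_k -> 'I_(k + k')}|]} := c i *: 'X_(enum_rank (finfun (I i))).
exists (msubst g f').
  by exists d; apply: msubst_homog => // i; rewrite rpredZ // dhomogX /= mdeg1.
move=> U dimU.
have dimU' : \dim (dual_subspace U) = k'.
  exact: dim_dual_eq dimU.
have key A B : basis_of U [seq row a A | a <- enum 'I_k] ->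
    basis_of (dual_subspace U) [seq row a B | a <- enum 'I_k'] ->
  exists2 e : K, e != 0 & f'.@[plucker B] = e * (msubst g f').@[plucker A].
  move=> /basis_of_rows[freeA UA] /basis_of_rows[freeB UB].
  have [e en0 eE] := dual_minors freeA UA freeB UB.
  exists (e ^+ d); first by rewrite expf_neq0.
  rewrite meval_subst -homog_scale //; apply: meval_eq => i.
  by rewrite pluckerE eE HI mevalZ mevalXU plucker_rank.
have [A0 /basis_of_rows UA0] := rows_basis dimU.
have [B0 /basis_of_rows UB0] := rows_basis dimU'.
split=> [fU B UB|f'U A UA].
  by have [e _ ->] := key A0 B UA0 UB; rewrite (fU A0 UA0) mulr0.
have [e en0] := key A B0 UA UB0; rewrite (f'U B0 UB0) => /esym/eqP.
by rewrite mulf_eq0 (negPf en0) => /eqP.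
Qed.

End Complementary.

Lemma dual_gr_closure N k k' (S : set {vspace 'rV[K]_N}) : (k + k')%N = N ->
    S `<=` grassmannian k ->
  [set dual_subspace L | L in gr_closure k S] =
  gr_closure k' [set dual_subspace L | L in S].
Proof.
move=> eqN; case: N / eqN S => S Sgr.
have S'gr : [set dual_subspace L | L in S] `<=` grassmannian k'.
  by move=> _ [L /Sgr dimL <-]; exact: dim_dual_eq dimL.
rewrite (gr_closureE Sgr) (gr_closureE S'gr); apply/seteqP; split.
  move=> _ [L [dimL vL] <-]; split; first exact: dim_dual_eq dimL.
  move=> f' [homf' f'S]; have [f homf fE] := dual_plucker_poly homf'.
  apply/fE => //; apply: vL; split=> // L' SL'; apply/fE; first exact: Sgr.
  by apply: f'S; exists L'.
move=> L' [dimL' vL']; exists (dual_subspace L'); last by rewrite dual_subspaceK.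
split; first by apply: dim_dual_eq dimL'; rewrite addnC.
move=> f [homf fS].
have [f' homf' fE] : exists2 f' : {mpoly K[#|{ffun 'I_k' -> 'I_(k + k')}|]}, homogeneous f' &
    forall U, \dim U = k' -> plucker_vanishes_at f' U <-> plucker_vanishes_at f (dual_subspace U).
  move: {S Sgr S'gr L' dimL' vL' fS} f homf; rewrite addnC => f homf.
  exact: dual_plucker_poly homf.
apply/fE => //; apply: vL'; split=> // _ [L SL <-]; apply/fE.
  exact: dim_dual_eq (Sgr _ SL).
by rewrite dual_subspaceK; exact: fS.
Qed.

End Plucker.

(** * Incidence varieties *)

Section Incidence.
Variables (K : closedFieldType) (N : nat).
Implicit Types (E : 'rV[K]_N -> 'rV[K]_N -> Prop) (w phi : 'rV[K]_N).

Definition incidence k E : set {vspace 'rV[K]_N} :=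
  [set L | \dim L = k /\ exists w phi, [/\ E w phi, w \in L & phi \in dual_subspace L]].

(** A vector [a] killed by [phi] is written as [phi M] with [M] alternating; then [phi' M] depends
    linearly on [phi'] and remains in its kernel for every [phi']. *)
Lemma skew_matrix (phi a : 'rV[K]_N) : phi != 0 -> phi *m a^T = 0 ->
  exists M : 'M[K]_N, phi *m M = a /\ forall psi : 'rV[K]_N, psi *m M *m psi^T = 0.
Proof.
move=> phin0 phia; have [i phii] := row_neq0_coord phin0.
pose e : 'rV[K]_N := delta_mx 0 i.
have eE (psi : 'rV[K]_N) : psi *m e^T = (psi 0 i)%:M.
  apply/rowP => j; rewrite ord1 !mxE (bigD1 i) //= big1 ?addr0 => [|l /negPf nli].
    by rewrite !mxE !eqxx mulr1 mulr1n.
  by rewrite !mxE nli andbF mulr0.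
exists ((phi 0 i)^-1 *: (e^T *m a - a^T *m e)); split=> [|psi].
  rewrite -scalemxAr mulmxBr !mulmxA phia mul0mx subr0 eE mul_scalar_mx.
  by rewrite scalerA mulVf // scale1r.
rewrite -scalemxAr -scalemxAl mulmxBr mulmxBl !mulmxA eE mul_scalar_mx -scalemxAl.
rewrite -[psi *m a^T *m e *m psi^T]mulmxA [e *m psi^T](_ : _ = (psi 0 i)%:M); last first.
  by apply: trmx_inj; rewrite trmx_mul trmxK eE tr_scalar_mx.
rewrite mul_mx_scalar [a *m psi^T](_ : _ = psi *m a^T) ?subrr ?scaler0 //.
by apply/rowP => j; rewrite !ord1 !mxE; apply: eq_bigr => l _; rewrite !mxE mulrC.
Qed.

(** A frame of L extends to a polynomial family of matrices over pairs [(w', phi')], with [w'] in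
    the row space and, on orthogonal pairs, all rows killed by [phi']. Composing [f] with the minors
    of this family gives a polynomial in the pair, to which the hypothesis comparing [E1] and [E2]
    applies. *)
Lemma incidence_vanishes E1 E2 k (f : {mpoly K[#|{ffun 'I_k -> 'I_N}|]}) :
    (forall w phi, E1 w phi -> phi *m w^T = 0) ->
    (forall w phi, E2 w phi -> w != 0 /\ phi != 0) ->
    (forall h : {mpoly K[N + N]},
      (forall w phi, E1 w phi -> h.@[glue (coords w) (coords phi)] = 0) ->
      forall w phi, E2 w phi -> h.@[glue (coords w) (coords phi)] = 0) ->
    (forall L, incidence k E1 L -> plucker_vanishes_at f L) ->
  forall L, incidence k E2 L -> plucker_vanishes_at f L.
Proof.
move=> orth1 nz2 sub fE1 L [dimL [w [phi [Ewp wL phiL]]]] A /basis_of_rows[freeA LA].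
have [wn0 phin0] := nz2 _ _ Ewp.
have /submxP[u wE] : (w <= A)%MS by rewrite -LA.
have [j0 uj0] : exists j, u 0 j != 0.
  by apply: row_neq0_coord; apply: contraNneq wn0 => u0; rewrite wE u0 mul0mx.
have phiA j : phi *m (row j A)^T = 0.
  by have /mem_dual_subspace := phiL; apply; rewrite LA row_sub.
have [M HM] := choice (fun j => skew_matrix phin0 (phiA j)).
(* a polynomial deformation of A through frames of the incidence variety *)
pose Phi : 'rV[{mpoly K[N + N]}]_N := \row_i 'X_(rshift N i).
pose W : 'rV[{mpoly K[N + N]}]_N := \row_i 'X_(lshift N i).
pose emb (B : 'M[K]_N) : 'M[{mpoly K[N + N]}]_N := map_mx (@mpolyC (N + N) K) B.
(* The coordinates of [w] in the frame are [u]. Rows other than [j0] move by the alternating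
   matrices; row [j0], where [u] is nonzero, is solved for so that [u] times the matrix is the
   moving [w']. *)
pose Apoly : 'M[{mpoly K[N + N]}]_(k, N) := \matrix_j
  if j == j0 then ((u 0 j0)^-1)%:MP *: (W - \sum_(j | j != j0) (u 0 j)%:MP *: (Phi *m emb (M j)))
  else Phi *m emb (M j).
pose At w' phi' : 'M[K]_(k, N) := map_mx (meval (glue (coords w') (coords phi'))) Apoly.
have PhiE w' phi' j : map_mx (meval (glue (coords w') (coords phi'))) (Phi *m emb (M j)) =
  phi' *m M j.
  rewrite map_mxM; congr (_ *m _); apply/matrixP => a b; rewrite !mxE /= ?mevalC //.
  by rewrite mevalXU gluer [a]ord1.
have WE w' phi' : map_mx (meval (glue (coords w') (coords phi'))) W = w'.
  by apply/matrixP => a b; rewrite !mxE /= mevalXU gluel [a]ord1.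
have row_At w' phi' j : row j (At w' phi') = if j == j0
    then (u 0 j0)^-1 *: (w' - \sum_(j | j != j0) u 0 j *: (phi' *m M j)) else phi' *m M j.
  rewrite /At -map_row rowK; case: (j == j0); last exact: PhiE.
  rewrite map_mxZ /= mevalC map_mxB WE raddf_sum; congr (_ *: (_ - _)).
  by apply: eq_bigr => l _; rewrite [LHS]/= map_mxZ /= mevalC PhiE.
have uAt w' phi' : u *m At w' phi' = w'.
  rewrite mulmx_sum_row (bigD1 j0) //= row_At eqxx scalerA mulfV // scale1r.
  rewrite [X in _ + X](eq_bigr (fun j => u 0 j *: (phi' *m M j))) ?subrK //.
  by move=> j /negPf nj; rewrite row_At nj.
have AtA : At w phi = A.
  apply/row_matrixP => j; rewrite row_At.
  have S : \sum_(j | j != j0) u 0 j *: (phi *m M j) = w - u 0 j0 *: row j0 A.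
    rewrite wE mulmx_sum_row [in RHS](bigD1 j0) //= addrAC subrr add0r.
    by apply: eq_bigr => l _; rewrite (HM l).1.
  case: eqP => [->|_]; last by rewrite (HM j).1.
  by rewrite S opprB addrC subrK scalerA mulVf // scale1r.
have phiAt w' phi' : phi' *m w'^T = 0 -> At w' phi' *m phi'^T = 0.
  move=> pw; apply/row_matrixP => j; rewrite row_mul row_At row0.
  case: (j == j0); last exact: (HM j).2.
  rewrite -scalemxAl mulmxBl (pairing_sym pw) sub0r mulmx_suml big1 ?oppr0 ?scaler0 //.
  by move=> l _; rewrite -scalemxAl (HM l).2 scaler0.
pose p (i : 'I_#|{ffun 'I_k -> 'I_N}|) : {mpoly K[N + N]} :=
  \det (colsub (enum_val i : {ffun 'I_k -> 'I_N}) Apoly).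
have pE w' phi' i : (p i).@[glue (coords w') (coords phi')] = plucker (At w' phi') i.
  by rewrite pluckerE /At -map_mxsub det_map_mx.
have [sigma minor] := colsub_row_free freeA.
rewrite -plucker_rank in minor; set i1 := enum_rank _ in minor.
(* The factor [p i1] is a minor nonzero at the original frame; it takes care of pairs where the
   family degenerates and spans no [k]-dimensional space. *)
have := sub (msubst p f * p i1) _ w phi Ewp.
have hE w' phi' : (msubst p f * p i1).@[glue (coords w') (coords phi')] =
    f.@[plucker (At w' phi')] * plucker (At w' phi') i1.
  rewrite mevalM meval_subst pE; congr (_ * _).
  by apply: meval_eq => i; rewrite pE.
rewrite hE AtA => H; apply/eqP; rewrite -(mulIr_eq0 _ (mulIf minor)); apply/eqP/H.
move=> w' phi' E1wp; rewrite hE.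
have [->|mn0] := eqVneq (plucker (At w' phi') i1) 0; first by rewrite mulr0.
have freeAt : row_free (At w' phi').
  by rewrite plucker_rank in mn0; exact: row_free_colsub mn0.
pose L' : {vspace 'rV[K]_N} := vspace_of [set v | (v <= At w' phi')%MS].
have L'E v : (v \in L') = (v <= At w' phi')%MS.
  apply/idP/idP; have HP := @vspace_ofP K N [set v | (v <= At w' phi')%MS] (sub0mx _ _).
    by move=> /HP; apply=> a x y xA yA; rewrite /= addmx_sub // scalemx_sub.
  by move=> vA; apply/HP => // a x y xA yA; rewrite /= addmx_sub // scalemx_sub.
rewrite (fE1 L') ?mul0r //; last exact/basis_of_rows.
split; first by rewrite (dim_row_space L'E); exact/eqP.
exists w', phi'; split=> //; first by rewrite L'E -{1}(uAt w' phi') submxMl.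
apply/mem_dual_subspace => v; rewrite L'E => /submxP[x ->]; apply: pairing_sym.
by rewrite -mulmxA phiAt ?mulmx0 //; exact: orth1.
Qed.

Lemma incidence_closure E1 E2 k :
    (forall w phi, E1 w phi \/ E2 w phi -> [/\ w != 0, phi != 0 & phi *m w^T = 0]) ->
    (forall h : {mpoly K[N + N]},
      (forall w phi, E1 w phi -> h.@[glue (coords w) (coords phi)] = 0) <->
      (forall w phi, E2 w phi -> h.@[glue (coords w) (coords phi)] = 0)) ->
  gr_closure k (incidence k E1) = gr_closure k (incidence k E2).
Proof.
move=> nz E12; have gr E : incidence k E `<=` grassmannian k by move=> L [].
rewrite !gr_closureE //; congr (_ `&` _); apply/seteqP.
have orth1 w phi : E1 w phi -> phi *m w^T = 0 by move=> H; have [] := nz w phi (or_introl H).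
have orth2 w phi : E2 w phi -> phi *m w^T = 0 by move=> H; have [] := nz w phi (or_intror H).
have nz1 w phi : E1 w phi -> w != 0 /\ phi != 0 by move=> H; have [] := nz w phi (or_introl H).
have nz2 w phi : E2 w phi -> w != 0 /\ phi != 0 by move=> H; have [] := nz w phi (or_intror H).
split=> U vU f [homf fE]; apply: vU; split=> //.
  by apply: (incidence_vanishes orth2 nz1 _ fE) => h /E12.
by apply: (incidence_vanishes orth1 nz2 _ fE) => h /E12.
Qed.

End Incidence.

(** * Associated varieties as incidences of conormal pairs, and the conclusion *)

Section Final.
Variables (K : closedFieldType) (N : nat).
Hypothesis charK0 : [pchar K] =i pred0.
Notation grad w := (gradient idfun (coords w)).
Implicit Types (X : set {vspace 'rV[K]_N}) (w phi : 'rV[K]_N).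

Definition conormal_pair X w phi :=
  [/\ w != 0, Reg X <[w]>%VS, phi != 0 & exists2 f, ideal_of X f & phi = grad w f].

Lemma conormal_pair_orth X w phi : conormal_pair X w phi -> phi *m w^T = 0.
Proof.
move=> [_ [Xw _] _ [f fX ->]].
have H := euler_ideal fX.
apply/rowP => j; rewrite ord1 [RHS]mxE -[RHS](H _ Xw w (memv_line w)) raddf_sum mxE.
by apply: eq_bigr => i _; rewrite /= mevalM mevalXU !mxE mulrC.
Qed.

(** The span of L and the tangent space is proper iff a nonzero form kills both, and the forms
    killing the tangent space are exactly the gradients, by [mem_dual_tangent_space]. *)
Lemma associated_incidence X L : X `<=` @proj_points K N ->
  (exists x, [/\ Reg X x, (x <= L)%VS & (\dim (L + tangent_space X x) < N)%N]) <->
  (exists w phi, [/\ conormal_pair X w phi, w \in L & phi \in dual_subspace L]).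
Proof.
move=> Xp; split=> [[x [regx xL dimLT]]|[w [phi [[wn0 regw phin0 [f fX phiE]] wL phiL]]]].
  have [w wn0 xE] := proj_pointP (Xp _ regx.1).
  set U := (L + _)%VS in dimLT; have dimU := dim_dual_subspace U.
  have dU0 : dual_subspace U != 0%VS.
    by rewrite -dimv_eq0; apply: contraTneq dimLT => d0; move: dimU; rewrite d0 add0n => ->;
      rewrite ltnn.
  have phiU := memv_pick (dual_subspace U); set phi := vpick _ in phiU.
  have phin0 : phi != 0 by rewrite vpick0.
  have : phi \in dual_subspace (tangent_space X <[w]>%VS).
    by rewrite -xE; apply: (subvP (dual_subspaceS _)) phiU; exact: addvSr.
  move=> /mem_dual_tangent_space[f fX phiE]; exists w, phi; split.
  - by split=> //; [rewrite -xE | exists f].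
  - by apply: (subvP xL); rewrite xE memv_line.
  - by apply: (subvP (dual_subspaceS _)) phiU; exact: addvSl.
exists <[w]>%VS; split=> //.
have phiT : phi \in dual_subspace (tangent_space X <[w]>%VS).
  by apply/mem_dual_tangent_space; exists f.
have sub : (L + tangent_space X <[w]> <= dual_subspace <[phi]>)%VS.
  have le_dual V : phi \in dual_subspace V -> (V <= dual_subspace <[phi]>)%VS.
    by rewrite memvE => /dual_subspaceS; rewrite dual_subspaceK.
  by rewrite subv_add !le_dual.
apply: leq_ltn_trans (dimvS sub) _.
have := dim_dual_subspace <[phi]>%VS; rewrite dim_vline phin0 addn1 => dimH.
by rewrite -[X in (_ < X)%N]dimH.
Qed.

(** Conormal pairs leave out [phi = 0]. Multiplying [h] by a fibre coordinate outside the conormal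
    ideal gives vanishing there too, and primality removes the factor. *)
Lemma conormal_pair_ideal X h : irreducible_variety X ->
    (exists i, ~ conormal_ideal X 'X_(rshift N i)) ->
  (forall w phi, conormal_pair X w phi -> h.@[glue (coords w) (coords phi)] = 0) <->
  conormal_ideal X h.
Proof.
move=> irrX [i0 ni0]; split=> [H|hX w phi [wn0 regw _ [f fX ->]]]; last first.
  exact: (conormal_regular charK0 irrX h).1.
have [_ _ PP] := conormal_prime (irreducible_ideal_prime irrX).
suff /PP[] : conormal_ideal X (h * 'X_(rshift N i0)) by [].
apply/(conormal_regular charK0 irrX) => w f wn0 regw fX; rewrite mevalM mevalXU gluer.
have [->|gn0] := eqVneq (grad w f) 0; first by rewrite mxE mulr0.
by rewrite H ?mul0r //; split=> //; exists f.
Qed.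

End Final.

Theorem lemma3 (K : closedFieldType) (charK0 : [pchar K] =i pred0)
    (n : nat) (X : set {vspace 'rV[K]_n.+1}) (irrX : irreducible_variety X)
    (l : nat) (ltln : (l < n)%N) :
  [set dual_subspace L | L in associated_variety l X] =
  associated_variety (n - l - 1) (dual_variety X).
Proof.
set Z := dual_variety X; set k := (n - l - 1).+1.
have eqk : (l.+1 + k)%N = n.+1 by rewrite /k subn1 prednK ?subn_gt0 // addSn subnKC // ltnW.
pose E1 := conormal_pair X; pose E2 w phi := conormal_pair Z phi w.
have Zp : Z `<=` @proj_points K n.+1.
  by move=> x xZ; have := xZ; rewrite /Z /dual_variety proj_closureE;
    [case | exact: dual_points_proj].
have -> : associated_variety l X = gr_closure l.+1 (incidence l.+1 E1).
  congr gr_closure; apply/seteqP; split=> L [dimL H]; split=> //.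
    exact/(associated_incidence _ (irreducible_points irrX)).
  exact/(associated_incidence _ (irreducible_points irrX)).
have -> : associated_variety (n - l - 1) Z =
    gr_closure k [set dual_subspace L | L in incidence l.+1 E2].
  congr gr_closure; apply/seteqP; split=> [L [dimL /(associated_incidence _ Zp)]|].
    move=> [w [phi [Ewp wL phiL]]]; exists (dual_subspace L); last by rewrite dual_subspaceK.
    split; first by apply: (dim_dual_eq _ dimL); rewrite addnC.
    by exists phi, w; rewrite dual_subspaceK; split.
  move=> _ [L [dimL [w [phi [Ewp wL phiL]]]] <-]; split; first exact: dim_dual_eq dimL.
  by apply/(associated_incidence _ Zp); exists phi, w; rewrite dual_subspaceK.
have grE E : incidence l.+1 E `<=` @grassmannian K n.+1 l.+1 by move=> L [].
rewrite -(dual_gr_closure eqk (grE E2)); congr [set dual_subspace L | L in _].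
apply: incidence_closure => [w phi [Ewp|Ewp]|h].
- by have [wn0 _ phin0 _] := Ewp; split=> //; exact: conormal_pair_orth Ewp.
- have [wn0 _ phin0 _] := Ewp; split=> //; apply: pairing_sym; exact: conormal_pair_orth Ewp.
have primeX := irreducible_ideal_prime irrX.
(* Without tangent hyperplanes, as when X is the whole space, there is no conormal pair of X and the
   dual variety is empty, so both relations are empty. *)
have [S0|/set0P Sn0] := eqVneq (dual_points X) set0.
  split=> _ w phi; last first.
    move=> [wn0 regw phin0 [f fX phiE]].
    have : dual_points X <[phi]>%VS by apply/dual_pointsP => //; exists w, f; rewrite -phiE.
    by rewrite S0.
  by move=> [_ [+ _] _ _]; rewrite /Z dual_variety_empty.
have irrZ : irreducible_variety Z by exact: dual_variety_irreducible.
have dualZ g : ideal_of Z g <-> conormal_ideal X (fiber_poly g) by exact: dual_variety_ideal.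
have duality := conormal_duality charK0 primeX dualZ.
have nX : exists i, ~ conormal_ideal X 'X_(rshift n.+1 i).
  have [y /dual_pointsP-/(_ irrX)[w [f [wn0 regw fX gn0 _]]]] := Sn0.
  apply: contrapT => H; case/eqP: gn0; apply/rowP => i; rewrite [RHS]mxE.
  have : conormal_ideal X 'X_(rshift n.+1 i) by apply: contrapT => nc; apply: H; exists i.
  by move/(conormal_regular charK0 irrX)/(_ w f wn0 regw fX); rewrite mevalXU gluer.
(* Otherwise, by duality, every base coordinate would vanish on X, contradicting a nonzero vector of
   its cone. *)
have nZ : exists i, ~ conormal_ideal Z 'X_(rshift n.+1 i).
  have [_ [x Xx] _] := irrX; have [v vn0 xE] := proj_pointP (irreducible_points irrX Xx).
  apply: contrapT => H; case/eqP: vn0; apply/rowP => i; rewrite mxE.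
  have /duality : conormal_ideal Z (swap_poly 'X_(lshift n.+1 i)).
    by rewrite /swap_poly msubstX gluel; apply: contrapT => nc; apply: H; exists i.
  have <- : base_poly 'X_i = 'X_(lshift n.+1 i) :> {mpoly K[n.+1 + n.+1]} by rewrite /base_poly
    msubstX.
  move/(conormal_base primeX)/(_ x Xx v); rewrite xE memv_line mevalXU; exact.
rewrite (conormal_pair_ideal charK0 h irrX nX) duality -(conormal_pair_ideal charK0 _ irrZ nZ).
have swapE (w phi : 'rV[K]_n.+1) :
  (swap_poly h).@[glue (coords phi) (coords w)] = h.@[glue (coords w) (coords phi)].
  rewrite /swap_poly meval_subst; apply: meval_eq => i; rewrite -[i]splitK.
  by case: (split i) => j /=; rewrite ?gluel ?gluer mevalXU ?gluel ?gluer.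
by split=> H w phi; [move=> /H; rewrite swapE | rewrite swapE; exact: H].
Qed.
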